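(* Let $c\ge2$, $t\ge2$, and let $\mathcal{A}$ be a $t\times(t+c-1)$ homogeneous matrix whose entries are general forms of degrees $d_{ij}>0$. Let $I=I_t(\mathcal{A})$, $J=I_{t-1}(\mathcal{A})$, and let $X\subset\mathbb{P}^n$ be the standard determinantal scheme of codimension $c$ associated to $\mathcal{A}$. Assume $n\ge2c-2$. Then: (1) $\operatorname{depth}_{\mathfrak{m}}I/I^2=n-2c+2$. (2) If $n\ge2c+1$, then $\operatorname{depth}_JI/I^2\ge3$; if $n\le2c$, then $\operatorname{depth}_JI/I^2=n-2c+2$. Therefore, if $n\ge2c$, there is a closed subset $Z\subset X$ such that $X\setminus Z\hookrightarrow\mathbb{P}^n$ is a local complete intersection and $\operatorname{depth}_{I(Z)}I/I^2\ge2$.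
   Context: $K$ is an algebraically closed field of characteristic $0$, $R=K[x_0,\dots,x_n]$ with its standard grading, $\mathfrak{m}=(x_0,\dots,x_n)$, $\mathbb{P}^n=\operatorname{Proj}(R)$. For a homogeneous matrix $\mathcal{A}$, $I_j(\mathcal{A})$ is the ideal of $R$ generated by its $j\times j$ minors. A codimension $c$ subscheme $X\subset\mathbb{P}^n$ is standard determinantal if its saturated ideal is $I(X)=I_t(\mathcal{A})$ for some $t\times(t+c-1)$ homogeneous matrix $\mathcal{A}$, i.e. a matrix representing a graded (degree $0$) morphism $\bigoplus_{j=1}^{t+c-1}R(-a_j)\to\bigoplus_{i=1}^tR(-b_i)$, so that $d_{ij}=a_j-b_i$. ''General forms'' means that the matrix belongs to a suitable non-empty Zariski open subset of the space of matrices with the given entry degrees. For a homogeneous ideal $\mathfrak{a}$ and a finitely generated graded module $N$, $\operatorname{depth}_{\mathfrak{a}}N$ is the length of a maximal $N$-regular sequence in $\mathfrak{a}$. $I(Z)$ is the saturated homogeneous ideal of $Z$, with $I(Z)=\mathfrak{m}$ if $Z=\emptyset$. *)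

(* Defs.v *)
From HB Require Import structures.
From mathcomp Require Import all_boot all_order all_algebra fraction.
From mathcomp Require Import boolp classical_sets.
From mathcomp Require Import mpoly.

Set Implicit Arguments.
Unset Strict Implicit.
Unset Printing Implicit Defensive.

Import GRing.Theory.
Local Open Scope ring_scope.
Local Open Scope classical_set_scope.
Local Open Scope quotient_scope.

Local Notation "x %:F" := (tofrac x).

(* Ideals and submodules are boolean predicates (classically, all subsets). *)

Section Submodules.
Variables (R : comNzRingType) (V : lmodType R).

Definition submod_gen (S : set V) : {pred V} := fun v =>
  `[< exists (k : nat) (r : 'I_k -> R) (x : 'I_k -> V),
        (forall i, S (x i)) /\ v = \sum_(i < k) r i *: x i >].

Lemma submod_gen_closed S : submod_closed (submod_gen S).
Proof.
split; first by apply/asboolP; exists 0%N, (fun=> 0), (fun=> 0); split=> [[]|];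
  rewrite ?big_ord0.
move=> a _ _ /asboolP[k [r [x [Sx ->]]]] /asboolP[l [q [y [Sy ->]]]].
apply/asboolP; exists (k + l)%N.
exists (fun i => match split i with inl j => a * r j | inr j => q j end).
exists (fun i => match split i with inl j => x j | inr j => y j end).
split=> [i|]; first by case: (split i).
rewrite big_split_ord scaler_sumr /=; congr (_ + _); apply: eq_bigr => i _.
  by rewrite (unsplitK (inl i)) scalerA.
by rewrite (unsplitK (inr i)).
Qed.

HB.instance Definition _ S :=
  GRing.isSubmodClosed.Build R V (submod_gen S) (submod_gen_closed S).

Definition ideal_smul (a : {pred R}) : {pred V} :=
  submod_gen [set y | exists r x, r \in a /\ y = r *: x].

HB.instance Definition _ a := GRing.SubmodClosed.on (ideal_smul a).

Variable S : submodClosed V.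

Record submodule := Submodule { submod_val : V; _ : submod_val \in S }.

HB.instance Definition _ := [isSub for submod_val].
HB.instance Definition _ := [Choice of submodule by <:].
HB.instance Definition _ := [SubChoice_isSubLmodule of submodule by <:].

Definition submod_pred : {pred V} := fun v => v \in S.

Lemma submod_pred_closed : zmod_closed submod_pred.
Proof.
split=> [|u v Su Sv]; first exact: rpred0.
by rewrite unfold_in addrC -scaleN1r; apply: rpredD => //; apply: rpredZ.
Qed.

HB.instance Definition _ :=
  GRing.isZmodClosed.Build V submod_pred submod_pred_closed.

Definition quotient_module := {ideal_quot submod_pred}.

HB.instance Definition _ := GRing.Zmodule.on quotient_module.

Definition quotient_scale (r : R) (x : quotient_module) : quotient_module :=
  \pi_{ideal_quot submod_pred} (r *: repr x).

Lemma quotient_scale_pi r v :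
  quotient_scale r (\pi_{ideal_quot submod_pred} v) = \pi_{ideal_quot submod_pred} (r *: v).
Proof.
apply/eqP; rewrite /quotient_scale -Quotient.idealrBE -scalerBr.
apply: (@rpredZ _ _ S); rewrite -[_ \in _]/(_ \in submod_pred).
by rewrite Quotient.idealrBE reprK.
Qed.

Fact quotient_scaleA r s x :
  quotient_scale r (quotient_scale s x) = quotient_scale (r * s) x.
Proof. by rewrite {2}/quotient_scale quotient_scale_pi scalerA. Qed.

Fact quotient_scale1 : left_id 1 quotient_scale.
Proof. by move=> x; rewrite /quotient_scale scale1r; exact: reprK. Qed.

Fact quotient_scaleDr : right_distributive quotient_scale +%R.
Proof.
move=> r x y; rewrite -[x]reprK -[y]reprK /=.
have piD u v : (\pi_{ideal_quot submod_pred} u : quotient_module) + \pi v =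
  \pi_{ideal_quot submod_pred} (u + v) by rewrite !piE.
by rewrite piD !quotient_scale_pi piD scalerDr.
Qed.

Fact quotient_scaleDl x : {morph quotient_scale^~ x : r s / r + s}.
Proof. by move=> r s; rewrite /quotient_scale scalerDl !piE. Qed.

HB.instance Definition _ := GRing.Zmodule_isLmodule.Build R quotient_module
  quotient_scaleA quotient_scale1 quotient_scaleDr quotient_scaleDl.

End Submodules.

Arguments ideal_smul {R} V a.

Section Depth.
Variable R : comNzRingType.

Definition ideal_gen (S : set R) : {pred R} := submod_gen (S : set R^o).

HB.instance Definition _ S :=
  GRing.SubmodClosed.copy (ideal_gen S : R^o -> bool)
                          (submod_gen (S : set R^o)).

(* I/I^2 is the quotient of the R-module I by its submodule I.I *)
Definition conormal (I : submodClosed R^o) : lmodType R :=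
  quotient_module (ideal_smul (submodule I) (I : {pred R})).

Variable N : lmodType R.

Definition regular_seq (s : seq R) : Prop :=
  (forall i, (i < size s)%N -> forall x : N,
     s`_i *: x \in ideal_smul N (mem (take i s)) ->
     x \in ideal_smul N (mem (take i s))) /\
  exists x : N, x \notin ideal_smul N (mem s).

Definition max_regular_seq (a : {pred R}) (s : seq R) : Prop :=
  [/\ {subset s <= a}, regular_seq s &
      forall f, f \in a -> ~ regular_seq (rcons s f)].

End Depth.

(* depth_a N = d.  For R noetherian and N finitely generated with aN != N, all
   maximal N-regular sequences in a have the same length (Rees). *)
Definition is_depth (R : comNzRingType) (a : {pred R}) (N : lmodType R)
    (d : nat) : Prop :=
  exists2 s : seq R, max_regular_seq N a s & size s = d.

Definition depth_ge (R : comNzRingType) (a : {pred R}) (N : lmodType R)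
    (k : nat) : Prop :=
  exists2 d, is_depth a N d & (k <= d)%N.

Section Height.
Variable R : comNzRingType.

Definition prime_chain (k : nat) (Q : prime_idealr R) : Prop :=
  exists P : 'I_k.+1 -> prime_idealr R,
    (forall i j : 'I_k.+1, (i < j)%N ->
       {subset (P i : {pred R}) <= (P j : {pred R})} /\
       exists2 f, f \in (P j : {pred R}) & f \notin (P i : {pred R})) /\
    (P ord_max : {pred R}) =i (Q : {pred R}).

(* The height of I is the minimum of the heights of the primes containing I. *)
Definition is_height (I : {pred R}) (h : nat) : Prop :=
  (forall Q : prime_idealr R, {subset I <= (Q : {pred R})} ->
     prime_chain h Q) /\
  exists2 Q : prime_idealr R, {subset I <= (Q : {pred R})} &
     ~ prime_chain h.+1 Q.

End Height.

Section Projective.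
Variables (K : fieldType) (n : nat).
Local Notation R := {mpoly K[n.+1]}.

Definition irrelevant : {pred R} := ideal_gen (range (fun i => 'X_i : R)).

Definition saturated (I : {pred R}) : Prop :=
  forall f, (exists k : nat, forall m : 'X_{1..n.+1}, mdeg m = k ->
               'X_[m] * f \in I) -> f \in I.

(* The points of the scheme P^n = Proj R. *)
Record proj_point := ProjPoint {
  point_ideal :> prime_idealr R;
  point_homog : forall f d, f \in (point_ideal : {pred R}) ->
        pihomog mdeg d f \in (point_ideal : {pred R});
  point_relevant : exists i, 'X_i \notin (point_ideal : {pred R}) }.

(* The set of points of Proj (R/I). *)
Definition proj_zeros (I : {pred R}) : set proj_point :=
  [set x | {subset I <= (point_ideal x : {pred R})}].

Definition proj_closed (Z : set proj_point) : Prop :=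
  exists2 S : set R, (forall f, S f -> exists d, f \is d.-homog) &
    Z = [set x | forall f, S f -> f \in (point_ideal x : {pred R})].

(* The ideal of Z with its reduced structure.  Membership in the irrelevant
   ideal is automatic for nonempty Z and gives I(set0) = irrelevant. *)
Definition vanishing_ideal (Z : set proj_point) : {pred R} := fun f =>
  (f \in irrelevant) &&
  `[< forall x, Z x -> f \in (point_ideal x : {pred R}) >].

Section Stalks.
Variable x : proj_point.
Local Notation P := (point_ideal x : {pred R}).

Definition in_stalk (I : {pred R}) : {pred {fraction R}} := fun u =>
  `[< exists (d : nat) (f g : R), [/\ f \is d.-homog, g \is d.-homog,
        f \in I, g \notin P & u = f%:F / g%:F] >].

Definition local_ring_pred : {pred {fraction R}} := in_stalk predT.

Lemma local_ring_pred_closed : subring_closed local_ring_pred.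
Proof.
have nz (g : R) : g \notin P -> g%:F != 0 :> {fraction R}.
  by apply: contraNneq => /eqP; rewrite tofrac_eq0 => /eqP ->; exact: idealr0.
split.
- apply/asboolP; exists 0%N, 1, 1.
  by rewrite dhomog1 idealr1 tofrac1 divr1.
- move=> u v /asboolP[d [f [g [hf hg _ Pg ->]]]].
  move=> /asboolP[e [p [q [hp hq _ Pq ->]]]]; apply/asboolP.
  exists (d + e)%N, (f * q - g * p), (g * q); split=> //.
  + by apply: rpredB; apply: dhomogM.
  + exact: dhomogM.
  + by rewrite prime_idealrM negb_or Pg.
  + rewrite tofracB !tofracM -mulNr addf_div ?nz // mulNr.
    by rewrite [p%:F * _]mulrC.
- move=> u v /asboolP[d [f [g [hf hg _ Pg ->]]]].
  move=> /asboolP[e [p [q [hp hq _ Pq ->]]]]; apply/asboolP.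
  exists (d + e)%N, (f * p), (g * q); split=> //; try exact: dhomogM.
  + by rewrite prime_idealrM negb_or Pg.
  + by rewrite !tofracM mulf_div.
Qed.

HB.instance Definition _ :=
  GRing.isSubringClosed.Build {fraction R} local_ring_pred
    local_ring_pred_closed.

(* O_{P^n,x}: the degree-0 part of the homogeneous localization at x *)
Record local_ring := LocalRing {
  local_val : {fraction R}; _ : local_val \in local_ring_pred }.

HB.instance Definition _ := [isSub for local_val].
HB.instance Definition _ := [Choice of local_ring by <:].
HB.instance Definition _ := [SubChoice_isSubComNzRing of local_ring by <:].

(* The stalk at x of the ideal sheaf of Proj (R/I) in P^n. *)
Definition ideal_stalk (I : {pred R}) : {pred local_ring} :=
  fun u => local_val u \in in_stalk I.

Definition lci_at (I : {pred R}) : Prop :=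
  exists2 s : seq local_ring, regular_seq (local_ring^o) s &
    ideal_gen [set` s] =i ideal_stalk I.

End Stalks.

(* Proj (R/I) \ Z -> P^n is a local complete intersection *)
Definition lci_outside (I : {pred R}) (Z : set proj_point) : Prop :=
  forall x, proj_zeros I x -> ~ Z x -> lci_at x I.

End Projective.

Section Matrices.
Variables (K : fieldType) (k p q : nat).
Local Notation R := {mpoly K[k]}.

Definition homogeneous_mx (d : 'I_p -> 'I_q -> nat) (A : 'M[R]_(p, q)) : Prop :=
  forall i j, A i j \is (d i j).-homog.

(* Polynomial functions in the coefficients of the entries of A. *)
Definition polynomial_fun (f : 'M[R]_(p, q) -> K) : Prop :=
  exists (N : nat) (w : 'I_N -> 'I_p * 'I_q * 'X_{1..k}) (P : {mpoly K[N]}),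
    forall A, f A = P.@[fun l => (A (w l).1.1 (w l).1.2)@_((w l).2)].

(* Open subsets of the affine space of homogeneous matrices of degrees d. *)
Definition zariski_open (d : 'I_p -> 'I_q -> nat) (U : set 'M[R]_(p, q))
    : Prop :=
  exists2 F : set ('M[R]_(p, q) -> K), (forall f, F f -> polynomial_fun f) &
    U = [set A | homogeneous_mx d A /\ exists2 f, F f & f A != 0].

(* Reordering the chosen rows and columns only changes signs. *)
Definition minors (j : nat) (A : 'M[R]_(p, q)) : set R :=
  [set \det (mxsub f.1 f.2 A) |
     f in [set f : ('I_j -> 'I_p) * ('I_j -> 'I_q) |
             injective f.1 /\ injective f.2]].

Definition minors_ideal (j : nat) (A : 'M[R]_(p, q)) : {pred R} :=
  ideal_gen (minors j A).

HB.instance Definition _ j A :=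
  GRing.SubmodClosed.copy (minors_ideal j A : R^o -> bool)
                          (submod_gen (minors j A : set R^o)).

End Matrices.

(* Proj (R/I_t(A)) is standard determinantal of codimension c, with saturated
   ideal I_t(A). *)
Definition standard_determinantal (K : fieldType) (n t c : nat)
    (A : 'M[{mpoly K[n.+1]}]_(t, (t + c).-1)) : Prop :=
  saturated (minors_ideal t A) /\ is_height (minors_ideal t A) c.

(* Main.v *)
(* I and I^2 are resolved simultaneously on the Fock space S_r of r copies of F (fermions) and
   G (bosons), for r = 1, 2, where A : F -> G: the differential is the sum over i, u of
   (A delta_u)_i gamma_iu, it commutes with gl_r, and its gl_r-singular vectors of weight t form
   a complex with H_0 = R/I^r.  For r = 1 this is the Eagon-Northcott complex, of length c; for
   r = 2 its length is 2c-1.  Inverting a t-minor (resp. a (t-1)-minor) contracts it, up to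
   powers of the minor, in positive degrees (resp. beyond degree c), so it is exact as soon as I
   and J have grades c and 2c-1.
   Depth sensitivity of exact complexes then yields regular elements on R/I and R/I^2, hence
   on I/I^2, as long as the grade of J (or m) modulo the sequence exceeds 2c-1; conversely a
   longer regular sequence in m would make the resolution of R/I^2 split off its last term,
   which a nonzero socle vector at its end forbids.
   The grades of I and J are maximal for a general matrix: that powers of the variables lie in
   I_k(A) modulo the remaining variables is an open condition, and an explicit band matrix
   satisfies it.  Finally Z is the zero locus of J: where a (t-1)-minor is invertible, I is
   generated by the c minors bordering it, and prime avoidance turns them into a regular
   sequence. *)

(* The constants compare lengths with grades. The resolution for r = 2 has length 2c-1, a general J
   has grade min(n+1, 2c+2), and m has grade n+1: the surplus is min(n-2c+2, 3) for J and n-2c+2 for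
   m. Schur functors are avoided. Singular vectors are cut out by linear equations, and in
   characteristic 0 the extremal projector of gl_2 makes them a direct summand of the weight
   vectors. This lets the complex be reduced modulo an ideal, and it carries homotopies of the Fock
   space, which do not commute with gl_2, over to singular vectors. Quotients and localizations are
   never formed: ideals are predicates, exactness modulo [a] means coordinates in [a], and inverting
   a minor [w] means working up to powers of [w]. The obstacle is that a (t-1)-minor contracts the
   complex for r = 2 only beyond degree c. Hence the acyclicity lemma is used twice: with the minor
   inverted, the grade of I settles the degrees up to c, so the homology is J-torsion; then the
   grade of J removes it. *)
Require Import Defs.
From HB Require Import structures.
From mathcomp Require Import all_boot all_order all_algebra fraction.
From mathcomp Require Import perm boolp zify.
From mathcomp Require Import mpoly.
Set Implicit Arguments. Unset Strict Implicit. Unset Printing Implicit Defensive.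
Import Order.TTheory GRing.Theory Num.Theory.
Local Open Scope ring_scope.

(** * Identities in commutative rings *)

(* Both sides are expanded into signed monomials, which are compared as multisets. *)
Inductive ring_expr : Type :=
  | RVar of nat | RZero | ROne | RAdd of ring_expr & ring_expr
  | RMul of ring_expr & ring_expr | ROpp of ring_expr.

Fixpoint ring_monomials (e : ring_expr) : seq (bool * seq nat) :=
  match e with
  | RVar i => [:: (false, [:: i])]
  | RZero => [::]
  | ROne => [:: (false, [::])]
  | RAdd a b => ring_monomials a ++ ring_monomials b
  | RMul a b =>
    [seq (x.1 (+) y.1, sort leq (x.2 ++ y.2)) | x <- ring_monomials a, y <- ring_monomials b]
  | ROpp a => [seq (~~ x.1, x.2) | x <- ring_monomials a]
  end.

Definition ring_expr_eq (e1 e2 : ring_expr) : bool :=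
  let l := ring_monomials (RAdd e1 (ROpp e2)) in
  perm_eq [seq x.2 | x <- l & x.1] [seq x.2 | x <- l & ~~ x.1].

Section Eval.
Variables (R : comPzRingType) (l : seq R).

Fixpoint ring_eval (e : ring_expr) : R :=
  match e with
  | RVar i => nth 0 l i
  | RZero => 0
  | ROne => 1
  | RAdd a b => ring_eval a + ring_eval b
  | RMul a b => ring_eval a * ring_eval b
  | ROpp a => - ring_eval a
  end.

Lemma ring_evalE e : ring_eval e =
  \sum_(x <- ring_monomials e) (-1) ^+ x.1 * \prod_(i <- x.2) nth 0 l i.
Proof.
elim: e => [i|||a IHa b IHb|a IHa b IHb|a IHa] /=; rewrite ?IHa ?IHb.
- by rewrite big_seq1 big_seq1 mul1r.
- by rewrite big_nil.
- by rewrite big_seq1 big_nil mulr1.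
- by rewrite big_cat.
- rewrite big_allpairs_dep mulr_suml; apply: eq_bigr => x _; rewrite mulr_sumr.
  apply: eq_bigr => y _ /=; rewrite (perm_big _ (permEl (perm_sort _ _))) big_cat /=.
  by rewrite signr_addb mulrACA.
- rewrite big_map -sumrN; apply: eq_bigr => x _ /=.
  by rewrite signrN mulNr.
Qed.

Lemma ring_expr_eqP e1 e2 : ring_expr_eq e1 e2 -> ring_eval e1 = ring_eval e2.
Proof.
move=> h; apply/eqP; rewrite -subr_eq0 -[_ - _]/(ring_eval (RAdd e1 (ROpp e2))) ring_evalE.
rewrite (bigID (fun x => x.1)) /= addrC -big_filter -[X in _ + X]big_filter.
set p := [seq x <- _ | _]; set q := [seq x <- _ | _].
rewrite (eq_big_seq (fun x => \prod_(i <- x.2) nth 0 l i)) => [|x]; last first.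
  by rewrite mem_filter; case: x => -[] m //= _; rewrite mul1r.
rewrite [X in _ + X](eq_big_seq (fun x => - \prod_(i <- x.2) nth 0 l i)) => [|x]; last first.
  by rewrite mem_filter; case: x => -[] m //= _; rewrite expr1 mulN1r.
rewrite sumrN subr_eq0 -(big_map snd xpredT (fun s => \prod_(i <- s) nth 0 l i)).
rewrite -[X in _ == X](big_map snd xpredT (fun s => \prod_(i <- s) nth 0 l i)).
by rewrite (perm_big _ h).
Qed.
End Eval.

(** Atoms are compared by [unify], so subterms that are merely convertible share one variable. *)
Ltac ring_atoms l t :=
  lazymatch t with
  | @GRing.add _ ?a ?b => let l := ring_atoms l a in ring_atoms l b
  | @GRing.mul _ ?a ?b => let l := ring_atoms l a in ring_atoms l b
  | @GRing.opp _ ?a => ring_atoms l a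
  | @GRing.zero _ => l
  | @GRing.one _ => l
  | _ => let rec mem m := lazymatch m with
           | nil => constr:(cons t l)
           | cons ?u ?m' => match goal with
             | _ => let _ := match goal with _ => unify u t end in l
             | _ => mem m' end
           end in mem l
  end.
Ltac ring_index l t :=
  lazymatch l with
  | cons ?u ?l' => match goal with
    | _ => let _ := match goal with _ => unify u t end in constr:(O)
    | _ => let i := ring_index l' t in constr:(S i) end
  end.
Ltac ring_reify l t :=
  lazymatch t with
  | @GRing.add _ ?a ?b => let a := ring_reify l a in let b := ring_reify l b in constr:(RAdd a b)
  | @GRing.mul _ ?a ?b => let a := ring_reify l a in let b := ring_reify l b in constr:(RMul a b)
  | @GRing.opp _ ?a => let a := ring_reify l a in constr:(ROpp a)
  | @GRing.zero _ => constr:(RZero)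
  | @GRing.one _ => constr:(ROne)
  | _ => let i := ring_index l t in constr:(RVar i)
  end.
Ltac ring :=
  intros;
  lazymatch goal with |- @eq ?T ?x ?y =>
    let l := ring_atoms (@nil T) x in
    let l := ring_atoms l y in
    let e1 := ring_reify l x in
    let e2 := ring_reify l y in
    exact (@ring_expr_eqP _ (l : seq (GRing.PzRing.sort _)) e1 e2 (erefl true : is_true _))
  end.

Goal forall (R : idomainType) (x y z : R), (x + y) * (z - 1) = - y + z * x + z * y - x * 1.
Proof. by move=> R x y z; ring. Qed.

(** * Fermions and the Fock space *)

Section Fermions.
Variables (R : comNzRingType) (T : finType) (W : lmodType R).
Local Notation V := {ffun {set T} -> W}.

(** The Jordan-Wigner sign: the parity of the occupied modes preceding [x] makes operators of
    different modes anticommute. *)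
Definition below (x : T) (S : {set T}) : bool :=
  odd #|[set y in S | (enum_rank y < enum_rank x)%N]|.

(** Vectors are stored as coefficient functions, so contraction reads its coefficient at [S] from
    [x |: S]. *)
Definition annih (x : T) (phi : V) : V :=
  [ffun S : {set T} => if x \in S then 0 else (-1) ^+ below x S *: phi (x |: S)].

Definition create (x : T) (phi : V) : V :=
  [ffun S : {set T} => if x \in S then (-1) ^+ below x S *: phi (S :\ x) else 0].

Fact annih_linear x : linear (annih x).
Proof.
move=> a f g; apply/ffunP=> S; rewrite !ffunE; case: ifP => _.
  by rewrite scaler0 addr0.
by rewrite scalerDr !scalerA mulrC.
Qed.
HB.instance Definition _ x := GRing.isLinear.Build R V V *:%R (annih x) (annih_linear x).

Fact create_linear x : linear (create x).
Proof.
move=> a f g; apply/ffunP=> S; rewrite !ffunE; case: ifP => _.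
  by rewrite scalerDr !scalerA mulrC.
by rewrite scaler0 addr0.
Qed.
HB.instance Definition _ x := GRing.isLinear.Build R V V *:%R (create x) (create_linear x).

Lemma belowU x y (S : {set T}) : y \notin S ->
  below x (y |: S) = below x S (+) (enum_rank y < enum_rank x)%N.
Proof.
move=> yS; rewrite /below; case: ltnP => h.
  have -> : [set z in y |: S | (enum_rank z < enum_rank x)%N] =
     y |: [set z in S | (enum_rank z < enum_rank x)%N].
    by apply/setP=> z; rewrite !inE; case: eqVneq => [->|]; rewrite ?h.
  by rewrite cardsU1 !inE (negbTE yS) /= addbT.
rewrite addbF; congr odd; apply: eq_card => z; rewrite !inE.
by case: eqVneq => [->|] //=; rewrite (negbTE yS) /= ltnNge h.
Qed.

Lemma belowU1 x (S : {set T}) : below x (x |: S) = below x S.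
Proof.
rewrite /below; congr odd; apply: eq_card => z; rewrite !inE.
by case: eqVneq => [->|] //=; rewrite ltnn andbF.
Qed.

Lemma belowD x y (S : {set T}) : y \in S ->
  below x (S :\ y) = below x S (+) (enum_rank y < enum_rank x)%N.
Proof.
move=> yS; have {2}-> : S = y |: (S :\ y) by rewrite setD1K.
by rewrite belowU ?setD11 // -addbA addbb addbF.
Qed.

Lemma belowD1 x (S : {set T}) : below x (S :\ x) = below x S.
Proof. 
have [xS|xS] := boolP (x \in S); first by rewrite -[in RHS](setD1K xS) belowU1.
by rewrite (_ : S :\ x = S) //; apply/setDidPl; rewrite disjoint_sym disjoints1.
Qed.

Lemma rank_antisym (x y : T) : x != y ->
  (enum_rank y < enum_rank x)%N = ~~ (enum_rank x < enum_rank y)%N.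
Proof.
move=> xy; rewrite -leqNgt ltn_neqAle; case: eqP => //= /val_inj /enum_rank_inj e.
by rewrite e eqxx in xy.
Qed.

Lemma annih_sq x phi : annih x (annih x phi) = 0.
Proof.
apply/ffunP=> S; rewrite !ffunE; case: ifP => // _.
by rewrite setU11 scaler0.
Qed.

Lemma create_sq x phi : create x (create x phi) = 0.
Proof.
apply/ffunP=> S; rewrite !ffunE; case: ifP => // _.
by rewrite setD11 scaler0.
Qed.

Lemma annihC x y phi : annih x (annih y phi) = - annih y (annih x phi).
Proof.
have [->|xy] := eqVneq x y; first by rewrite annih_sq oppr0.
apply/ffunP=> S; rewrite !ffunE !inE (eq_sym y x) (negbTE xy) /=.
have [xS|xS] := boolP (x \in S); first by case: ifP; rewrite ?scaler0 oppr0.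
have [yS|yS] := boolP (y \in S); first by rewrite scaler0 oppr0.
rewrite !scalerA -scaleNr setUCA; congr (_ *: _); rewrite !belowU //.
rewrite (rank_antisym xy).
by case: (below x S); case: (below y S); case: (_ < _)%N;
  rewrite !(expr0, expr1, mulrN, mulNr, mulr1, opprK).
Qed.

Lemma createC x y phi : create x (create y phi) = - create y (create x phi).
Proof.
have [->|xy] := eqVneq x y; first by rewrite create_sq oppr0.
apply/ffunP=> S; rewrite !ffunE !inE (eq_sym y x) (negbTE xy) /=.
have [xS|xS] := boolP (x \in S); last by case: ifP; rewrite ?scaler0 oppr0.
have [yS|yS] := boolP (y \in S); last by rewrite scaler0 oppr0.
rewrite !scalerA -scaleNr.
have -> : S :\ x :\ y = S :\ y :\ x by apply/setP=> z; rewrite !inE andbCA.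
congr (_ *: _); rewrite !belowD //.
rewrite (rank_antisym xy).
by case: (below x S); case: (below y S); case: (_ < _)%N;
  rewrite !(expr0, expr1, mulrN, mulNr, mulr1, opprK).
Qed.

Lemma annih_create x y phi :
  annih x (create y phi) = - create y (annih x phi) + (x == y)%:R *: phi.
Proof.
apply/ffunP=> S; rewrite !ffunE !inE.
have [->|xy] := eqVneq x y.
  rewrite ?eqxx /= scale1r.
  have [yS|yS] := boolP (y \in S); last first.
    rewrite oppr0 add0r belowU1 scalerA -signr_addb addbb scale1r.
    by rewrite setU1K.
  by rewrite setD1K // belowD1 scalerA -signr_addb addbb scale1r addNr.
rewrite scale0r addr0 /=.
have [xS|xS] := boolP (x \in S).
  by case: ifP; rewrite ?scaler0 oppr0.
have [yS|yS] := boolP (y \in S); last by rewrite scaler0 oppr0.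
rewrite !scalerA -scaleNr.
have -> : (x |: S) :\ y = x |: (S :\ y).
  apply/setP=> z; rewrite !inE; case: (eqVneq z x) => [->|//].
  by rewrite (negbTE xy).
congr (_ *: _); rewrite belowD // belowU // (rank_antisym xy).
by case: (below x S); case: (below y S); case: (_ < _)%N;
  rewrite !(expr0, expr1, mulrN, mulNr, mulr1, opprK).
Qed.

End Fermions.

Section Fock.
Variables (R : idomainType) (t s r : nat).
Local Notation T := ('I_s * 'I_r)%type.
Local Notation B := ('I_t * 'I_r)%type.

(** Exterior algebra on r copies of F = R^s, tensored with the symmetric algebra on r copies of G =
    R^t: each fermionic state carries a polynomial in the [t * r] bosonic variables. *)
Definition fock := {ffun {set T} -> {mpoly R[#|{: B}|]}}.
HB.instance Definition _ := GRing.Lmodule.on fock.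
Implicit Types (phi psi : fock) (a b : B).

Definition coef phi (S : {set T}) (m : 'X_{1..#|{: B}|}) : R := (phi S)@_m.

Lemma coefP phi psi : (forall S m, coef phi S m = coef psi S m) <-> phi = psi.
Proof.
split=> [h|-> //]; apply/ffunP=> S; apply/mpolyP=> m; exact: h.
Qed.

Lemma coefD phi psi S m : coef (phi + psi) S m = coef phi S m + coef psi S m.
Proof. by rewrite /coef ffunE mcoeffD. Qed.
Lemma coefZ c phi S m : coef (c *: phi) S m = c * coef phi S m.
Proof. by rewrite /coef ffunE mcoeffZ. Qed.
Lemma coefN phi S m : coef (- phi) S m = - coef phi S m.
Proof. by rewrite /coef ffunE mcoeffN. Qed.
Lemma coef0 S m : coef 0 S m = 0.
Proof. by rewrite /coef ffunE mcoeff0. Qed.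
Lemma coefB phi psi S m : coef (phi - psi) S m = coef phi S m - coef psi S m.
Proof. by rewrite coefD coefN. Qed.
Lemma coef_sum (I : Type) (l : seq I) (P : pred I) (F : I -> fock) S m :
  coef (\sum_(i <- l | P i) F i) S m = \sum_(i <- l | P i) coef (F i) S m.
Proof. by elim/big_rec2: _ => [|i x y _ <-]; rewrite ?coef0 ?coefD. Qed.

Definition lower a phi : fock := [ffun S => (phi S)^`M(enum_rank a)].
Definition raise a phi : fock := [ffun S => 'X_(enum_rank a) * phi S].

Fact lower_linear a : linear (lower a).
Proof. by move=> c f g; apply/ffunP=> S; rewrite !ffunE mderivD mderivZ. Qed.
HB.instance Definition _ a :=
  GRing.isLinear.Build R fock fock *:%R (lower a) (lower_linear a).
Fact raise_linear a : linear (raise a).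
Proof. by move=> c f g; apply/ffunP=> S; rewrite !ffunE mulrDr -scalerAr. Qed.
HB.instance Definition _ a :=
  GRing.isLinear.Build R fock fock *:%R (raise a) (raise_linear a).

Definition fannih (x : T) : fock -> fock := annih x.
Definition fcreate (x : T) : fock -> fock := create x.
HB.instance Definition _ x := GRing.Linear.on (fannih x).
HB.instance Definition _ x := GRing.Linear.on (fcreate x).

Lemma fannihC x y phi : fannih x (fannih y phi) = - fannih y (fannih x phi).
Proof. exact: annihC. Qed.
Lemma fcreateC x y phi : fcreate x (fcreate y phi) = - fcreate y (fcreate x phi).
Proof. exact: createC. Qed.
Lemma fannih_fcreate x y phi :
  fannih x (fcreate y phi) = - fcreate y (fannih x phi) + (x == y)%:R *: phi.
Proof. exact: annih_create. Qed.

Lemma lowerC a b phi : lower a (lower b phi) = lower b (lower a phi).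
Proof. by apply/ffunP=> S; rewrite !ffunE mderiv_comm. Qed.
Lemma raiseC a b phi : raise a (raise b phi) = raise b (raise a phi).
Proof. by apply/ffunP=> S; rewrite !ffunE mulrCA. Qed.
Lemma lower_raise a b phi :
  lower a (raise b phi) = raise b (lower a phi) + (a == b)%:R *: phi.
Proof.
apply/ffunP=> S; rewrite !ffunE mderivM addrC; congr (_ + _).
rewrite mderivX mnm1E (inj_eq enum_rank_inj) eq_sym.
have [->|_] := eqVneq a b; last by rewrite !scale0r mul0r.
rewrite !scale1r (_ : (_ - _)%MM = 0%MM) ?mpolyX0 ?mul1r //.
by apply/mnmP=> i; rewrite mnmBE subnn mnm0E.
Qed.
Lemma raise_inj a phi : raise a phi = 0 -> phi = 0.
Proof.
move=> /ffunP h; apply/ffunP=> S; move: (h S); rewrite !ffunE => /eqP.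
by rewrite mulf_eq0 -msupp_eq0 msuppX /= => /eqP.
Qed.

Lemma lower_fannih a x phi : lower a (fannih x phi) = fannih x (lower a phi).
Proof.
apply/ffunP=> S; rewrite !ffunE; case: ifP => _; first by rewrite mderiv0.
by rewrite mderivZ.
Qed.
Lemma lower_fcreate a x phi : lower a (fcreate x phi) = fcreate x (lower a phi).
Proof.
apply/ffunP=> S; rewrite !ffunE; case: ifP => _; last by rewrite mderiv0.
by rewrite mderivZ.
Qed.
Lemma raise_fannih a x phi : raise a (fannih x phi) = fannih x (raise a phi).
Proof.
apply/ffunP=> S; rewrite !ffunE; case: ifP => _; first by rewrite mulr0.
by rewrite scalerAr.
Qed.
Lemma raise_fcreate a x phi : raise a (fcreate x phi) = fcreate x (raise a phi).
Proof.
apply/ffunP=> S; rewrite !ffunE; case: ifP => _; last by rewrite mulr0.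
by rewrite scalerAr.
Qed.

Lemma coef_number x phi S m :
  coef (fcreate x (fannih x phi)) S m = (x \in S)%:R * coef phi S m.
Proof.
rewrite /coef !ffunE; case: ifP => xS; last by rewrite mcoeff0 mul0r.
by rewrite setD11 setD1K // belowD1 scalerA -signr_addb addbb scale1r mul1r.
Qed.

Lemma coef_raise_lower a phi S m :
  coef (raise a (lower a phi)) S m = (m (enum_rank a))%:R * coef phi S m.
Proof.
rewrite /coef !ffunE mulrC; have [m0|] := posnP (m (enum_rank a)).
  rewrite m0 mul0r; apply: memN_msupp_eq0; apply/negP.
  rewrite (perm_mem (msuppMX _ _)); case/mapP=> m' _ /mnmP/(_ (enum_rank a)).
  by rewrite m0 mnmDE mnm1E eqxx.
move=> m_gt0; have e : m = (U_(enum_rank a) + (m - U_(enum_rank a)))%MM.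
  apply/mnmP=> i; rewrite mnmDE mnmBE mnm1E subnKC //.
  by have [<-|] := eqVneq (enum_rank a) i.
rewrite [in LHS]e mcoeffMX mcoeff_mderiv addmC -e mnmBE mnm1E eqxx.
by rewrite subn1 prednK // mulr_natl.
Qed.

Variable A : 'M[R]_(t, s).
Hypothesis nat_unit : forall n, n.+1%:R \is a @GRing.unit R.

Lemma nat_regular n phi : n.+1%:R *: phi = 0 -> phi = 0.
Proof.
by move=> h; rewrite -[phi]scale1r -(mulVr (nat_unit n)) -scalerA h scaler0.
Qed.

Lemma skew0 phi : phi = - phi -> phi = 0.
Proof.
move=> h; apply: (@nat_regular 1).
by rewrite scaler_nat mulr2n {1}h addNr.
Qed.

Definition annihA (a : B) phi : fock :=
  \sum_j A a.1 j *: fannih (j, a.2) phi.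

(** [X] will be built from an adjugate, a right inverse of [A] up to a minor, so that these creators
    are dual to the [annihA] up to that minor. *)
Definition createX (X : 'M[R]_(s, t)) (a : B) phi : fock :=
  \sum_j X j a.1 *: fcreate (j, a.2) phi.

Fact annihA_linear a : linear (annihA a).
Proof.
move=> c f g; rewrite /annihA scaler_sumr -big_split; apply: eq_bigr => j _.
by rewrite linearP scalerDr !scalerA mulrC.
Qed.
HB.instance Definition _ a :=
  GRing.isLinear.Build R fock fock *:%R (annihA a) (annihA_linear a).
Fact createX_linear X a : linear (createX X a).
Proof.
move=> c f g; rewrite /createX scaler_sumr -big_split; apply: eq_bigr => j _.
by rewrite linearP scalerDr !scalerA mulrC.
Qed.
HB.instance Definition _ X a :=
  GRing.isLinear.Build R fock fock *:%R (createX X a) (createX_linear X a).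

Lemma fannih_annihA x a phi : fannih x (annihA a phi) = - annihA a (fannih x phi).
Proof.
rewrite /annihA linear_sum /= -sumrN; apply: eq_bigr => j _.
by rewrite linearZ /= fannihC scalerN.
Qed.

Lemma annihAC a b phi : annihA a (annihA b phi) = - annihA b (annihA a phi).
Proof.
transitivity (\sum_j A b.1 j *: annihA a (fannih (j, b.2) phi)).
  rewrite [annihA b phi]/annihA linear_sum /=; apply: eq_bigr => j _.
  by rewrite linearZ.
rewrite [annihA b _]/annihA -sumrN; apply: eq_bigr => j _.
by rewrite fannih_annihA scalerN opprK.
Qed.

Lemma annihA_sq a phi : annihA a (annihA a phi) = 0.
Proof. by apply: skew0; rewrite -annihAC. Qed.

Lemma fcreate_createX X x a phi :
  fcreate x (createX X a phi) = - createX X a (fcreate x phi).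
Proof.
rewrite /createX linear_sum /= -sumrN; apply: eq_bigr => j _.
by rewrite linearZ /= fcreateC scalerN.
Qed.

Lemma createXC X a b phi : createX X a (createX X b phi) = - createX X b (createX X a phi).
Proof.
transitivity (\sum_j X j b.1 *: createX X a (fcreate (j, b.2) phi)).
  rewrite [createX X b phi]/createX linear_sum /=; apply: eq_bigr => j _.
  by rewrite linearZ.
rewrite [createX X b _]/createX -sumrN; apply: eq_bigr => j _.
by rewrite fcreate_createX scalerN opprK.
Qed.

Lemma createX_sq X a phi : createX X a (createX X a phi) = 0.
Proof. by apply: skew0; rewrite -createXC. Qed.

Lemma annihA_fcreate a x phi : annihA a (fcreate x phi) =
  - fcreate x (annihA a phi) + ((a.2 == x.2)%:R * A a.1 x.1) *: phi.
Proof.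
rewrite /annihA linear_sum /= -sumrN.
rewrite (eq_bigr (fun j => - fcreate x (A a.1 j *: fannih (j, a.2) phi) +
   (A a.1 j * ((j, a.2) == x)%:R) *: phi)); last first.
  by move=> j _; rewrite fannih_fcreate scalerDr scalerN [fcreate x (_ *: _)]linearZ /= scalerA.
rewrite big_split /=; congr (_ + _); rewrite -scaler_suml; congr (_ *: _).
case: x => j u; rewrite (bigD1 j) //= big1 ?addr0 => [|i ij].
  by rewrite xpair_eqE eqxx mulrC.
by rewrite xpair_eqE (negbTE ij) mulr0.
Qed.

Lemma annihA_createX X a b phi : annihA a (createX X b phi) =
  - createX X b (annihA a phi) + ((a.2 == b.2)%:R * (A *m X) a.1 b.1) *: phi.
Proof.
rewrite /createX linear_sum /= -sumrN.
rewrite (eq_bigr (fun j => - (X j b.1 *: fcreate (j, b.2) (annihA a phi)) +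
   ((a.2 == b.2)%:R * (A a.1 j * X j b.1)) *: phi)); last first.
  move=> j _; rewrite linearZ /= annihA_fcreate /= scalerDr scalerN scalerA.
  by rewrite mulrC mulrA.
by rewrite big_split /= -scaler_suml -mulr_sumr mxE.
Qed.

Lemma lower_annihA a b phi : lower a (annihA b phi) = annihA b (lower a phi).
Proof.
by rewrite /annihA linear_sum /=; apply: eq_bigr => j _; rewrite linearZ /= lower_fannih.
Qed.
Lemma raise_annihA a b phi : raise a (annihA b phi) = annihA b (raise a phi).
Proof.
by rewrite /annihA linear_sum /=; apply: eq_bigr => j _; rewrite linearZ /= raise_fannih.
Qed.
Lemma lower_createX X a b phi : lower a (createX X b phi) = createX X b (lower a phi).
Proof.
by rewrite /createX linear_sum /=; apply: eq_bigr => j _; rewrite linearZ /= lower_fcreate.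
Qed.
Lemma raise_createX X a b phi : raise a (createX X b phi) = createX X b (raise a phi).
Proof.
by rewrite /createX linear_sum /=; apply: eq_bigr => j _; rewrite linearZ /= raise_fcreate.
Qed.

Definition diff phi : fock := \sum_a annihA a (lower a phi).
Fact diff_linear : linear diff.
Proof.
move=> c f g; rewrite /diff scaler_sumr -big_split; apply: eq_bigr => a _.
by rewrite !linearP.
Qed.
HB.instance Definition _ := GRing.isLinear.Build R fock fock *:%R diff diff_linear.

Lemma annihA_diff a phi : annihA a (diff phi) = - diff (annihA a phi).
Proof.
rewrite /diff linear_sum /= -sumrN; apply: eq_bigr => b _.
by rewrite /= annihAC lower_annihA.
Qed.

Lemma lower_diff a phi : lower a (diff phi) = diff (lower a phi).
Proof.
by rewrite /diff linear_sum /=; apply: eq_bigr => b _; rewrite lower_annihA lowerC.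
Qed.

Lemma diff_sq phi : diff (diff phi) = 0.
Proof.
apply: skew0; rewrite {1}/diff.
rewrite (eq_bigr (fun a => - diff (annihA a (lower a phi)))); last first.
  by move=> a _; rewrite lower_diff annihA_diff.
by rewrite sumrN -linear_sum /=.
Qed.

(** The bosons carry the dual action, hence the minus sign and the exchanged indices. The diagonal
    operators count fermions minus bosons of a copy. *)
Definition gl (u v : 'I_r) phi : fock :=
  \sum_j fcreate (j, u) (fannih (j, v) phi) - \sum_i raise (i, v) (lower (i, u) phi).

Fact gl_linear u v : linear (gl u v).
Proof.
move=> c f g; rewrite /gl scalerBr !scaler_sumr addrACA -opprD.
congr (_ - _); rewrite -big_split; apply: eq_bigr => j _; by rewrite !linearP.
Qed.
HB.instance Definition _ u v :=
  GRing.isLinear.Build R fock fock *:%R (gl u v) (gl_linear u v).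

Definition bosons phi : fock := \sum_a raise a (lower a phi).
Fact bosons_linear : linear bosons.
Proof.
move=> c f g; rewrite /bosons scaler_sumr -big_split; apply: eq_bigr => a _.
by rewrite !linearP.
Qed.
HB.instance Definition _ := GRing.isLinear.Build R fock fock *:%R bosons bosons_linear.

Lemma bosons_lower a phi : bosons (lower a phi) = lower a (bosons phi) - lower a phi.
Proof.
rewrite /bosons linear_sum /= [in RHS](eq_bigr (fun b =>
   raise b (lower b (lower a phi)) + (a == b)%:R *: lower b phi)); last first.
  by move=> b _; rewrite lower_raise lowerC.
rewrite big_split /= [X in _ + X - _](_ : _ = lower a phi) ?addrK //.
rewrite (bigD1 a) //= eqxx scale1r big1 ?addr0 // => b ba.
by rewrite eq_sym (negbTE ba) scale0r.
Qed.

Lemma bosons_raise a phi : bosons (raise a phi) = raise a (bosons phi) + raise a phi.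
Proof.
rewrite /bosons linear_sum /= (eq_bigr (fun b =>
   raise a (raise b (lower b phi)) + (b == a)%:R *: raise b phi)); last first.
  by move=> b _; rewrite lower_raise linearD linearZ /= raiseC.
rewrite big_split /=; congr (_ + _).
rewrite (bigD1 a) //= eqxx scale1r big1 ?addr0 // => b ba.
by rewrite (negbTE ba) scale0r.
Qed.

Lemma bosons_fannih x phi : bosons (fannih x phi) = fannih x (bosons phi).
Proof.
rewrite /bosons linear_sum /=; apply: eq_bigr => b _.
by rewrite lower_fannih raise_fannih.
Qed.
Lemma bosons_fcreate x phi : bosons (fcreate x phi) = fcreate x (bosons phi).
Proof.
rewrite /bosons linear_sum /=; apply: eq_bigr => b _.
by rewrite lower_fcreate raise_fcreate.
Qed.
Lemma bosons_annihA b phi : bosons (annihA b phi) = annihA b (bosons phi).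
Proof.
rewrite /annihA linear_sum /=; apply: eq_bigr => j _.
by rewrite linearZ /= bosons_fannih.
Qed.
Lemma bosons_createX X b phi : bosons (createX X b phi) = createX X b (bosons phi).
Proof.
rewrite /createX linear_sum /=; apply: eq_bigr => j _.
by rewrite linearZ /= bosons_fcreate.
Qed.
Lemma bosons_diff phi : bosons (diff phi) = diff (bosons phi) - diff phi.
Proof.
rewrite /diff linear_sum /= -sumrB; apply: eq_bigr => a _.
by rewrite bosons_annihA bosons_lower linearB.
Qed.

Lemma bosons_gl u v phi : bosons (gl u v phi) = gl u v (bosons phi).
Proof.
rewrite /gl [bosons (_ - _)]linearB /= 2![bosons (\sum_(_ < _) _)]linear_sum /=; congr (_ - _); apply: eq_bigr => j _.
  by rewrite bosons_fcreate bosons_fannih.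
by rewrite bosons_raise bosons_lower linearB subrK.
Qed.

(* [gl u v] acts as a derivation on the generators. *)
Lemma gl_fannih u v (x : T) phi : gl u v (fannih x phi) =
  fannih x (gl u v phi) - (x.2 == u)%:R *: fannih (x.1, v) phi.
Proof.
rewrite /gl [fannih x (_ - _)]linearB /= 2![fannih x (\sum_(_ < _) _)]linear_sum /= [in RHS]addrAC; congr (_ - _); last first.
  by apply: eq_bigr => i _; rewrite lower_fannih raise_fannih.
rewrite [in RHS](eq_bigr (fun j => fcreate (j, u) (fannih (j, v) (fannih x phi))
   + (x == (j, u))%:R *: fannih (j, v) phi)); last first.
  by move=> j _; rewrite fannih_fcreate fannihC linearN opprK.
rewrite big_split /= [X in _ + X - _](_ : _ =
  (x.2 == u)%:R *: fannih (x.1, v) phi) ?addrK //.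
case: x => j w; rewrite (bigD1 j) //= big1 ?addr0 => [|i ij].
  by rewrite xpair_eqE eqxx.
by rewrite xpair_eqE eq_sym (negbTE ij) scale0r.
Qed.

Lemma gl_fcreate u v (x : T) phi : gl u v (fcreate x phi) =
  fcreate x (gl u v phi) + (x.2 == v)%:R *: fcreate (x.1, u) phi.
Proof.
rewrite /gl [fcreate x (_ - _)]linearB /= 2![fcreate x (\sum_(_ < _) _)]linear_sum /= [in RHS]addrAC; congr (_ - _); last first.
  by apply: eq_bigr => i _; rewrite lower_fcreate raise_fcreate.
rewrite (eq_bigr (fun j => fcreate x (fcreate (j, u) (fannih (j, v) phi))
   + ((j, v) == x)%:R *: fcreate (j, u) phi)); last first.
  move=> j _; rewrite fannih_fcreate linearD linearN linearZ /=.
  by rewrite fcreateC opprK.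
rewrite big_split /=; congr (_ + _).
case: x => j w; rewrite (bigD1 j) //= big1 ?addr0 => [|i ij].
  by rewrite xpair_eqE eqxx eq_sym.
by rewrite xpair_eqE (negbTE ij) scale0r.
Qed.

Lemma gl_lower u v a phi : gl u v (lower a phi) =
  lower a (gl u v phi) + (a.2 == v)%:R *: lower (a.1, u) phi.
Proof.
rewrite /gl [lower a (_ - _)]linearB /= 2![lower a (\sum_(_ < _) _)]linear_sum /= -addrA; congr (_ + _).
  by apply: eq_bigr => i _; rewrite lower_fcreate lower_fannih.
rewrite [in RHS](eq_bigr (fun i => raise (i, v) (lower (i, u) (lower a phi))
   + (a == (i, v))%:R *: lower (i, u) phi)); last first.
  by move=> i _; rewrite lower_raise lowerC.
rewrite big_split /= opprD -addrA [X in _ + X](_ : _ = 0) ?addr0 //.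
apply/eqP; rewrite addrC subr_eq0 eq_sym; apply/eqP.
case: a => j w; rewrite (bigD1 j) //= big1 ?addr0 => [|i ij].
  by rewrite xpair_eqE eqxx.
by rewrite xpair_eqE eq_sym (negbTE ij) scale0r.
Qed.

Lemma gl_raise u v a phi : gl u v (raise a phi) =
  raise a (gl u v phi) - (a.2 == u)%:R *: raise (a.1, v) phi.
Proof.
rewrite /gl [raise a (_ - _)]linearB /= 2![raise a (\sum_(_ < _) _)]linear_sum /= -addrA; congr (_ + _).
  by apply: eq_bigr => i _; rewrite raise_fcreate raise_fannih.
rewrite (eq_bigr (fun i => raise a (raise (i, v) (lower (i, u) phi))
   + ((i, u) == a)%:R *: raise (i, v) phi)); last first.
  by move=> i _; rewrite lower_raise linearD linearZ /= raiseC.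
rewrite big_split /= opprD; congr (_ - _).
case: a => j w; rewrite (bigD1 j) //= big1 ?addr0 => [|i ij].
  by rewrite xpair_eqE eqxx eq_sym.
by rewrite xpair_eqE (negbTE ij) scale0r.
Qed.

Lemma gl_annihA u v a phi : gl u v (annihA a phi) =
  annihA a (gl u v phi) - (a.2 == u)%:R *: annihA (a.1, v) phi.
Proof.
rewrite /annihA linear_sum /= scaler_sumr -sumrB; apply: eq_bigr => j _.
by rewrite linearZ /= gl_fannih scalerBr /= !scalerA mulrC.
Qed.

Lemma gl_createX X u v a phi : gl u v (createX X a phi) =
  createX X a (gl u v phi) + (a.2 == v)%:R *: createX X (a.1, u) phi.
Proof.
rewrite /createX linear_sum /= scaler_sumr -big_split; apply: eq_bigr => j _.
by rewrite linearZ /= gl_fcreate scalerDr /= !scalerA mulrC.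
Qed.

Lemma sum_snd_eq v (F : B -> fock) :
  \sum_a (a.2 == v)%:R *: F a = \sum_i F (i, v).
Proof.
rewrite (eq_bigr (fun a : B => (a.2 == v)%:R *: F (a.1, a.2))) => [|[] //].
rewrite -(pair_big predT predT (fun i w => (w == v)%:R *: F (i, w))) /=.
apply: eq_bigr => i _; rewrite (bigD1 v) //= eqxx scale1r big1 ?addr0 // => w wv.
by rewrite (negbTE wv) scale0r.
Qed.

(** Fermions and bosons are rotated in dual ways, so the two correction sums agree once the copy
    index is summed out. *)
Lemma gl_diff u v phi : gl u v (diff phi) = diff (gl u v phi).
Proof.
rewrite /diff linear_sum /=.
rewrite (eq_bigr (fun a => annihA a (lower a (gl u v phi)) +
  ((a.2 == v)%:R *: annihA a (lower (a.1, u) phi) -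
   (a.2 == u)%:R *: annihA (a.1, v) (lower a phi)))); last first.
  move=> a _; rewrite gl_annihA gl_lower linearD linearZ /=.
  by rewrite -!addrA.
rewrite big_split /= -[RHS]addr0; congr (_ + _).
rewrite big_split /= sumrN; apply/eqP; rewrite subr_eq0; apply/eqP.
transitivity (\sum_i annihA (i, v) (lower (i, u) phi)).
  exact: (sum_snd_eq v (fun a => annihA a (lower (a.1, u) phi))).
exact/esym/(sum_snd_eq u (fun a => annihA (a.1, v) (lower a phi))).
Qed.

Lemma gl_comm u v w z phi : gl u v (gl w z phi) = gl w z (gl u v phi)
  + (v == w)%:R *: gl u z phi - (z == u)%:R *: gl w v phi.
Proof.
rewrite [gl w z phi]/gl [gl u v (_ - _)]linearB /= 2![gl u v (\sum_(_ < _) _)]linear_sum /=.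
rewrite (eq_bigr (fun j => fcreate (j, w) (fannih (j, z) (gl u v phi)) +
  ((v == w)%:R *: fcreate (j, u) (fannih (j, z) phi) -
   (z == u)%:R *: fcreate (j, w) (fannih (j, v) phi)))); last first.
  move=> j _; rewrite gl_fcreate gl_fannih linearB linearZ /= (eq_sym v).
  by rewrite -addrA [- _ + _]addrC.
rewrite [X in _ - X](eq_bigr (fun i => raise (i, z) (lower (i, w) (gl u v phi)) +
  ((v == w)%:R *: raise (i, z) (lower (i, u) phi) -
   (z == u)%:R *: raise (i, v) (lower (i, w) phi)))); last first.
  move=> i _; rewrite gl_raise gl_lower linearD linearZ /= (eq_sym v).
  by rewrite -addrA.
rewrite !big_split /= !sumrN -!scaler_sumr [gl w z _]/gl [gl u z _]/gl [gl w v _]/gl.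
rewrite !scalerBr !opprD !opprK !addrA.
by rewrite [RHS](ACl (1*3*5*2*4*6)).
Qed.

Lemma coef_bosons phi S m : coef (bosons phi) S m = (mdeg m)%:R * coef phi S m.
Proof.
rewrite /bosons coef_sum (eq_bigr (fun a : B => (m (enum_rank a))%:R * coef phi S m)).
  rewrite -mulr_suml -natr_sum mdegE; congr (_%:R * _).
  by rewrite (reindex (@enum_val _ {: B})) /= ?(eq_bigr _ (fun i _ => congr1 m (enum_valK i))) //;
    exact/onW_bij/enum_val_bij.
by move=> a _; rewrite coef_raise_lower.
Qed.

Lemma nat_regularR n (c : R) : n.+1%:R * c = 0 -> c = 0.
Proof. by move=> h; rewrite -[c]mul1r -(mulVr (nat_unit n)) -mulrA h mulr0. Qed.

Lemma bosons0_lower a phi : bosons phi = 0 -> lower a phi = 0.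
Proof.
move=> h; apply/coefP=> S m; rewrite coef0 /coef ffunE mcoeff_mderiv.
have := congr1 (fun x => coef x S (m + U_(enum_rank a))%MM) h.
rewrite coef_bosons coef0 mdegD mdeg1 addn1 => /nat_regularR; rewrite /coef => ->.
by rewrite mul0rn.
Qed.

Lemma diffE phi : diff phi = \sum_a annihA a (lower a phi). Proof. by []. Qed.
Lemma bosonsE phi : bosons phi = \sum_a raise a (lower a phi). Proof. by []. Qed.
Lemma glE u v phi : gl u v phi = \sum_j fcreate (j, u) (fannih (j, v) phi)
   - \sum_i raise (i, v) (lower (i, u) phi). Proof. by []. Qed.
Lemma annihAE a phi : annihA a phi = \sum_j A a.1 j *: fannih (j, a.2) phi.
Proof. by []. Qed.

End Fock.
Opaque lower raise fannih fcreate annihA createX diff gl bosons.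

(** * Contracting homotopies *)

Section Homotopy.
Variables (R : idomainType) (t s r : nat).
Local Notation T := ('I_s * 'I_r)%type.
Local Notation B := ('I_t * 'I_r)%type.
Local Notation fock := (fock R t s r).
Implicit Types (phi psi : fock) (a b : B).
Hypothesis nat_unit : forall n, n.+1%:R \is a @GRing.unit R.

Variables (A : 'M[R]_(t, s)) (X : 'M[R]_(s, t)) (w : R) (rows : {set 'I_t}).
Hypothesis AX : {in rows &, forall i l, (A *m X) i l = (i == l)%:R * w}.
Hypothesis w_neq0 : w != 0.
Local Notation annihA := (annihA A).
Local Notation createX := (createX X).
Local Notation diff := (diff A).

(** The combination of lowering operators that [diff] produces next to [createX]. For modes in
    [rows] it forms a canonical pair with [raise] up to the factor [w], although [A *m X] is not
    controlled outside [rows]. *)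
Definition lowerX a phi : fock := \sum_i (A *m X) i a.1 *: lower (i, a.2) phi.
Fact lowerX_linear a : linear (lowerX a).
Proof.
move=> c f g; rewrite /lowerX scaler_sumr -big_split; apply: eq_bigr => j _.
by rewrite linearP scalerDr !scalerA mulrC.
Qed.
HB.instance Definition _ a :=
  GRing.isLinear.Build R fock fock *:%R (lowerX a) (lowerX_linear a).

Definition homot a phi : fock := createX a (raise a phi).
Fact homot_linear a : linear (homot a).
Proof. by move=> c f g; rewrite /homot !linearP. Qed.
HB.instance Definition _ a :=
  GRing.isLinear.Build R fock fock *:%R (homot a) (homot_linear a).

(** The anticommutator of [diff] and [homot a]. For a mode in [rows] it is [w] times the boson
    number plus [w] times the vacancy of the dual fermion, so its kernel has no boson in that
    mode. *)
Definition lapl a phi : fock := raise a (lowerX a phi) + annihA a (createX a phi).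
Fact lapl_linear a : linear (lapl a).
Proof. by move=> c f g; rewrite /lapl !linearP scalerDr addrACA. Qed.
HB.instance Definition _ a :=
  GRing.isLinear.Build R fock fock *:%R (lapl a) (lapl_linear a).

Lemma lowerX_raise a b phi : lowerX a (raise b phi) =
  raise b (lowerX a phi) + ((a.2 == b.2)%:R * (A *m X) b.1 a.1) *: phi.
Proof.
rewrite /lowerX linear_sum /=.
rewrite (eq_bigr (fun i => raise b ((A *m X) i a.1 *: lower (i, a.2) phi) +
  ((A *m X) i a.1 * ((i, a.2) == b)%:R) *: phi)); last first.
  by move=> i _; rewrite lower_raise scalerDr [raise b (_ *: _)]linearZ /= scalerA.
rewrite big_split /=; congr (_ + _); rewrite -scaler_suml; congr (_ *: _).
case: b => j u; rewrite (bigD1 j) //= big1 ?addr0 => [|i ij].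
  by rewrite xpair_eqE eqxx mulrC.
by rewrite xpair_eqE (negbTE ij) mulr0.
Qed.

Lemma lowerXC a b phi : lowerX a (lowerX b phi) = lowerX b (lowerX a phi).
Proof.
rewrite {2}/lowerX linear_sum [in RHS]/lowerX; apply: eq_bigr => i _.
rewrite linearZ /=; congr (_ *: _); rewrite /lowerX linear_sum.
by apply: eq_bigr => j _; rewrite linearZ /= lowerC.
Qed.

Lemma lowerX_annihA a b phi : lowerX a (annihA b phi) = annihA b (lowerX a phi).
Proof.
by rewrite /lowerX linear_sum; apply: eq_bigr => j _; rewrite linearZ /= lower_annihA.
Qed.
Lemma lowerX_createX a b phi : lowerX a (createX b phi) = createX b (lowerX a phi).
Proof.
by rewrite /lowerX linear_sum; apply: eq_bigr => j _; rewrite linearZ /= lower_createX.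
Qed.

Lemma lowerXE a phi : lowerX a phi = \sum_i (A *m X) i a.1 *: lower (i, a.2) phi.
Proof. by []. Qed.
Lemma homotE a phi : homot a phi = createX a (raise a phi). Proof. by []. Qed.
Lemma laplE a phi : lapl a phi = raise a (lowerX a phi) + annihA a (createX a phi).
Proof. by []. Qed.
Opaque lowerX homot lapl.

Lemma diff_homot_term a b phi :
  annihA b (lower b (createX a (raise a phi))) +
  createX a (raise a (annihA b (lower b phi))) =
  raise a (((b.2 == a.2)%:R * (A *m X) b.1 a.1) *: lower b phi)
   + (b == a)%:R *: annihA b (createX a phi).
Proof.
rewrite lower_createX lower_raise [createX a (_ + _)]linearD /=.
rewrite [annihA b (_ + _)]linearD /= [createX a (_ *: _)]linearZ /=.
rewrite [annihA b (_ *: _)]linearZ /= annihA_createX raise_annihA.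
rewrite [raise a (_ *: _)]linearZ /=.
by rewrite addrC !addrA subrr add0r.
Qed.

Lemma diff_homot a phi : diff (homot a phi) + homot a (diff phi) = lapl a phi.
Proof.
rewrite !homotE [diff phi]diffE [raise a (\sum__ _)]linear_sum /=.
rewrite [createX a (\sum__ _)]linear_sum /= diffE -big_split /=.
rewrite (eq_bigr (fun b => raise a (((b.2 == a.2)%:R * (A *m X) b.1 a.1) *: lower b phi)
   + (b == a)%:R *: annihA b (createX a phi))); last first.
  by move=> b _; rewrite diff_homot_term.
rewrite big_split /= laplE; congr (_ + _); last first.
  rewrite (bigD1 a) //= eqxx scale1r big1 ?addr0 // => b ba.
  by rewrite (negbTE ba) scale0r.
rewrite -linear_sum lowerXE; congr (raise a _).
rewrite (eq_bigr (fun b : B => (b.2 == a.2)%:R *: ((A *m X) b.1 a.1 *: lower b phi))).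
  exact: (sum_snd_eq a.2 (fun b => (A *m X) b.1 a.1 *: lower b phi)).
by move=> b _; rewrite scalerA.
Qed.

Lemma lapl_diff a phi : lapl a (diff phi) = diff (lapl a phi).
Proof.
rewrite -!diff_homot diff_sq // !linearD /= diff_sq // [homot a 0]linear0.
by rewrite add0r addr0.
Qed.

Lemma bosons_lowerX a phi : bosons (lowerX a phi) = lowerX a (bosons phi) - lowerX a phi.
Proof.
rewrite !lowerXE linear_sum -sumrB; apply: eq_bigr => i _.
by rewrite linearZ /= bosons_lower scalerBr.
Qed.

Lemma bosons_lapl a phi : bosons (lapl a phi) = lapl a (bosons phi).
Proof.
rewrite !laplE linearD /= bosons_raise bosons_annihA bosons_createX bosons_lowerX.
by rewrite linearB /= subrK.
Qed.

Lemma gl_lowerX u v a phi : gl u v (lowerX a phi) =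
  lowerX a (gl u v phi) + (a.2 == v)%:R *: lowerX (a.1, u) phi.
Proof.
rewrite !lowerXE linear_sum scaler_sumr -big_split; apply: eq_bigr => i _.
by rewrite linearZ /= gl_lower scalerDr /= !scalerA mulrC.
Qed.

Lemma gl_homot u a phi : gl u u (homot a phi) = homot a (gl u u phi).
Proof.
rewrite !homotE gl_createX gl_raise [createX a (_ - _)]linearB /=.
rewrite [createX a (_ *: _)]linearZ /=.
have [e|_] := eqVneq a.2 u; last by rewrite !scale0r subr0 addr0.
by rewrite !scale1r -e -surjective_pairing subrK.
Qed.

Lemma gl_lapl u a phi : gl u u (lapl a phi) = lapl a (gl u u phi).
Proof.
rewrite -diff_homot [gl u u (_ + _)]linearD /= gl_homot gl_diff gl_homot gl_diff.
exact: diff_homot.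
Qed.

Lemma lowerX_lapl a b phi : a \in setX rows setT -> b \in setX rows setT -> a != b ->
  lowerX b (lapl a phi) = lapl a (lowerX b phi).
Proof.
rewrite !inE !andbT => ra rb ab.
rewrite !laplE linearD /= lowerX_annihA lowerX_createX lowerX_raise AX // [lowerX b (lowerX a _)]lowerXC.
rewrite [X in X *: _](_ : _ = 0) ?scale0r ?addr0 // mulrA -natrM mulnb.
case: (a) (b) ab => [a1 a2] [b1 b2]; rewrite xpair_eqE /= (eq_sym b2) andbC.
by move/negbTE->; rewrite mul0r.
Qed.

(** The product of the operators [k w - lapl a] for k = 1, ..., n: it removes the eigenvalues
    [w, ..., n w]. *)
Fixpoint spec a n phi : fock :=
  if n is m.+1 then (m.+1%:R * w) *: spec a m phi - lapl a (spec a m phi) else phi.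

Fixpoint spec_homot a n phi : fock :=
  if n is m.+1 then (m.+1%:R * w) *: spec_homot a m phi + homot a (spec a m phi) else 0.

Lemma specS a n phi : spec a n.+1 phi =
  (n.+1%:R * w) *: spec a n phi - lapl a (spec a n phi).
Proof. by []. Qed.
Lemma spec_homotS a n phi : spec_homot a n.+1 phi =
  (n.+1%:R * w) *: spec_homot a n phi + homot a (spec a n phi).
Proof. by []. Qed.

Fact spec_linear a n : linear (spec a n).
Proof.
move=> c f g; elim: n => [|n IH] //; rewrite !specS IH [lapl a (_ + _)]linearP.
rewrite [in LHS]scalerDr opprD addrACA [in RHS]scalerBr !scalerA.
by rewrite [c * _]mulrC.
Qed.
HB.instance Definition _ a n :=
  GRing.isLinear.Build R fock fock *:%R (spec a n) (spec_linear a n).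
Fact spec_homot_linear a n : linear (spec_homot a n).
Proof.
move=> c f g; elim: n => [|n IH]; first by rewrite /= scaler0 addr0.
rewrite !spec_homotS IH [spec a n (_ + _)]linearP /= [homot a (_ + _)]linearP.
rewrite [in LHS]scalerDr [in RHS]scalerDr addrACA !scalerA.
by rewrite [c * _]mulrC.
Qed.
HB.instance Definition _ a n :=
  GRing.isLinear.Build R fock fock *:%R (spec_homot a n) (spec_homot_linear a n).

Lemma spec_comm (L : {linear fock -> fock}) a n phi :
  (forall psi, L (lapl a psi) = lapl a (L psi)) -> L (spec a n phi) = spec a n (L phi).
Proof. by move=> h; elim: n => //= n IH; rewrite linearB linearZ /= h IH. Qed.

Lemma spec_homotP a n phi : spec a n phi =
  (n`!%:R * w ^+ n) *: phi - (diff (spec_homot a n phi) + spec_homot a n (diff phi)).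
Proof.
elim: n => [|n IH] /=; first by rewrite mulr1 scale1r linear0 addr0 subr0.
rewrite -diff_homot -(spec_comm _ _ (L := diff)); last by move=> psi; rewrite lapl_diff.
rewrite {1}IH scalerBr scalerA opprD -addrA; congr (_ + _).
  by congr (_ *: _); rewrite factS natrM exprS; rewrite mulrACA.
rewrite [diff (_ + _)]linearD /= [diff (_ *: _)]linearZ /= scalerDr !opprD.
by rewrite addrACA.
Qed.

Definition number a phi : fock := raise a (lowerX a phi).

(** A falling factorial of the number operator. Normal ordering turns it, up to sign, into n
    lowerings followed by n raisings, which vanish on fewer than n bosons. *)
Fixpoint falling a n phi : fock :=
  if n is m.+1 then (m%:R * w) *: falling a m phi - number a (falling a m phi) else phi.

Lemma lowerX_raise_iter a n phi : a.1 \in rows ->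
  lowerX a (iter n (raise a) phi) =
  iter n (raise a) (lowerX a phi) + (n%:R * w) *: iter n.-1 (raise a) phi.
Proof.
move=> ra; elim: n => [|n IH]; first by rewrite mul0r scale0r addr0.
rewrite /= lowerX_raise IH linearD /= -addrA; congr (_ + _).
rewrite AX // !eqxx !mul1r linearZ /= -natr1 mulrDl mul1r scalerDl.
by case: n {IH} => [|n] //=; rewrite !mul0r !scale0r.
Qed.

Lemma fallingE a n phi : a.1 \in rows ->
  falling a n phi = (-1) ^+ n *: iter n (raise a) (iter n (lowerX a) phi).
Proof.
move=> ra; elim: n => [|n IH]; first by rewrite scale1r.
rewrite [LHS]/= IH /number [lowerX a (_ *: _)]linearZ /= [raise a (_ *: _)]linearZ /=.
rewrite lowerX_raise_iter // [raise a (_ + _)]linearD /= [raise a (_ *: _)]linearZ /=.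
set z := iter n (lowerX a) phi.
have -> : (n%:R * w) *: raise a (iter n.-1 (raise a) z) =
          (n%:R * w) *: iter n (raise a) z.
  by case: (n) => [|m] //; rewrite !mul0r !scale0r.
rewrite scalerDr !scalerA [_ * (-1) ^+ _]mulrC opprD addrA addrAC subrr sub0r.
by rewrite exprS mulN1r scaleNr.
Qed.

Lemma iter_lowerX a n p phi : bosons phi = p%:R *: phi -> (p < n)%N ->
  iter n (lowerX a) phi = 0.
Proof.
elim: n p phi => // n IH [|p] phi hp pn; rewrite iterSr.
  suff -> : lowerX a phi = 0.
    by elim: n {IH pn} => //= n ->; rewrite linear0.
  rewrite lowerXE big1 // => i _; rewrite bosons0_lower ?scaler0 //.
  by rewrite hp scale0r.
apply: (IH p) => //; rewrite bosons_lowerX hp linearZ /= -natr1 scalerDl scale1r.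
by rewrite addrK.
Qed.

Lemma falling0 a n p phi : a.1 \in rows -> bosons phi = p%:R *: phi -> (p < n)%N ->
  falling a n phi = 0.
Proof.
move=> ra hp pn; rewrite fallingE // (iter_lowerX _ hp pn).
have -> : iter n (raise a) 0 = 0 :> fock by elim: n {pn} => //= n ->; rewrite linear0.
by rewrite scaler0.
Qed.

Definition fermi a phi : fock := annihA a (createX a phi).
Fact fermi_linear a : linear (fermi a).
Proof. by move=> c f g; rewrite /fermi !linearP. Qed.
HB.instance Definition _ a :=
  GRing.isLinear.Build R fock fock *:%R (fermi a) (fermi_linear a).

Lemma fermiE a phi : fermi a phi = annihA a (createX a phi). Proof. by []. Qed.

Lemma fermi_sq a phi : a.1 \in rows -> fermi a (fermi a phi) = w *: fermi a phi.
Proof.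
move=> ra; rewrite /fermi.
have := annihA_createX A X a a (createX a phi).
rewrite createX_sq // [annihA a 0]linear0 AX // !eqxx !mul1r addrC.
move/esym/eqP; rewrite subr_eq0 => /eqP h.
by rewrite -h linearZ.
Qed.

Lemma lapl_fermi a phi : fermi a (lapl a phi) = lapl a (fermi a phi).
Proof.
rewrite !laplE [fermi a (_ + _)]linearD /=; congr (_ + _).
by rewrite /fermi lowerX_annihA lowerX_createX raise_annihA raise_createX.
Qed.

Lemma bosons_fermi a phi : bosons (fermi a phi) = fermi a (bosons phi).
Proof. by rewrite /fermi bosons_annihA bosons_createX. Qed.

Lemma fermi_spec a n phi : fermi a (spec a n phi) = spec a n (fermi a phi).
Proof. exact: spec_comm (lapl_fermi a). Qed.

Opaque fermi.

(** Here [lapl a] is [number a + w], and the shift turns the factors k = 1, ..., n into k = 0, ...,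
    n-1. *)
Lemma spec_occupied a n phi : fermi a phi = w *: phi -> spec a n phi = falling a n phi.
Proof.
move=> f1; elim: n => // n IH.
rewrite specS laplE -fermiE fermi_spec f1 [spec a n (w *: _)]linearZ /= IH.
rewrite -/(number a _) opprD [- number _ _ + _]addrC addrA -scaleNr -scalerDl.
by rewrite -natr1 mulrDl mul1r addrK.
Qed.

(** Here [lapl a] is [number a], and the outer [number a] supplies, up to sign, the factor k = 0
    that [spec] lacks. *)
Lemma number_spec_empty a n phi : fermi a phi = 0 ->
  number a (spec a n phi) = - falling a n.+1 phi.
Proof.
move=> f0; elim: n => [|n IH]; first by rewrite /= mul0r scale0r sub0r opprK.
rewrite specS laplE -fermiE fermi_spec f0 [spec a n 0]linear0 addr0.
rewrite -/(number a _) IH opprK [falling a n.+2 phi]/= -/(falling a n.+1 phi).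
rewrite /number [lowerX a (_ + _)]linearD /= [raise a (_ + _)]linearD /=.
rewrite [lowerX a (_ *: _)]linearZ /= [raise a (_ *: _)]linearZ /=.
by rewrite -/(number a _) IH scalerN opprB addrC.
Qed.

Lemma scale_regular (c : R) phi : c != 0 -> c *: phi = 0 -> phi = 0.
Proof.
move=> c0 h; apply/coefP=> S m; have := congr1 (fun f => coef f S m) h.
by rewrite coefZ !coef0 => /eqP; rewrite mulf_eq0 (negbTE c0) /= => /eqP.
Qed.

(* The eigenvalues of [lapl a] on forms of degree p in the bosons are multiples of
   w between 0 and (p + 1) w, so [spec a n] is a multiple of the projection onto
   its kernel. *)
Lemma lowerX_spec a n p phi : a.1 \in rows -> bosons phi = p%:R *: phi -> (p < n)%N ->
  lowerX a (spec a n phi) = 0.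
Proof.
move=> ra hp pn; apply: (scale_regular w_neq0).
(* [fermi a] is [w] times a projection, so [w *: phi] splits into parts with eigenvalues [w] and
   0. *)
have -> : w *: lowerX a (spec a n phi) =
   lowerX a (spec a n (fermi a phi)) + lowerX a (spec a n (w *: phi - fermi a phi)).
  by rewrite -!linearD /= addrC subrK !linearZ.
have hf : bosons (fermi a phi) = p%:R *: fermi a phi.
  by rewrite bosons_fermi hp linearZ.
rewrite (spec_occupied n (fermi_sq _ ra)) (falling0 ra hf pn) linear0 add0r.
have f0 : fermi a (w *: phi - fermi a phi) = 0.
  by rewrite linearB linearZ /= fermi_sq // subrr.
have h0 : bosons (w *: phi - fermi a phi) = p%:R *: (w *: phi - fermi a phi).
  by rewrite linearB linearZ /= hf hp scalerBr !scalerA mulrC.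
apply: (@raise_inj _ _ _ _ a); rewrite -/(number a _) number_spec_empty //.
by rewrite (falling0 ra h0) ?oppr0 // ltnS ltnW.
Qed.

End Homotopy.

(** * Weights, singular vectors and the augmentation *)

Section Weights.
Variables (R : idomainType) (t s r : nat).
Local Notation T := ('I_s * 'I_r)%type.
Local Notation B := ('I_t * 'I_r)%type.
Local Notation fock := (fock R t s r).
Implicit Types (phi psi : fock) (a b : B).
Hypothesis nat_unit : forall n, n.+1%:R \is a @GRing.unit R.

Definition fermi_degree (u : 'I_r) (S : {set T}) : nat := \sum_j ((j, u) \in S).
Definition boson_degree (u : 'I_r) (m : 'X_{1..#|{: B}|}) : nat :=
  \sum_i m (enum_rank (i, u)).

Lemma coef_gl u phi S m : coef (gl u u phi) S m =
  ((fermi_degree u S)%:R - (boson_degree u m)%:R) * coef phi S m.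
Proof.
rewrite glE coefB !coef_sum mulrBl /fermi_degree /boson_degree !natr_sum !mulr_suml.
congr (_ - _); apply: eq_bigr => i _; first by rewrite coef_number.
by rewrite coef_raise_lower.
Qed.

Lemma natR_inj m n : m%:R = n%:R :> R -> m = n.
Proof.
wlog mn : m n / (m <= n)%N => [h e|].
  by case/orP: (leq_total m n) => l; [apply: h | apply/esym/h].
move=> e; apply/eqP; rewrite eqn_leq mn /= -subn_eq0; apply/eqP.
case E : (n - m)%N => [//|k]; have := nat_unit k.
by rewrite -E natrB // e subrr unitr0.
Qed.

Definition weight (p : nat) phi : Prop :=
  bosons phi = p%:R *: phi /\ forall u, gl u u phi = t%:R *: phi.

Definition singular (p : nat) phi : Prop :=
  weight p phi /\ forall u v : 'I_r, (u < v)%N -> gl u v phi = 0.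

Lemma weightP p phi : weight p phi <-> forall S m, coef phi S m != 0 ->
  mdeg m = p /\ forall u, fermi_degree u S = (t + boson_degree u m)%N.
Proof.
split=> [[h1 h2] S m c0|h].
  split=> [|u].
    have := congr1 (fun f => coef f S m) h1; rewrite coef_bosons coefZ.
    by move/(mulIf c0)/natR_inj.
  have := congr1 (fun f => coef f S m) (h2 u); rewrite coef_gl coefZ.
  by move/(mulIf c0)/eqP; rewrite subr_eq -natrD => /eqP/natR_inj.
split=> [|u]; apply/coefP=> S m.
  rewrite coef_bosons coefZ; have [->|/h[-> //]] := eqVneq (coef phi S m) 0.
  by rewrite !mulr0.
rewrite coef_gl coefZ; have [->|/h[_ ->]] := eqVneq (coef phi S m) 0.
  by rewrite !mulr0.
by rewrite natrD addrK.
Qed.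

Lemma weight_lin p c phi psi : weight p phi -> weight p psi -> weight p (c *: phi + psi).
Proof.
move=> [h1 h2] [k1 k2]; split=> [|u]; rewrite linearP /= ?h1 ?k1 ?h2 ?k2 scalerDr !scalerA.
  by rewrite mulrC.
by rewrite mulrC.
Qed.

Lemma weight0 p : weight p 0.
Proof. by split=> [|u]; rewrite linear0 scaler0. Qed.

Lemma singular_lin p c phi psi :
  singular p phi -> singular p psi -> singular p (c *: phi + psi).
Proof.
move=> [h1 h2] [k1 k2]; split=> [|u v uv]; first exact: weight_lin.
by rewrite linearP /= h2 // k2 // scaler0 addr0.
Qed.

Lemma singular0 p : singular p 0.
Proof. by split=> [|u v uv]; [exact: weight0 | rewrite linear0]. Qed.

Lemma fermi_degree_sum S : (\sum_u fermi_degree u S)%N = #|S|.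
Proof.
rewrite /fermi_degree exchange_big /= pair_big /= -sum1_card [RHS]big_mkcond /=.
by apply: eq_bigr => -[j u] _ /=; case: (_ \in _).
Qed.

Lemma boson_degree_sum m : (\sum_u boson_degree u m)%N = mdeg m.
Proof.
rewrite /boson_degree exchange_big /= pair_big /= mdegE.
rewrite (reindex (@enum_val _ {: B})) /=; last exact/onW_bij/enum_val_bij.
by apply: eq_bigr => i _; rewrite -surjective_pairing enum_valK.
Qed.

(** A state with p bosons holds [r * t + p] fermions, and there are only [r * s] modes. This bounds
    the length of the complex. *)
Lemma weight_top p phi : weight p phi -> (r * s < r * t + p)%N -> phi = 0.
Proof.
move=> /weightP h lt; apply/coefP=> S m; rewrite coef0; apply/eqP.
apply: contraLR lt => /h[<- hu]; rewrite -leqNgt -boson_degree_sum.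
have -> : (r * t = \sum_(u < r) t)%N by rewrite sum_nat_const card_ord.
rewrite -big_split /= -(eq_bigr _ (fun u _ => hu u)) fermi_degree_sum.
by apply: leq_trans (max_card _) _; rewrite card_prod !card_ord mulnC.
Qed.

Lemma lower0_zero p phi : bosons phi = p.+1%:R *: phi ->
  (forall a, lower a phi = 0) -> phi = 0.
Proof.
move=> h l0; apply: (nat_regular nat_unit (n := p)).
by rewrite -h bosonsE big1 // => a _; rewrite l0 linear0.
Qed.

Variables (A : 'M[R]_(t, s)).
Local Notation diff := (diff A).

Lemma weight_diff p phi : weight p.+1 phi -> weight p (diff phi).
Proof.
move=> [h1 h2]; split=> [|u]; last by rewrite gl_diff h2 linearZ.
by rewrite bosons_diff h1 linearZ /= -natr1 scalerDl scale1r addrK.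
Qed.

Lemma singular_diff p phi : singular p.+1 phi -> singular p (diff phi).
Proof.
move=> [h1 h2]; split=> [|u v uv]; first exact: weight_diff.
by rewrite gl_diff h2 // linear0.
Qed.

(** The augmentation. Applied to t fermions in each copy, the [r * t] contractions empty the state
    and leave a product of r maximal minors on the vacuum. *)
Definition eps phi : fock := foldr (annihA A) phi (enum {: B}).

Fact eps_linear : linear eps.
Proof. by rewrite /eps => c f g; elim: (enum _) => //= a l ->; rewrite linearP. Qed.
HB.instance Definition _ := GRing.isLinear.Build R fock fock *:%R eps eps_linear.

Lemma annihA_foldr a l phi : a \in l -> foldr (annihA A) (annihA A a phi) l = 0.
Proof.
have sgn (m : seq B) psi : exists e : bool, foldr (annihA A) (annihA A a psi) m =
    (-1) ^+ e *: annihA A a (foldr (annihA A) psi m).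
  elim: m => [|b m [e IH]] /=; first by exists false; rewrite scale1r.
  exists (~~ e); rewrite IH linearZ /= annihAC.
  by case: e {IH}; rewrite ?expr1 ?expr0 ?scaleN1r ?scale1r ?opprK.
case: (sgn l phi) => e -> al.
suff -> : annihA A a (foldr (annihA A) phi l) = 0 by rewrite scaler0.
elim: l al => // b l IH; rewrite inE /= => /orP[/eqP<-|/IH h].
  exact: annihA_sq.
by rewrite annihAC h linear0 oppr0.
Qed.

Lemma eps_annihA a phi : eps (annihA A a phi) = 0.
Proof. by apply: annihA_foldr; rewrite mem_enum. Qed.

Lemma eps_diff phi : eps (diff phi) = 0.
Proof. by rewrite diffE linear_sum big1 // => a _; rewrite /= eps_annihA. Qed.

Lemma lower_eps a phi : lower a (eps phi) = eps (lower a phi).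
Proof. by rewrite /eps; elim: (enum _) => //= b l <-; rewrite lower_annihA. Qed.

Lemma gl_foldr u l phi : gl u u (foldr (annihA A) phi l) =
  foldr (annihA A) (gl u u phi) l - (count (fun a : B => a.2 == u) l)%:R *: foldr (annihA A) phi l.
Proof.
elim: l => [|a l IH]; first by rewrite scale0r subr0.
rewrite [foldr _ _ _]/= gl_annihA IH [annihA A a (_ - _)]linearB /=.
rewrite [annihA A a (_ *: _)]linearZ /= -addrA -opprD; congr (_ - _).
move: (foldr _ phi l) => F; move: (count _ _) => n.
case: eqP => [<-|_]; last by rewrite scale0r addr0.
by rewrite -surjective_pairing scale1r add1n -natr1 scalerDl scale1r.
Qed.

Lemma count_enum u : count (fun a : B => a.2 == u) (enum {: B}) = t.
Proof.
rewrite (_ : count _ _ = #|[pred a : B | a.2 == u]|); last first.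
  by rewrite enumT cardE /enum_mem size_filter; apply: eq_count.
have -> : #|[pred a : B | a.2 == u]| = #|[set (i, u) | i : 'I_t]|.
  apply: eq_card => -[i v]; rewrite inE /=.
  by apply/idP/imsetP => [/eqP-> | [j _ [_ ->]] //]; exists i.
by rewrite card_imset ?card_ord // => i j [].
Qed.

(* The image of [eps] lies in the line spanned by the vacuum. *)
Lemma eps_vacuum phi : weight 0 phi ->
  forall S m, (S, m) != (set0, 0%MM) -> coef (eps phi) S m = 0.
Proof.
move=> [h1 h2] S m Sm.
have e1 : bosons (eps phi) = 0.
  rewrite bosonsE big1 // => a _; rewrite lower_eps bosons0_lower ?linear0 //.
  by rewrite h1 scale0r.
have e2 u : gl u u (eps phi) = 0.
  by rewrite /eps gl_foldr count_enum h2 -/(eps _) -/(eps _) linearZ subrr.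
have [m0|m0] := eqVneq (mdeg m) 0%N; last first.
  have := congr1 (fun f => coef f S m) e1; rewrite coef_bosons coef0.
  by case: (mdeg m) m0 => // k _ /nat_regularR; apply.
move/eqP: m0; rewrite mdeg_eq0 => /eqP m0; rewrite {}m0 in Sm *.
have /set0Pn[[j u] jS] : S != set0 by apply: contraNneq Sm => ->.
have := congr1 (fun f => coef f S 0%MM) (e2 u); rewrite coef_gl coef0.
rewrite [boson_degree u 0](_ : _ = 0)%N; last first.
  by rewrite /boson_degree big1 // => i _; rewrite mnm0E.
rewrite subr0 /fermi_degree (bigD1 j) //= jS.
by rewrite add1n => /nat_regularR; apply.
Qed.

End Weights.

(** * The projection onto gl_r-singular vectors *)

Section Reduction.
Variables (R : idomainType) (t s r : nat).
Local Notation T := ('I_s * 'I_r)%type.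
Local Notation B := ('I_t * 'I_r)%type.
Local Notation fock := (fock R t s r).
Implicit Types (phi psi : fock) (a b : B).
Hypothesis nat_unit : forall n, n.+1%:R \is a @GRing.unit R.
Variables (A : 'M[R]_(t, s)).
Local Notation annihA := (annihA A).
Local Notation diff := (diff A).
Local Notation eps := (eps A).

(** What is asked of a projection onto singular vectors. [proj_stable] expresses, without naming a
    formula, that it is a polynomial in the operators [gl u v]. *)
Record projector (pr : nat -> fock -> fock) : Prop := Projector {
  proj_linear : forall p, linear (pr p);
  proj_singular : forall p phi, weight p phi -> singular p (pr p phi);
  proj_id : forall p phi, singular p phi -> pr p phi = phi;
  proj_diff : forall p phi, weight p.+1 phi -> pr p (diff phi) = diff (pr p.+1 phi);
  proj_stable : forall p (P : fock -> Prop),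
    (forall c f g, P f -> P g -> P (c *: f + g)) ->
    (forall u v f, P f -> P (gl u v f)) -> forall phi, P phi -> P (pr p phi);
  proj_eps : forall phi, weight 0 phi -> eps (pr 0%N phi) = eps phi }.

Variables (X : 'M[R]_(s, t)) (w : R) (rows : {set 'I_t}).
Hypothesis AX : {in rows &, forall i l, (A *m X) i l = (i == l)%:R * w}.
Hypothesis w_neq0 : w != 0.
Local Notation createX := (createX X).
Local Notation lowerX := (lowerX A X).
Local Notation spec := (spec A X w).
Local Notation spec_homot := (spec_homot A X w).

Lemma weight_homot p a phi : weight p phi -> weight p.+1 (homot X a phi).
Proof.
move=> [h1 h2]; split=> [|u]; last by rewrite gl_homot h2 linearZ.
rewrite homotE bosons_createX bosons_raise h1 linearZ /= -[X in _ + X]scale1r.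
by rewrite -scalerDl natr1 [LHS]linearZ.
Qed.

Lemma weight_spec p a n phi : weight p phi -> weight p (spec a n phi).
Proof.
move=> h; elim: n => //= n [h1 h2]; split=> [|u].
  by rewrite linearB linearZ /= bosons_lapl h1 [lapl _ _ _ _]linearZ /= scalerBr !scalerA mulrC.
by rewrite linearB linearZ /= gl_lapl h2 [lapl _ _ _ _]linearZ /= scalerBr !scalerA mulrC.
Qed.

Lemma weight_spec_homot p a n phi : weight p phi -> weight p.+1 (spec_homot a n phi).
Proof.
move=> h; elim: n => [|n IH] /=; first exact: weight0.
by apply: weight_lin => //; apply/weight_homot/weight_spec.
Qed.

Definition specs (l : seq B) n phi : fock := foldr (fun a => spec a n) phi l.
Fixpoint specs_homot (l : seq B) n phi : fock :=
  if l is a :: l' then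
    (n`!%:R * w ^+ n) *: specs_homot l' n phi + spec_homot a n (specs l' n phi)
  else 0.

Fact specs_linear l n : linear (specs l n).
Proof. by rewrite /specs => c f g; elim: l => //= a l ->; rewrite [LHS]linearP. Qed.
HB.instance Definition _ l n :=
  GRing.isLinear.Build R fock fock *:%R (specs l n) (specs_linear l n).
Fact specs_homot_linear l n : linear (specs_homot l n).
Proof.
move=> c f g; elim: l => [|a l IH] /=; first by rewrite scaler0 addr0.
rewrite IH [specs l n (_ + _)]linearP [spec_homot _ _ (_ + _)]linearP /=.
by rewrite [in LHS]scalerDr [in RHS]scalerDr addrACA !scalerA [c * _]mulrC.
Qed.
HB.instance Definition _ l n :=
  GRing.isLinear.Build R fock fock *:%R (specs_homot l n) (specs_homot_linear l n).

Lemma specs_diff l n phi : diff (specs l n phi) = specs l n (diff phi).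
Proof.
rewrite /specs; elim: l => //= a l <-.
by rewrite -(spec_comm _ _ _ (L := diff)) // => psi; rewrite lapl_diff.
Qed.

Lemma specs_homotP l n phi : specs l n phi = (n`!%:R * w ^+ n) ^+ size l *: phi -
  (diff (specs_homot l n phi) + specs_homot l n (diff phi)).
Proof.
elim: l => [|a l IH] /=; first by rewrite scale1r linear0 addr0 subr0.
rewrite -/(specs l n phi) spec_homotP // specs_diff {1}IH scalerBr scalerA -exprS.
rewrite -/(specs l n (diff phi)) -addrA -opprD; congr (_ - _).
rewrite [diff (_ + _)]linearD /= [diff (_ *: _)]linearZ /= scalerDr.
by rewrite addrACA.
Qed.

Lemma weight_specs p l n phi : weight p phi -> weight p (specs l n phi).
Proof. by move=> h; rewrite /specs; elim: l => //= a l IH; apply: weight_spec. Qed.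

Lemma weight_specs_homot p l n phi : weight p phi -> weight p.+1 (specs_homot l n phi).
Proof.
move=> h; elim: l => [|a l IH] /=; first exact: weight0.
by apply: weight_lin => //; apply/weight_spec_homot/weight_specs.
Qed.

Lemma lowerX_specs l n p phi : uniq l -> {subset l <= setX rows setT} ->
  weight p phi -> (p < n)%N -> forall b, b \in l -> lowerX b (specs l n phi) = 0.
Proof.
move=> ul sl wp pn; elim: l ul sl => //= a l IH /andP[al ul] sl b.
have sl' : {subset l <= setX rows setT} by move=> x xl; apply: sl; rewrite inE xl orbT.
have ra : a \in setX rows setT by apply: sl; rewrite inE eqxx.
rewrite inE -/(specs l n phi); case/orP=> [/eqP->|bl].
  have [h _] := weight_specs l n wp.
  apply: (lowerX_spec nat_unit AX w_neq0 _ h pn).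
  by move: ra; rewrite inE => /andP[].
have ab : a != b by apply: contraNneq al => ->.
rewrite -/(specs l n phi) (spec_comm _ _ _ (L := lowerX b)).
  by rewrite /= IH // linear0.
by move=> psi; rewrite /= (lowerX_lapl AX) // sl'.
Qed.

Variable pr : nat -> fock -> fock.
Hypothesis prP : projector pr.

Lemma pr_linear p : linear (pr p). Proof. exact: proj_linear prP p. Qed.
HB.instance Definition _ p :=
  GRing.isLinear.Build R fock fock *:%R (pr p) (pr_linear p).

Let modes := enum (setX rows [set: 'I_r]).

Definition red_map n p phi : fock := pr p (specs modes n phi).
Definition red_homot n p phi : fock := pr p.+1 (specs_homot modes n phi).
Definition red_const n : R := (n`!%:R * w ^+ n) ^+ #|setX rows [set: 'I_r]|.

Lemma red_map_linear n p : linear (red_map n p).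
Proof. by move=> c f g; rewrite /red_map !linearP. Qed.
Lemma red_homot_linear n p : linear (red_homot n p).
Proof. by move=> c f g; rewrite /red_homot !linearP. Qed.

Lemma red_map_singular n p phi : weight p phi -> singular p (red_map n p phi).
Proof. by move=> h; apply/(proj_singular prP)/weight_specs. Qed.
Lemma red_homot_singular n p phi : weight p phi -> singular p.+1 (red_homot n p phi).
Proof. by move=> h; apply/(proj_singular prP)/weight_specs_homot. Qed.

Lemma red_map_diff n p phi : weight p.+1 phi ->
  red_map n p (diff phi) = diff (red_map n p.+1 phi).
Proof.
move=> h; rewrite /red_map -specs_diff (proj_diff prP) //; exact: weight_specs.
Qed.

(** The homotopy of the Fock space leaves the singular vectors; [pr] fixes [phi] and commutes with
    [diff], hence brings the homotopy back into the complex. *)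
Lemma red_homotP n p phi : singular p.+1 phi -> red_const n *: phi =
  red_map n p.+1 phi + (diff (red_homot n p.+1 phi) + red_homot n p (diff phi)).
Proof.
move=> h; have [hw _] := h.
have /eqP := specs_homotP modes n phi; rewrite -subr_eq opprK => /eqP e.
rewrite /red_const cardE -[in LHS](proj_id prP h) -[LHS]linearZ -e.
rewrite linearD /= [pr _ (_ + _)]linearD /= (proj_diff prP) //.
exact: weight_specs_homot.
Qed.

Lemma red_constE n : exists2 c : R, c \is a GRing.unit & exists N, red_const n = c * w ^+ N.
Proof.
exists (n`!%:R ^+ #|setX rows [set: 'I_r]|); last by eexists; rewrite /red_const exprMn -exprM.
by rewrite unitrX // -(prednK (fact_gt0 n)).
Qed.

(** [gl] mixes the copies of a lowering operator, so the vanishing is carried through [pr] for all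
    copies [v] of the row [i] at once. *)
Lemma lowerX_red n p phi i u : i \in rows -> weight p phi -> (p < n)%N ->
  lowerX (i, u) (red_map n p phi) = 0.
Proof.
move=> ri wp pn; rewrite /red_map.
have h : forall b, b \in setX rows [set: 'I_r] -> lowerX b (specs modes n phi) = 0.
  move=> b bm; apply: (@lowerX_specs modes n p phi _ _ wp pn b).
  - exact: enum_uniq.
  - by move=> x; rewrite mem_enum.
  - by rewrite mem_enum.
pose P psi := forall v, lowerX (i, v) psi = 0.
have : P (pr p (specs modes n phi)).
  apply: (@proj_stable _ prP p P) => [c f g hf hg v|v v' f hf v''|v].
  - by rewrite linearP /= hf hg scaler0 addr0.
  - have /eqP := gl_lowerX A X v v' (i, v'') f.
    by rewrite hf /= hf scaler0 addr0 linear0 eq_sym => /eqP.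
  - by apply: h; rewrite inE ri inE.
exact.
Qed.

(** With every row inverted, a vector killed by all [lowerX] is killed by all [lower], hence 0 in
    positive degree: [red_map] vanishes and the homotopy contracts. *)
Lemma exact_full p phi : rows = setT -> singular p.+1 phi -> diff phi = 0 ->
  exists N, exists2 psi, singular p.+2 psi & w ^+ N *: phi = diff psi.
Proof.
move=> rT h d0; have [hw _] := h.
have [c cu [N cN]] := red_constE p.+2.
exists N, (c^-1 *: red_homot p.+2 p.+1 phi).
  rewrite -[_ *: _]addr0; apply: singular_lin; first exact: red_homot_singular.
  exact: singular0.
have k0 : red_map p.+2 p.+1 phi = 0.
  have [[h1 h2] _] := red_map_singular p.+2 hw.
  apply: (lower0_zero nat_unit h1) => -[i u].
  have ri j : j \in rows by rewrite rT inE.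
  have := lowerX_red u (ri i) hw (ltnSn _).
  rewrite lowerXE (bigD1 i) //= big1 ?addr0 => [|j ji]; last first.
    by rewrite AX // (negbTE ji) mul0r scale0r.
  by rewrite AX // eqxx mul1r => /(scale_regular w_neq0).
have := red_homotP p.+2 h; rewrite k0 add0r d0.
have -> : red_homot p.+2 p 0 = 0 by rewrite /red_homot !linear0.
rewrite addr0 cN => e; rewrite linearZ /= -e scalerA mulrA mulVr ?mul1r //.
Qed.

Fixpoint fill (l : seq B) phi : fock :=
  if l is b :: l' then fill l' (createX b phi) else phi.

Lemma fill_linear l : linear (fill l).
Proof. by elim: l => //= b l IH c f g; rewrite linearP IH. Qed.
HB.instance Definition _ l := GRing.isLinear.Build R fock fock *:%R (fill l) (fill_linear l).

Lemma fill_annihA l b phi : uniq (b :: l) -> {subset b :: l <= setX rows setT} ->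
  exists e : bool, fill l (annihA b phi) = (-1) ^+ e *: annihA b (fill l phi).
Proof.
elim: l phi => [|a l IH] phi; first by exists false; rewrite scale1r.
rewrite /= inE negb_or -andbA => /and3P[ba bl /andP[al ul]] sl.
have [||e he] := IH (createX a phi).
- by rewrite /= bl.
- by move=> x xl; apply: sl; move: xl; rewrite !inE => /orP[->//|->]; rewrite !orbT.
exists (~~ e).
have := annihA_createX A X b a phi; rewrite AX.
- rewrite [X in X *: _](_ : _ = 0) ?scale0r ?addr0 => [h|]; last first.
    rewrite mulrA -natrM mulnb; case: (a) (b) ba => [a1 a2] [b1 b2] /=.
    by rewrite xpair_eqE andbC => /negbTE->; rewrite mul0r.
  have -> : createX a (annihA b phi) = - annihA b (createX a phi) by rewrite h opprK.
  by rewrite linearN /= he; case: (e); rewrite ?expr0 ?expr1 ?scaleN1r ?scale1r ?opprK.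
- by have := sl b; rewrite inE eqxx !inE andbT; apply.
- by have := sl a; rewrite !inE eqxx orbT andbT; apply.
Qed.

Lemma gl_fill u l phi : gl u u (fill l phi) =
  fill l (gl u u phi) + (count (fun a : B => a.2 == u) l)%:R *: fill l phi.
Proof.
elim: l phi => [|a l IH] phi; first by rewrite scale0r addr0.
rewrite [fill _ _]/= IH gl_createX linearD /= -addrA; congr (_ + _).
move: (count _ _) => n; case: eqP => [<-|_]; last by rewrite scale0r linear0 add0r.
by rewrite scale1r -surjective_pairing add1n -nat1r scalerDl scale1r.
Qed.

Lemma bosons_fill l phi : bosons (fill l phi) = fill l (bosons phi).
Proof. by elim: l phi => //= b l IH phi; rewrite IH bosons_createX. Qed.
Lemma bosons_foldr l phi : bosons (foldr annihA phi l) = foldr annihA (bosons phi) l.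
Proof. by elim: l => //= b l <-; rewrite bosons_annihA. Qed.

Lemma foldr_annihAZ l c phi : foldr annihA (c *: phi) l = c *: foldr annihA phi l.
Proof. by elim: l => //= b l ->; rewrite linearZ. Qed.

Lemma annihA_exact b phi : bosons phi = 0 -> annihA b phi = diff (raise b phi).
Proof.
move=> h; rewrite diffE (bigD1 b) //= big1 ?addr0 => [|c cb]; rewrite lower_raise.
  by rewrite eqxx scale1r bosons0_lower // linear0 add0r.
by rewrite bosons0_lower // linear0 (negbTE cb) scale0r addr0 linear0.
Qed.

(** Without bosons every [annihA b psi] is the boundary of [raise b psi], so modulo boundaries [w]
    acts as [createX b] after [annihA b]. Over all modes the contractions compose to [eps], which is
    then the only obstruction in degree 0. *)
Lemma fill_annihA_homotopic l phi : uniq l -> {subset l <= setX rows setT} ->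
  weight 0 phi -> exists2 psi, weight 1 psi &
    w ^+ size l *: phi = fill l (foldr annihA phi l) + diff psi.
Proof.
move=> + + h0; elim: l => [|b l IH] ul sl.
  by exists 0; [exact: weight0 | rewrite scale1r linear0 addr0].
have sl' : {subset l <= setX rows setT} by move=> x xl; apply: sl; rewrite inE xl orbT.
have [psi hpsi e] := IH (subseq_uniq (subseq_cons l b) ul) sl'.
have [h1 h2] := h0; set phi' := foldr annihA phi l.
have b0 : bosons phi' = 0 by rewrite bosons_foldr h1 foldr_annihAZ scale0r.
have rb : b.1 \in rows by have := sl b; rewrite inE eqxx inE andbC => /(_ isT)/andP[].
have key : w *: phi' = createX b (annihA b phi') + annihA b (createX b phi').
  by rewrite annihA_createX AX // !eqxx !mul1r addrA subrr add0r.
have [sg hsg] := fill_annihA (createX b phi') ul sl.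
exists (w *: psi + (-1) ^+ sg *: raise b (fill l (createX b phi'))).
  apply: weight_lin => //; rewrite -[X in weight _ X]addr0.
  apply: weight_lin; last exact: weight0.
  split=> [|u].
    by rewrite bosons_raise bosons_fill bosons_createX b0 linear0 linear0 linear0 add0r scale1r.
  have g' : gl u u phi' = (t%:R - (count (fun a : B => a.2 == u) l)%:R) *: phi'.
    by rewrite gl_foldr h2 foldr_annihAZ scalerBl.
  rewrite gl_raise gl_fill gl_createX g' [createX b (_ *: _)]linearZ /=.
  move: (count _ _) => n; set y := createX b phi'.
  case: eqP => [<-|_].
    rewrite -surjective_pairing !scale1r [fill l (_ + _)]linearD /=.
    rewrite [fill l (_ *: _)]linearZ /= addrAC -scalerDl subrK.
    by rewrite [raise b (_ + _)]linearD /= addrK [LHS]linearZ.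
  rewrite !scale0r addr0 subr0 [fill l (_ *: _)]linearZ /= -scalerDl subrK.
  by rewrite [LHS]linearZ.
rewrite [size _]/= exprS -scalerA e scalerDr -/phi' -[w *: fill l _]linearZ key linearD /=.
rewrite -!addrA; congr (_ + _); rewrite hsg annihA_exact; last first.
  by rewrite bosons_fill bosons_createX b0 !linear0.
by rewrite addrC linearD /= !linearZ.
Qed.

Lemma exact_full0 phi : rows = setT -> singular 0 phi -> eps phi = 0 ->
  exists N, exists2 psi, singular 1 psi & w ^+ N *: phi = diff psi.
Proof.
move=> rT h e0; have [hw _] := h.
have [||psi wpsi e] := @fill_annihA_homotopic (enum {: B}) phi _ _ hw.
- exact: enum_uniq.
- by move=> x _; rewrite !inE rT inE.
exists (size (enum {: B})), (pr 1 psi); first exact: proj_singular.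
rewrite -(proj_diff prP) // -[in LHS](proj_id prP h) -[LHS]linearZ e /=.
by rewrite [foldr _ _ _]e0 linear0 add0r.
Qed.

End Reduction.

Section ProjectorOne.
Variables (R : idomainType) (t s : nat) (A : 'M[R]_(t, s)).

Lemma projector1 : projector (r := 1) A (fun _ phi => phi).
Proof.
split.
- by move=> p c f g.
- by move=> p phi h; split=> // u v; rewrite !ord1.
- by [].
- by [].
- by move=> p P _ _ phi.
- by [].
Qed.
End ProjectorOne.

(** * The extremal projector for two copies *)

Section GlTwo.
Variables (R : idomainType) (t s : nat).
Local Notation B := ('I_t * 'I_2)%type.
Local Notation fock := (fock R t s 2).
Implicit Types (phi psi : fock).
Hypothesis nat_unit : forall n, n.+1%:R \is a @GRing.unit R.
Variable A : 'M[R]_(t, s).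

Let o0 : 'I_2 := ord0.
Let o1 : 'I_2 := ord_max.

Definition sl_e : fock -> fock := gl o0 o1.
Definition sl_f : fock -> fock := gl o1 o0.
HB.instance Definition _ := GRing.Linear.on sl_e.
HB.instance Definition _ := GRing.Linear.on sl_f.

(** The weights are taken in R, because [sl_e] and [sl_f] shift them by one in opposite directions
    and they may become negative. *)
Definition biweight (p : nat) (x y : R) phi : Prop :=
  [/\ bosons phi = p%:R *: phi, gl o0 o0 phi = x *: phi & gl o1 o1 phi = y *: phi].

Lemma biweight_e p x y phi : biweight p x y phi -> biweight p (x + 1) (y - 1) (sl_e phi).
Proof.
move=> [h1 h2 h3]; split; rewrite /sl_e.
- by rewrite bosons_gl h1 linearZ.
- by rewrite gl_comm h2 [gl _ _ (_ *: _)]linearZ /= scale0r subr0 scale1r scalerDl scale1r.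
- by rewrite gl_comm h3 [gl _ _ (_ *: _)]linearZ /= scale0r addr0 scale1r scalerBl scale1r.
Qed.

Lemma biweight_f p x y phi : biweight p x y phi -> biweight p (x - 1) (y + 1) (sl_f phi).
Proof.
move=> [h1 h2 h3]; split; rewrite /sl_f.
- by rewrite bosons_gl h1 linearZ.
- by rewrite gl_comm h2 [gl _ _ (_ *: _)]linearZ /= scale0r addr0 scale1r scalerBl scale1r.
- by rewrite gl_comm h3 [gl _ _ (_ *: _)]linearZ /= scale0r subr0 scale1r scalerDl scale1r.
Qed.

Lemma biweight_iter_e p x y k phi :
  biweight p x y phi -> biweight p (x + k%:R) (y - k%:R) (iter k sl_e phi).
Proof.
move=> h; elim: k => [|k IH]; first by rewrite addr0 subr0.
by rewrite -natr1 opprD !addrA; apply: biweight_e.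
Qed.

Lemma biweight_iter_f p x y k phi :
  biweight p x y phi -> biweight p (x - k%:R) (y + k%:R) (iter k sl_f phi).
Proof.
move=> h; elim: k => [|k IH]; first by rewrite addr0 subr0.
by rewrite -natr1 opprD !addrA; apply: biweight_f.
Qed.

Lemma sl_ef p x y phi : biweight p x y phi ->
  sl_e (sl_f phi) = sl_f (sl_e phi) + (x - y) *: phi.
Proof.
move=> [h1 h2 h3]; rewrite /sl_e /sl_f gl_comm h2 h3 /= !scale1r.
by rewrite -addrA -scalerBl.
Qed.

Lemma sl_e_diff phi : sl_e (diff A phi) = diff A (sl_e phi).
Proof. exact: gl_diff. Qed.
Lemma sl_f_diff phi : sl_f (diff A phi) = diff A (sl_f phi).
Proof. exact: gl_diff. Qed.
Lemma sl_eE phi : sl_e phi = gl o0 o1 phi. Proof. by []. Qed.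
Lemma sl_fE phi : sl_f phi = gl o1 o0 phi. Proof. by []. Qed.
Opaque sl_e sl_f.

Lemma iter_linear (L : {linear fock -> fock}) k : linear (iter k L).
Proof. by move=> c f g; elim: k => //= k ->; rewrite linearP. Qed.

Lemma iter_sl_e0 k : iter k sl_e 0 = 0.
Proof. by elim: k => // k IH; rewrite iterS IH linear0. Qed.
Lemma iter_sl_f0 k : iter k sl_f 0 = 0.
Proof. by elim: k => // k IH; rewrite iterS IH linear0. Qed.

Lemma sl_e_iter_f p x y k phi : biweight p x y phi -> sl_e (iter k sl_f phi) =
  iter k sl_f (sl_e phi) + (k%:R * (x - y - k%:R + 1)) *: iter k.-1 sl_f phi.
Proof.
move=> h; elim: k => [|k IH]; first by rewrite mul0r scale0r addr0.
rewrite iterS (sl_ef (biweight_iter_f k h)) IH [sl_f (_ + _)]linearD /= -addrA.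
congr (_ + _); rewrite [sl_f (_ *: _)]linearZ /=.
have -> : (k%:R * (x - y - k%:R + 1)) *: sl_f (iter k.-1 sl_f phi) =
          (k%:R * (x - y - k%:R + 1)) *: iter k sl_f phi.
  by case: (k) => [|m] //; rewrite !mul0r !scale0r.
by rewrite -scalerDl -natr1; congr (_ *: _); ring.
Qed.

(** [(-1)^k / (k! (k+1)!)], the coefficients of the extremal projector of sl_2 at weight
    [x - y = 0]. *)
Fixpoint proj_coef (k : nat) : R :=
  if k is k'.+1 then - proj_coef k' / (k'.+1%:R * k'.+2%:R) else 1.

Lemma proj_coefS k : proj_coef k + proj_coef k.+1 * (k.+1%:R * k.+2%:R) = 0.
Proof.
by rewrite /= divrK ?addrN // unitrM !nat_unit.
Qed.

Definition sl_term k phi := iter k sl_f (iter k sl_e phi).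
Definition sl_proj n phi : fock := \sum_(k < n) proj_coef k *: sl_term k phi.

Lemma sl_term_linear k : linear (sl_term k).
Proof.
move=> c f g; rewrite /sl_term.
exact: etrans (congr1 _ (iter_linear sl_e k c f g)) (iter_linear sl_f k c _ _).
Qed.

Lemma sl_proj_linear n : linear (sl_proj n).
Proof.
move=> c f g; rewrite /sl_proj scaler_sumr -big_split; apply: eq_bigr => k _ /=.
by rewrite sl_term_linear scalerDr !scalerA mulrC.
Qed.

Lemma ord2P (u : 'I_2) : u = o0 \/ u = o1.
Proof. by case: u => [[|[|//]] hu]; [left | right]; apply: val_inj. Qed.

Lemma weight_biweight p phi : weight p phi -> biweight p t%:R t%:R phi.
Proof. by case. Qed.

Lemma biweight_weight p phi : biweight p t%:R t%:R phi -> weight p phi.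
Proof.
move=> [h1 h2 h3]; split; first exact: h1.
by move=> u; case: (ord2P u) => ->; [exact: h2 | exact: h3].
Qed.

(** The second weight drops to [t - k], while fermions minus bosons in a copy is at least [-p]. *)
Lemma sl_e_nilpotent p k phi : weight p phi -> (t + p < k)%N -> iter k sl_e phi = 0.
Proof.
move=> h pk; have [h1 _ h3] := biweight_iter_e k (weight_biweight h).
apply/coefP=> S m; rewrite coef0; apply/eqP; apply: contraLR pk => c0.
rewrite -leqNgt; have := congr1 (fun f => coef f S m) h1.
rewrite coef_bosons coefZ => /(mulIf c0)/(natR_inj nat_unit) mp.
have := congr1 (fun f => coef f S m) h3; rewrite coef_gl coefZ => /(mulIf c0).
move/eqP; rewrite subr_eq addrAC eq_sym subr_eq -!natrD => /eqP/(natR_inj nat_unit) e.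
have : (k <= t + boson_degree o1 m)%N by rewrite e leq_addl.
move/leq_trans; apply; rewrite leq_add2l -mp -boson_degree_sum.
by rewrite (bigD1 o1) //= leq_addr.
Qed.

(** The sum telescopes: moving [sl_e] through the k-th term yields multiples of f^k e^(k+1) and
    f^(k-1) e^k, neighbours cancel by [proj_coefS], and the last one is 0 by nilpotency. *)
Lemma sl_e_proj p n phi : weight p phi -> (t + p < n)%N -> sl_e (sl_proj n phi) = 0.
Proof.
move=> h pn; rewrite /sl_proj linear_sum /=.
have key k : sl_e (proj_coef k *: sl_term k phi) =
    proj_coef k *: iter k sl_f (iter k.+1 sl_e phi) +
    (proj_coef k * (k%:R * k.+1%:R)) *: iter k.-1 sl_f (iter k sl_e phi).
  transitivity (proj_coef k *: sl_e (sl_term k phi)); first exact: linearZ.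
  rewrite /sl_term; have E := sl_e_iter_f k (biweight_iter_e k (weight_biweight h)).
  apply: etrans (congr1 (fun x => proj_coef k *: x) E) _.
  (* After k raisings the weights differ by [2 k], so [x - y - k + 1] is [k + 1]. *)
  rewrite scalerDr scalerA; congr (_ + (_ * (_ * _)) *: _).
  by rewrite -natr1; ring.
rewrite (eq_bigr _ (fun (k : 'I_n) _ => key k)) big_split /=.
case: n pn => // n pn; rewrite big_ord_recr /= -iterS (sl_e_nilpotent h) //.
rewrite iter_sl_f0 scaler0 addr0 big_ord_recl /= mul0r mulr0 scale0r add0r -big_split /=.
rewrite big1 // => k _; rewrite -scalerDl proj_coefS scale0r //.
Qed.

Lemma sl_termS0 k phi : sl_e phi = 0 -> sl_term k.+1 phi = 0.
Proof.
move=> h; have e : iter k.+1 sl_e phi = 0.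
  by rewrite iterSr; apply: etrans (iter_sl_e0 k); congr iter.
exact: etrans (congr1 (iter k.+1 sl_f) e) (iter_sl_f0 _).
Qed.

Definition proj2 (p : nat) : fock -> fock := sl_proj (t + p).+1.

Lemma sl_proj_stable n (P : fock -> Prop) :
  (forall c f g, P f -> P g -> P (c *: f + g)) ->
  (forall u v f, P f -> P (gl u v f)) -> forall phi, P phi -> P (sl_proj n phi).
Proof.
move=> hl hg phi hp; rewrite /sl_proj.
have P0 : P 0 by rewrite -(addNr phi) -scaleN1r; apply: hl.
elim/big_ind: _ => // [x y hx hy|k _]; first by rewrite -[x]scale1r; apply: hl.
have it L : (forall y, P y -> P (L y)) -> forall j x, P x -> P (iter j L x).
  by move=> hL j x px; elim: j => // j; apply: hL.
rewrite -[_ *: _]addr0; apply: hl => //; rewrite /sl_term.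
have hx : P (iter k sl_e phi) by apply: (it _ _ _ _ hp) => y; apply: hg.
by apply: (it _ _ _ _ hx) => y; apply: hg.
Qed.

(** Moving [gl u v] past the letter (i, u) creates the letter (i, v); if that occurs elsewhere in
    the word, the new term vanishes because letters anticommute and square to 0. The word [m]
    collects the letters already passed. *)
Lemma foldr_gl (u v : 'I_2) (m l : seq B) phi : u != v ->
  (forall a, a \in l -> a.2 = u -> ((a.1, v) \in m) || ((a.1, v) \in l)) ->
  foldr (annihA A) (gl u v (foldr (annihA A) phi l) -
     foldr (annihA A) (gl u v phi) l) m = 0.
Proof.
have fl c f g k : foldr (annihA A) (c *: f + g) k =
    c *: foldr (annihA A) f k + foldr (annihA A) g k.
  by elim: k => //= b k ->; rewrite linearP.
have fB f g k : foldr (annihA A) (f - g) k = foldr (annihA A) f k - foldr (annihA A) g k.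
  by rewrite addrC -scaleN1r fl scaleN1r addrC.
move=> uv; elim: l m => [|a l IH] m hm.
  by rewrite /= subrr; elim: m {hm} => //= b m ->; rewrite linear0.
rewrite [foldr _ phi (a :: l)]/= [foldr _ (gl _ _ _) (a :: l)]/= gl_annihA.
set F := foldr _ phi l; rewrite addrAC -linearB /= fB.
have e x : foldr (annihA A) (annihA A a x) m = foldr (annihA A) x (rcons m a).
  by rewrite foldr_rcons.
rewrite e IH ?sub0r; last first.
  move=> b bl bu; have := hm b; rewrite inE bl orbT => /(_ isT bu).
  by rewrite mem_rcons !inE => /or3P[]->; rewrite ?orbT.
have f0 k : foldr (annihA A) 0 k = 0.
  by elim: k => //= b k ->; rewrite linear0.
have [au|_] := eqVneq a.2 u; last by rewrite scale0r f0 oppr0.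
have := hm a; rewrite inE eqxx au => /(_ isT erefl).
rewrite scale1r inE => /or3P[h|/eqP h|h].
- by rewrite annihA_foldr ?oppr0.
- by have := congr1 snd h; rewrite /= au => vu; rewrite vu eqxx in uv.
rewrite (_ : annihA A (a.1, v) F = 0) ?f0 ?oppr0 // /F.
move: h; elim: (l) => // b k IHk; rewrite inE => /orP[/eqP->|/IHk h].
  by rewrite /= annihA_sq.
by rewrite /= annihAC h linear0 oppr0.
Qed.

Lemma eps_gl (u v : 'I_2) phi : u != v -> eps A (gl u v phi) = gl u v (eps A phi).
Proof.
move=> uv; have := @foldr_gl u v [::] (enum {: B}) phi uv.
move/(_ _)/eqP; rewrite /= subr_eq0 => h; apply/esym/eqP/h => a _ _.
by rewrite mem_enum.
Qed.

(** After t fermions of each copy are removed the second weight is -1, which a state without bosons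
    cannot have. Since [eps] commutes with [sl_f], this kills all correction terms of the projector
    under [eps]. *)
Lemma eps_biweight phi : biweight 0 (t%:R + 1) (t%:R - 1) phi -> eps A phi = 0.
Proof.
move=> [h1 h2 h3].
have e1 : bosons (eps A phi) = 0.
  rewrite bosonsE big1 // => a _; rewrite lower_eps bosons0_lower ?linear0 //.
  by rewrite h1 scale0r.
have e2 : gl o1 o1 (eps A phi) = - eps A phi.
  rewrite {1}/eps gl_foldr count_enum h3 -/(eps A _) -/(eps A _) linearZ /=.
  by rewrite scalerBl scale1r addrAC subrr sub0r.
apply/coefP=> S m; rewrite coef0.
have [m0|m0] := eqVneq (mdeg m) 0%N; last first.
  have := congr1 (fun f => coef f S m) e1; rewrite coef_bosons coef0.
  by case: (mdeg m) m0 => // k _ /(nat_regularR nat_unit).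
move/eqP: m0; rewrite mdeg_eq0 => /eqP ->.
have := congr1 (fun f => coef f S 0%MM) e2; rewrite coef_gl coefN.
rewrite [boson_degree o1 0](_ : _ = 0)%N; last first.
  by rewrite /boson_degree big1 // => i _; rewrite mnm0E.
rewrite subr0 => /eqP; rewrite -addr_eq0 -{2}[coef _ _ _]mul1r -mulrDl natr1.
by move/eqP/(nat_regularR nat_unit).
Qed.

Lemma weight_sl_proj p n phi : weight p phi -> weight p (sl_proj n phi).
Proof.
move=> h; rewrite /sl_proj; elim/big_ind: _ => [|x y hx hy|k _].
- exact: weight0.
- by rewrite -[x]scale1r; apply: weight_lin.
rewrite -[X in weight _ X]addr0; apply: weight_lin; last exact: weight0.
apply: biweight_weight; rewrite /sl_term.
have := biweight_iter_f k (biweight_iter_e k (weight_biweight h)).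
by rewrite addrK subrK.
Qed.

Lemma sl_term_diff k phi : sl_term k (diff A phi) = diff A (sl_term k phi).
Proof.
have e j x : iter j sl_e (diff A x) = diff A (iter j sl_e x).
  by elim: j => [|j IH]; [exact: erefl | exact: etrans (congr1 sl_e IH) (sl_e_diff _)].
have f j x : iter j sl_f (diff A x) = diff A (iter j sl_f x).
  by elim: j => [|j IH]; [exact: erefl | exact: etrans (congr1 sl_f IH) (sl_f_diff _)].
exact: etrans (congr1 (iter k sl_f) (e k phi)) (f k _).
Qed.

Lemma projector2 : projector A proj2.
Proof.
split.
- by move=> p; apply: sl_proj_linear.
- move=> p phi h; split; first exact: weight_sl_proj.
  move=> u v uv; have [-> ->] : u = o0 /\ v = o1.
    by move: uv; case: (ord2P u) (ord2P v) => -> [] ->.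
  by rewrite -sl_eE; exact: (sl_e_proj h).
- move=> p phi [h1 h2]; rewrite /proj2 /sl_proj big_ord_recl /= scale1r big1 ?addr0 //.
  by move=> k _; rewrite sl_termS0 ?scaler0 // sl_eE; apply: h2.
(* [proj2 p.+1] has one term more than [proj2 p]; after [diff] only p bosons are left and it dies by
   nilpotency. *)
- move=> p phi h; rewrite /proj2 /sl_proj [RHS]linear_sum /= addnS [RHS]big_ord_recr /=.
  have top : iter (t + p).+1 sl_e (diff A phi) = 0.
    exact: sl_e_nilpotent (weight_diff A h) _.
  have -> : diff A (proj_coef (t + p).+1 *: sl_term (t + p).+1 phi) = 0.
    rewrite linearZ /= -sl_term_diff /sl_term top [X in _ *: X]iter_sl_f0.
    exact: scaler0.
  rewrite addr0; apply: eq_bigr => k _; rewrite sl_term_diff; exact/esym/linearZ.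
- by move=> p; apply: sl_proj_stable.
- move=> phi h; rewrite /proj2 /sl_proj linear_sum big_ord_recl /= scale1r big1 ?addr0 //.
  move=> k _; rewrite linearZ /= /sl_term iterS sl_fE [eps A _]eps_gl // eps_biweight ?linear0 ?scaler0 //.
  have := biweight_iter_f k (biweight_iter_e k.+1 (weight_biweight h)).
  by rewrite -natr1 opprD !addrA addrAC addrK [X in biweight _ _ X]addrAC subrK.
Qed.

Variables (X : 'M[R]_(s, t)) (w : R) (i0 : 'I_t).
Hypothesis AX : {in [set~ i0] &, forall i l, (A *m X) i l = (i == l)%:R * w}.
Hypothesis w_neq0 : w != 0.

Lemma lowerX_lower a b phi : lowerX A X a (lower b phi) = lower b (lowerX A X a phi).
Proof.
rewrite !lowerXE linear_sum; apply: eq_bigr => i _.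
by rewrite [RHS]linearZ /= lowerC.
Qed.

(* Only the bosons [(i0, u)] survive, so all fermions of one copy pile up there. *)
Lemma singular_vanish p phi : singular p phi -> (s < t + p)%N ->
  (forall i u, i != i0 -> lowerX A X (i, u) phi = 0) -> phi = 0.
Proof.
move=> [hw he] st hX.
pose L u := lower (i0, u) : fock -> fock.
have biL j x y psi : biweight j.+1 x y psi -> biweight j x (y + 1) (L o1 psi).
  move=> [h1 h2 h3]; split.
  - by rewrite bosons_lower h1 linearZ /= -natr1 scalerDl scale1r addrK.
  - by rewrite gl_lower h2 /= scale0r addr0 linearZ.
  - by rewrite gl_lower h3 /= scale1r scalerDl scale1r linearZ.
have biter q psi y : biweight q t%:R y psi ->
    biweight 0 t%:R (y + q%:R) (iter q (L o1) psi).
  elim: q psi y => [|q IH] psi y h; first by rewrite addr0.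
  by rewrite iterSr -nat1r addrA; apply/IH/biL.
(* Each [L o1] raises the weight of the copy [o1] by one: the result has no boson and would need
   [t + p > s] fermions in that copy. *)
have top : iter p (L o1) phi = 0.
  have [h1 _ h3] := biter _ _ _ (weight_biweight hw).
  apply/coefP=> S m; rewrite coef0; apply/eqP.
  apply: contraLR st => c0; rewrite -leqNgt.
  have := congr1 (fun f => coef f S m) h1; rewrite coef_bosons coefZ.
  move/(mulIf c0)/(natR_inj nat_unit)/eqP; rewrite mdeg_eq0 => /eqP m0.
  have := congr1 (fun f => coef f S m) h3; rewrite coef_gl coefZ => /(mulIf c0).
  rewrite m0 [boson_degree o1 0](_ : _ = 0)%N; last first.
    by rewrite /boson_degree big1 // => i _; rewrite mnm0E.
  rewrite subr0 -natrD => /(natR_inj nat_unit) <-.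
  rewrite /fermi_degree (@leq_trans (\sum_(j < s) 1)) ?leq_sum //.
    by move=> j _; case: (_ \in _).
  by rewrite sum_nat_const card_ord muln1.
have L0 a : iter a (L o0) 0 = 0.
  by elim: a => // a IH; rewrite iterS IH /L linear0.
have LZ a c x : iter a (L o0) (c *: x) = c *: iter a (L o0) x.
  by elim: a => // a IH; rewrite !iterS IH /L linearZ.
have LC b x : iter b (L o1) (L o0 x) = L o0 (iter b (L o1) x).
  by elim: b => // b IH; rewrite !iterS IH /L lowerC.
have gl0 a x : gl o0 o1 (iter a (L o0) x) = iter a (L o0) (gl o0 o1 x).
  elim: a => // a IH; rewrite !iterS -IH /L gl_lower.
  by rewrite scale0r addr0.
have gl1 b : gl o0 o1 (iter b (L o1) phi) = b%:R *: L o0 (iter b.-1 (L o1) phi).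
  elim: b => [|b IH]; first by rewrite scale0r; apply: he.
  rewrite iterS /L gl_lower -/(L o1 _) -/(L o0 _) IH eqxx scale1r.
  have -> : L o1 (b%:R *: L o0 (iter b.-1 (L o1) phi)) = b%:R *: L o0 (iter b (L o1) phi).
    rewrite /L linearZ /=; case: b {IH} => [|b]; first by rewrite !scale0r.
    by rewrite lowerC.
  by rewrite -natr1 scalerDl scale1r.
(* Since [phi] is singular, [gl o0 o1] trades one [L o1] for one [L o0] up to an invertible integer,
   so every mixed derivative of order p is 0. *)
have all0 a b : (a + b = p)%N -> iter a (L o0) (iter b (L o1) phi) = 0.
  elim: a b => [|a IH] b ab; first by rewrite -top -ab.
  have := congr1 (gl o0 o1) (IH b.+1 _).
  rewrite addnS -ab gl0 gl1 LZ linear0 => /(_ erefl) /(nat_regular nat_unit).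
  by rewrite iterSr.
(* [L u phi] need not be singular, but it inherits the vanishing of mixed derivatives, so the
   induction runs on that. *)
move: hw.1 all0 hX => {hw he st biL biter top gl1}.
elim: p phi => [|p IH] phi h hall hX; first exact: (hall 0%N 0%N).
have Lz u : L u phi = 0.
  apply: IH.
  - by rewrite bosons_lower h linearZ /= -natr1 scalerDl scale1r addrK.
  - move=> a b ab; case: (ord2P u) => ->.
      by rewrite LC -iterSr; apply: hall; rewrite addSn ab.
    by rewrite -iterSr; apply: hall; rewrite addnS ab.
  - by move=> i v ii; rewrite lowerX_lower hX // linear0.
apply: (lower0_zero nat_unit h) => -[i u].
have [->|ii] := eqVneq i i0; first exact: Lz.
have := hX i u ii; rewrite lowerXE (bigD1 i) //= (bigD1 i0) /=; last by rewrite eq_sym.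
rewrite -/(L u phi) Lz scaler0 add0r big1 ?addr0 => [|j /andP[ji j0]].
  rewrite AX ?inE // eqxx mul1r; exact: scale_regular.
by rewrite AX ?inE // (negbTE ji) mul0r scale0r.
Qed.

End GlTwo.

(** * Ideals, grade and regular sequences *)

Section Ideals.
Variable R : comNzRingType.
Implicit Types (a b : R -> Prop) (x y u : R).

Record ideal a : Prop := Ideal {
  ideal0 : a 0;
  idealD : forall x y, a x -> a y -> a (x + y);
  idealM : forall r x, a x -> a (r * x) }.

Lemma idealN a x : ideal a -> a x -> a (- x).
Proof. by move=> ia ax; rewrite -mulN1r; apply: idealM. Qed.
Lemma idealB a x y : ideal a -> a x -> a y -> a (x - y).
Proof. by move=> ia ax ay; apply: idealD => //; apply: idealN. Qed.
Lemma ideal_sub a x y : ideal a -> a (x - y) -> a y -> a x.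
Proof. by move=> ia axy ay; rewrite -(subrK y x); apply: idealD. Qed.
Lemma ideal_subr a x y : ideal a -> a (x - y) -> a x -> a y.
Proof. by move=> ia axy ax; rewrite -(subKr x y); apply: idealB. Qed.
Lemma ideal_sum (I : Type) (s : seq I) (P : pred I) (F : I -> R) a :
  ideal a -> (forall i, P i -> a (F i)) -> a (\sum_(i <- s | P i) F i).
Proof. by move=> ia h; elim/big_ind: _ => //; [exact: ideal0 | exact: idealD]. Qed.

Definition zero_ideal x : Prop := x = 0.
Lemma ideal_zero : ideal zero_ideal.
Proof. by split=> [|x y -> ->|r x ->] //; rewrite /zero_ideal ?addr0 ?mulr0. Qed.

Definition adj a x : R -> Prop := fun u => exists r, a (u - r * x).

Lemma ideal_adj a x : ideal a -> ideal (adj a x).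
Proof.
move=> ia; split=> [|u v [r hr] [q hq]|c u [r hr]].
- by exists 0; rewrite mul0r subr0; apply: ideal0.
- by exists (r + q); rewrite mulrDl opprD addrACA; apply: idealD.
- by exists (c * r); rewrite -mulrA -mulrBr; apply: idealM.
Qed.

Lemma sub_adj a x u : a u -> adj a x u.
Proof. by move=> au; exists 0; rewrite mul0r subr0. Qed.
Lemma mem_adj a x r : ideal a -> adj a x (r * x).
Proof. by move=> ia; exists r; rewrite subrr; apply: ideal0. Qed.
Lemma mem_adj1 a x : ideal a -> adj a x x.
Proof. by move=> ia; rewrite -{2}[x]mul1r; apply: mem_adj. Qed.
Lemma adj_min a b x : ideal b -> (forall u, a u -> b u) -> b x -> forall u, adj a x u -> b u.
Proof. by move=> ib ab bx u [r /ab h]; apply: ideal_sub h _ => //; apply: idealM. Qed.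
Lemma pred_eq a b : (forall u, a u <-> b u) -> a = b.
Proof. by move=> h; apply/funext => u; apply/propext. Qed.

Lemma adjC a x y : adj (adj a x) y = adj (adj a y) x.
Proof.
by apply: pred_eq => u; split=> -[r [q h]]; exists q, r;
  rewrite addrAC.
Qed.

Lemma adj_congr a x y : ideal a -> a (x - y) -> adj a x = adj a y.
Proof.
move=> ia h; apply: pred_eq => u; split=> -[r hr]; exists r.
  have -> : u - r * y = (u - r * x) + r * (x - y) by ring.
  by apply: idealD => //; apply: idealM.
have -> : u - r * x = (u - r * y) - r * (x - y) by ring.
by apply: idealB => //; apply: idealM.
Qed.

Definition reg a x : Prop := forall u, a (x * u) -> a u.

Lemma reg_congr a x y : ideal a -> a (x - y) -> reg a x -> reg a y.
Proof.
move=> ia h rx u hu; apply: rx; apply: (ideal_sub (y := y * u)) => //.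
by rewrite -mulrBl mulrC; apply: idealM.
Qed.

Lemma reg_swap a x y : ideal a -> reg a x -> reg a y -> reg (adj a x) y -> reg (adj a y) x.
Proof.
move=> ia rx ry ryx u [r hr].
have [v hv] : adj a x r.
  apply: ryx; exists u; have -> : y * r - u * x = - (x * u - r * y) by ring.
  exact: idealN.
exists v; apply: rx; have -> : x * (u - v * y) = (x * u - r * y) + y * (r - v * x) by ring.
by apply: idealD => //; apply: idealM.
Qed.

(** A regular sequence of length k on R/a with terms in [P]. Properness is not demanded, so the unit
    ideal has every grade as soon as [P] is inhabited. *)
Fixpoint grade (k : nat) (P a : R -> Prop) : Prop :=
  if k is k'.+1 then exists x, [/\ P x, reg a x & grade k' P (adj a x)] else True.

Lemma grade_congr k (P Q a : R -> Prop) : ideal a ->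
  (forall x, P x -> exists2 y, Q y & a (x - y)) -> grade k P a -> grade k Q a.
Proof.
elim: k a => // k IH a ia PQ [x [Px rx gx]]; have [y Qy axy] := PQ x Px.
exists y; split=> //; first exact: reg_congr axy rx.
rewrite -(adj_congr ia axy); apply: IH gx => [|z /PQ[z' Qz' h]]; first exact: ideal_adj.
by exists z' => //; apply: sub_adj.
Qed.

Lemma grade_sub k (P Q a : R -> Prop) : ideal a ->
  (forall x, P x -> Q x) -> grade k P a -> grade k Q a.
Proof.
move=> ia PQ; apply: grade_congr => // x /PQ Qx; exists x => //.
by rewrite subrr; apply: ideal0.
Qed.

Lemma grade_le j k P a : (j <= k)%N -> grade k P a -> grade j P a.
Proof.
elim: k j a => [|k IH] [|j] a //= jk [x [Px rx gx]].
by exists x; split=> //; apply: IH gx.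
Qed.

Fixpoint span (ps : seq R) : R -> Prop :=
  if ps is p :: ps' then adj (span ps') p else zero_ideal.

Lemma ideal_span ps : ideal (span ps).
Proof. by elim: ps => [|p ps IH] /=; [exact: ideal_zero | exact: ideal_adj]. Qed.

Lemma mem_span ps p : p \in ps -> span ps p.
Proof.
elim: ps => // q ps IH; rewrite inE => /orP[/eqP->|/IH h] /=; last exact: sub_adj.
exact/mem_adj1/ideal_span.
Qed.

Lemma span_min ps b : ideal b -> (forall p, p \in ps -> b p) -> forall u, span ps u -> b u.
Proof.
move=> ib; elim: ps => [_ u -> | p ps IH h]; first exact: ideal0.
apply: adj_min => //; last by apply: h; rewrite inE eqxx.
by apply: IH => q qps; apply: h; rewrite inE qps orbT.
Qed.

Definition colon a u : R -> Prop := fun x => a (x * u).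
Lemma ideal_colon a u : ideal a -> ideal (colon a u).
Proof.
move=> ia; split=> [|x y|r x]; rewrite /colon ?mul0r; first exact: ideal0.
  by rewrite mulrDl; apply: idealD.
by rewrite -mulrA; apply: idealM.
Qed.

(** Equivalently, Hom(R/(ps), R/a) = 0. *)
Definition nosocle (ps : seq R) a : Prop :=
  forall u, (forall p, p \in ps -> a (p * u)) -> a u.

Lemma reg_nosocle ps a x : ideal a -> span ps x -> reg a x -> nosocle ps a.
Proof.
move=> ia sx rx u h; apply: rx.
exact: (span_min (ideal_colon u ia) (fun p hp => h p hp)).
Qed.

Definition noetherian : Prop := forall F : (R -> Prop) -> Prop,
  (exists2 a, ideal a & F a) -> exists a, [/\ ideal a, F a &
    forall b, ideal b -> F b -> (forall x, a x -> b x) -> forall x, b x -> a x].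

Hypothesis noeth : noetherian.
Hypothesis nat_unit : forall n, exists c : R, n.+1%:R * c = 1.

(** A point of the moment curve, [p_0 + n p_1 + n^2 p_2 + ...]. An ideal that does not contain all
    of [ps] contains fewer than [size ps] of these elements. *)
Fixpoint mixed (n : nat) (ps : seq R) : R :=
  if ps is p :: ps' then p + n%:R * mixed n ps' else 0.

Lemma span_mixed n ps : span ps (mixed n ps).
Proof.
elim: ps => [|p ps IH] //=; have i := ideal_adj p (ideal_span ps).
apply: idealD => //; first exact/mem_adj1/ideal_span.
by apply: idealM => //; apply: sub_adj.
Qed.

Lemma mixedE n ps : mixed n ps = \sum_(i < size ps) ps`_i * n%:R ^+ i.
Proof.
elim: ps => [|p ps IH] /=; first by rewrite big_ord0.
rewrite IH big_ord_recl mulr1 mulr_sumr; congr (_ + _); apply: eq_bigr => i _ /=.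
by rewrite exprS mulrCA.
Qed.

(* Vandermonde: enough of the combinations [mixed n ps] generate all of [ps]. *)
Lemma mixed_ideal b ps (s : seq nat) : ideal b -> uniq s -> size s = size ps ->
  (forall n, n \in s -> b (mixed n ps)) -> forall p, p \in ps -> b p.
Proof.
move=> ib us ss h p /(nthP 0)[i ip <-].
set q := size ps in ss ip; pose v : 'rV[R]_q := \row_j (nth 0%N s j)%:R.
pose V := Vandermonde q v; pose P : 'rV[R]_q := \row_j ps`_j.
have PV : forall j, b ((P *m V) 0 j).
  move=> j; rewrite mxE (eq_bigr (fun k : 'I_q => ps`_k * (nth 0%N s j)%:R ^+ k)).
    by rewrite -mixedE; apply: h; rewrite mem_nth // ss.
  by move=> k _; rewrite !mxE.
have [c hc] : exists c, \det V * c = 1.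
  rewrite det_Vandermonde; elim/big_ind: _ => [|x y [c hc] [d hd]|j _].
  - by exists 1; rewrite mulr1.
  - by exists (c * d); rewrite mulrACA hc hd mulr1.
  elim/big_ind: _ => [|x y [c hc] [d hd]|k jk].
  - by exists 1; rewrite mulr1.
  - by exists (c * d); rewrite mulrACA hc hd mulr1.
  rewrite !mxE; have ne : nth 0%N s k != nth 0%N s j.
    by rewrite nth_uniq ?ss // neq_ltn jk orbT.
  have [lt|lt|e] := ltngtP (nth 0%N s j) (nth 0%N s k); last by rewrite e eqxx in ne.
    case E : (nth 0%N s k - nth 0%N s j)%N => [|m]; first by move: lt; rewrite -subn_gt0 E.
    by have [d hd] := nat_unit m; exists d; rewrite -natrB ?(ltnW lt) // E.
  case E : (nth 0%N s j - nth 0%N s k)%N => [|m]; first by move: lt; rewrite -subn_gt0 E.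
  have [d hd] := nat_unit m; exists (- d).
  by rewrite mulrN -mulNr opprB -natrB ?(ltnW lt) // E.
have e : (P *m V *m \adj V) 0 (Ordinal ip) = ps`_i * \det V.
  by rewrite -mulmxA mul_mx_adj mul_mx_scalar !mxE mulrC.
rewrite -[ps`_i]mulr1 -hc mulrA -e mulrC; apply: idealM => //.
rewrite mxE; apply: ideal_sum => // j _; rewrite mulrC; exact: idealM.
Qed.

Section Avoidance.
Variables (ps : seq R) (a : R -> Prop).
Hypotheses (ia : ideal a) (na : nosocle ps a).

Let bad n := exists2 u, ~ a u & a (mixed n ps * u).
(** The annihilator of such a [u] modulo [a] is maximal among those containing [mixed n ps], hence
    an associated prime. *)
Let good n u := [/\ ~ a u, a (mixed n ps * u) & forall v, ~ a v -> a (mixed n ps * v) ->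
  (forall x, colon a u x -> colon a v x) -> forall x, colon a v x -> colon a u x].

Lemma bad_good n : bad n -> exists u, good n u.
Proof.
move=> [u nu hu]; pose F c := exists v, [/\ ~ a v, a (mixed n ps * v) & c = colon a v].
have [|c [ic [v [nv hv ->]] hmax]] := @noeth F.
  by exists (colon a u); [exact: ideal_colon | exists u].
exists v; split=> // v' nv' hv' sub x hx.
by apply: (hmax (colon a v')) hx => //; [exact: ideal_colon | exists v'].
Qed.

Lemma good_prime n u x y : good n u -> colon a u (x * y) -> ~ colon a u x -> colon a u y.
Proof.
move=> [nu hu hmax] hxy nx; apply: (hmax (x * u)) => //.
- by rewrite mulrCA; apply: idealM.
- by move=> z hz; rewrite /colon mulrCA; apply: idealM.
- by rewrite /colon mulrA [y * x]mulrC.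
Qed.

Lemma pigeonhole (L s : seq nat) (Q : nat -> nat -> bool) q :
  (forall m, m \in s -> exists2 n, n \in L & Q n m) ->
  (forall n s', n \in L -> subseq s' s -> all (Q n) s' -> (size s' <= q)%N) ->
  (size s <= size L * q)%N.
Proof.
elim: L s => [|n L IH] s hs hq.
  by case: s hs {hq} => // m s /(_ m); rewrite inE eqxx => /(_ isT)[].
rewrite -(count_predC (Q n)) mulSn leq_add //.
  rewrite -size_filter; apply: (hq n); rewrite ?inE ?eqxx ?filter_subseq //.
  exact: filter_all.
rewrite -size_filter; apply: IH => [m|k s' kL ss].
  rewrite mem_filter /= => /andP[nQ /hs[k]]; rewrite inE => /orP[/eqP->|kL Qk].
    by rewrite (negbTE nQ).
  by exists k.
by apply: hq; rewrite ?inE ?kL ?orbT // (subseq_trans ss) // filter_subseq.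
Qed.

(** A finiteness of associated primes. By noetherianity finitely many witnesses [u n] generate all
    of them modulo [a], every bad [mixed m ps] lies in the annihilator of one of these, and each
    such annihilator holds at most [size ps] of the mixed elements. *)
Lemma bad_bounded : exists B, forall s, uniq s -> (forall n, n \in s -> bad n) ->
  (size s <= B)%N.
Proof.
have [u hu] : exists u : nat -> R, forall n, bad n -> good n (u n).
  have h n : exists v, bad n -> good n v.
    have [/bad_good[v hv]|nb] := EM (bad n); first by exists v.
    by exists 0.
  by have [f hf] := choice h; exists f.
pose gen (L : seq nat) := foldr (fun n c => adj c (u n)) a L.
have igen L : ideal (gen L) by elim: L => //= n L; apply: ideal_adj.
pose F c := exists2 L, (forall n, n \in L -> bad n) & c = gen L.
have [|c [_ [L hL ->] hmax]] := @noeth F; first by exists a => //; exists [::].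
(* If the head annihilator is not contained in that of [u m], an [x] outside the latter kills the
   head generator, and primality keeps [x * z] outside as well. *)
have key m L' z : bad m -> (forall n, n \in L' -> bad n) -> gen L' (z * u m) ->
    ~ colon a (u m) z -> exists2 n, n \in L' & forall x, colon a (u n) x -> colon a (u m) x.
  move=> bm; elim: L' z => [//|n L' IH] z hb hz nz.
  have [sub|] := EM (forall x, colon a (u n) x -> colon a (u m) x).
    by exists n => //; rewrite inE eqxx.
  move/existsNP=> [x /not_implyP[hx nx]].
  have [|||k kL hk] := IH (x * z).
  - by move=> k kL; apply: hb; rewrite inE kL orbT.
  - case: hz => r hr; rewrite -/(gen L') in hr.
    have -> : x * z * u m = x * (z * u m - r * u n) + r * (x * u n) by ring.
    apply: idealD => //; first exact: idealM.
    apply: idealM => //; elim: (L') => //= ? ? ?; exact: sub_adj.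
  - by move=> h; apply: nz; exact: (good_prime (hu m bm) h nx).
  - by exists k; rewrite ?inE ?kL ?orbT.
exists (size L * size ps)%N => s us hs.
apply: (pigeonhole (Q := fun n m => `[< colon a (u n) (mixed m ps) >])) => [m ms|n s' nL ss hall].
  have bm := hs m ms; have [nu hum _] := hu m bm.
  have [||n nL sub] := key m L 1 bm hL.
  - apply: (hmax (gen (m :: L)) (igen (m :: L))).
    + by exists (m :: L) => // k; rewrite inE => /orP[/eqP->|/hL].
    + by move=> x; apply: sub_adj.
    + by rewrite mul1r; apply: mem_adj1.
  - by rewrite /colon mul1r.
  exists n => //; apply/asboolP; have [nn hn hmaxn] := hu n (hL n nL).
  by apply: (hmaxn (u m)) => //; apply: sub.
rewrite leqNgt; apply/negP => lt; have [nn _ _] := hu n (hL n nL); apply: nn.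
apply: na => p pp.
apply: (mixed_ideal (s := take (size ps) s') (ideal_colon (u n) ia)) pp.
- by apply: take_uniq; apply: subseq_uniq us.
- by rewrite size_takel // ltnW.
- by move=> k /mem_take kt; apply/asboolP; apply: (allP hall).
Qed.

End Avoidance.

(** Three ideals occur together: [a], [a + (x)], [a + (y)] in the exchange of regular elements
    below, and later [a], I + a, I^2 + a. *)
Lemma avoidance ps a b c : ideal a -> ideal b -> ideal c ->
  nosocle ps a -> nosocle ps b -> nosocle ps c ->
  exists n, [/\ reg a (mixed n ps), reg b (mixed n ps) & reg c (mixed n ps)].
Proof.
move=> ia ib ic na nb nc.
have [Ba ha] := bad_bounded ia na; have [Bb hb] := bad_bounded ib nb.
have [Bc hc] := bad_bounded ic nc.
pose bad d n := exists2 u, ~ d u & d (mixed n ps * u).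
pose bad_at d n := `[< bad d n >].
pose s := iota 0 (Ba + Bb + Bc).+1.
have [n ns nbad] : exists2 n, n \in s & ~~ [|| bad_at a n, bad_at b n | bad_at c n].
  apply/hasP; rewrite has_predC; apply/negP => /allP all_bad.
  have bound d B : (forall s, uniq s -> (forall n, n \in s -> bad d n) -> (size s <= B)%N) ->
      (count (bad_at d) s <= B)%N.
    move=> h; rewrite -size_filter; apply: h; first by rewrite filter_uniq ?iota_uniq.
    by move=> n; rewrite mem_filter => /andP[/asboolP].
  have : (size s <= Ba + Bb + Bc)%N.
    rewrite -(count_predT s) (@eq_in_count _ _ (predU (bad_at a) (predU (bad_at b) (bad_at c)))).
      rewrite -addnA (leq_trans _ (leq_add (bound _ _ ha) (leq_add (bound _ _ hb) (bound _ _ hc)))) //.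
      apply: leq_trans (leq_add (leqnn _) (_ : count (predU (bad_at b) (bad_at c)) s <= _)%N).
        by rewrite -[X in (_ <= X)%N]count_predUI leq_addr.
      by rewrite -[X in (_ <= X)%N]count_predUI leq_addr.
    by move=> n ns; rewrite /= all_bad.
  by rewrite size_iota ltnn.
case/norP: nbad => h1 /norP[h2 h3].
have nbadP d : ~~ bad_at d n -> reg d (mixed n ps).
  move=> hd u hu; apply: contrapT => nu; move/negP: hd; apply.
  by apply/asboolP; exists u.
by exists n; split; apply: nbadP.
Qed.

(** For [x] and [y] regular in (ps), the socles modulo [x] and modulo [y] both compute Ext^1(R/(ps),
    R/a); the proof writes out the comparison by elements. *)
Lemma nosocle_exchange ps a x y : ideal a -> span ps x -> reg a x -> reg a y ->
  nosocle ps (adj a x) -> nosocle ps (adj a y).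
Proof.
move=> ia px rx ry nx u hu.
have spu z : span ps z -> adj a y (z * u).
  by apply: (span_min (ideal_colon u (ideal_adj y ia))).
have [v hv] := spu x px.
have [q hq] : adj a x v.
  apply: nx => p /mem_span/spu[r hr]; exists r; apply: ry.
  have -> : y * (p * v - r * x) = x * (p * u - r * y) - p * (x * u - v * y) by ring.
  by apply: idealB => //; apply: idealM.
exists q; apply: rx.
have -> : x * (u - q * y) = (x * u - v * y) + y * (v - q * x) by ring.
by apply: idealD => //; apply: idealM.
Qed.

(** Rees's theorem: an element regular modulo [a], [a + (x)] and [a + (y)] serves as an intermediate
    step, and regular pairs may be swapped. *)
Lemma grade_exchange ps k a x y : ideal a -> span ps x -> span ps y ->
  reg a x -> reg a y -> grade k (span ps) (adj a x) -> grade k (span ps) (adj a y).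
Proof.
elim: k a x y => // k IH a x y ia px py rx ry [z [pz rz gz]].
have iax := ideal_adj x ia; have iay := ideal_adj y ia.
have nx := reg_nosocle iax pz rz.
have ny := nosocle_exchange ia px rx ry nx.
have na := reg_nosocle ia px rx.
have [n [ra rax ray]] := avoidance ia iax iay na nx ny.
set e := mixed n ps in ra rax ray; have pe : span ps e by apply: span_mixed.
exists e; split=> //; rewrite adjC; apply: (IH _ x) => //.
- exact: ideal_adj.
- exact: reg_swap.
- exact: reg_swap.
by rewrite adjC; apply: (IH _ z).
Qed.

Lemma grade_adj ps k a x : ideal a -> span ps x -> reg a x ->
  grade k.+1 (span ps) a -> grade k (span ps) (adj a x).
Proof. by move=> ia px rx [y [py ry]]; apply: grade_exchange. Qed.

Lemma grade_nosocle ps k a : ideal a -> grade k.+1 (span ps) a -> nosocle ps a.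
Proof. by move=> ia [y [py ry _]]; apply: reg_nosocle py ry. Qed.

End Ideals.

(** * Depth sensitivity of complexes *)

Section Complex.
Variables (R : comNzRingType) (V : lmodType R) (K : Type) (co : K -> V -> R).
Hypothesis co_lin : forall k c u v, co k (c *: u + v) = c * co k u + co k v.
Implicit Types (a : R -> Prop) (u v : V).

(** Membership in [a V]; it takes the place of being 0 in V/aV. *)
Definition coords_in a v : Prop := forall k, a (co k v).

Lemma coD k u v : co k (u + v) = co k u + co k v.
Proof. by have := co_lin k 1 u v; rewrite scale1r mul1r. Qed.
Lemma co0 k : co k 0 = 0.
Proof. by apply: (addrI (co k 0)); rewrite -coD !addr0. Qed.
Lemma coZ k c u : co k (c *: u) = c * co k u.
Proof. by rewrite -[c *: u]addr0 co_lin co0 addr0. Qed.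

Lemma coords_lin a c u v :
  ideal a -> coords_in a u -> coords_in a v -> coords_in a (c *: u + v).
Proof. by move=> ia hu hv k; rewrite co_lin; apply: idealD => //; apply: idealM. Qed.
Lemma coordsD a u v : ideal a -> coords_in a u -> coords_in a v -> coords_in a (u + v).
Proof. by move=> ia hu hv; have := coords_lin 1 ia hu hv; rewrite scale1r. Qed.
Lemma coords0 a : ideal a -> coords_in a 0.
Proof. by move=> ia k; rewrite co0; apply: ideal0. Qed.
Lemma coordsZ a c u : ideal a -> coords_in a u -> coords_in a (c *: u).
Proof. by move=> ia hu k; rewrite coZ; apply: idealM. Qed.
Lemma coordsZl a c u : ideal a -> a c -> coords_in a (c *: u).
Proof. by move=> ia hc k; rewrite coZ mulrC; apply: idealM. Qed.
Lemma coords_reg a x u : reg a x -> coords_in a (x *: u) -> coords_in a u.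
Proof. by move=> rx h k; apply: rx; rewrite -coZ. Qed.
Lemma coords_sub a b u : (forall x, a x -> b x) -> coords_in a u -> coords_in b u.
Proof. by move=> ab h k; apply: ab. Qed.

Variables (d : nat -> V -> V) (C : nat -> V -> Prop).
Hypothesis d_lin : forall i, linear (d i).
Hypothesis d_coords : forall a i u, ideal a -> coords_in a u -> coords_in a (d i u).
Hypothesis C_lin : forall i c u v, C i u -> C i v -> C i (c *: u + v).
Hypothesis C_0 : forall i, C i 0.
Hypothesis d_C : forall i u, C i.+1 u -> C i (d i.+1 u).
Hypothesis d_d : forall i u, C i.+2 u -> d i.+1 (d i.+2 u) = 0.
(** The trace of a direct summand property: it makes reduction of the submodule [C i] modulo [a]
    behave as for a free module. *)
Hypothesis C_split : forall a x i u, ideal a -> C i u -> coords_in (adj a x) u ->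
  exists2 v, C i v & coords_in a (u - x *: v).

Lemma d0 i : d i 0 = 0.
Proof.
by have := d_lin i (-1) 0 0; rewrite scaler0 addr0 scaleN1r addNr.
Qed.
Lemma dZ i c u : d i (c *: u) = c *: d i u.
Proof. by have := d_lin i c u 0; rewrite d0 !addr0. Qed.
Lemma dD i u v : d i (u + v) = d i u + d i v.
Proof. by have := d_lin i 1 u v; rewrite !scale1r. Qed.
Lemma dB i u v : d i (u - v) = d i u - d i v.
Proof. by rewrite dD -scaleN1r dZ scaleN1r. Qed.
Lemma C_Z i c u : C i u -> C i (c *: u).
Proof. by move=> h; rewrite -[_ *: _]addr0; apply: C_lin. Qed.
Lemma C_B i u v : C i u -> C i v -> C i (u - v).
Proof. by move=> hu hv; rewrite addrC -scaleN1r; apply: C_lin. Qed.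

(* Everything is tested up to powers of [w], i.e. after inverting [w]. *)
Variable w : R.

Definition bounds a i u : Prop :=
  exists N, exists2 v, C i.+1 v & coords_in a (w ^+ N *: u - d i.+1 v).
Definition exact_at a i : Prop :=
  forall u, C i u -> coords_in a (d i u) -> bounds a i u.

Lemma bounds_lin a i c u v : ideal a ->
  bounds a i u -> bounds a i v -> bounds a i (c *: u + v).
Proof.
move=> ia [N [x hx hu]] [M [y hy hv]]; exists (N + M)%N.
exists ((c * w ^+ M) *: x + w ^+ N *: y); first by apply: C_lin => //; apply: C_Z.
have -> : w ^+ (N + M) *: (c *: u + v) - d i.+1 ((c * w ^+ M) *: x + w ^+ N *: y) =
   (c * w ^+ M) *: (w ^+ N *: u - d i.+1 x) + w ^+ N *: (w ^+ M *: v - d i.+1 y).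
  rewrite d_lin dZ !scalerBr scalerDr !scalerA opprD addrACA exprD.
  by congr (_ *: _ - _ + _); ring.
by apply: coords_lin => //; apply: coordsZ.
Qed.

Lemma bounds0 a i : ideal a -> bounds a i 0.
Proof.
by move=> ia; exists 0%N, 0 => //; rewrite scaler0 d0 subr0; apply: coords0.
Qed.
Lemma boundsZ a i c u : ideal a -> bounds a i u -> bounds a i (c *: u).
Proof. by move=> ia h; rewrite -[_ *: _]addr0; apply/bounds_lin/bounds0. Qed.
Lemma bounds_w a i N u : bounds a i (w ^+ N *: u) -> bounds a i u.
Proof. by move=> [M [v hv h]]; exists (M + N)%N, v => //; rewrite exprD -scalerA. Qed.

Variable ps : seq R.

Definition socle_at a i : Prop :=
  forall u, C i u -> (forall p, p \in ps -> bounds a i (p *: u)) -> bounds a i u.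

Lemma bounds_span a i u x : ideal a -> (forall p, p \in ps -> bounds a i (p *: u)) ->
  span ps x -> bounds a i (x *: u).
Proof.
move=> ia h; apply: (span_min (b := fun x => bounds a i (x *: u))) => //; split.
- by rewrite scale0r; apply: bounds0.
- by move=> y z hy hz; rewrite scalerDl -[y *: u]scale1r; apply: bounds_lin.
- by move=> r y hy; rewrite -scalerA; apply: boundsZ.
Qed.

(** The connecting step for multiplication by [x]: a cycle modulo [x] has [d u = x y] modulo [a],
    and regularity of [x] on the i-th cokernel makes [y] a boundary, which corrects [u] to a
    cycle. *)
Lemma exact_adj0 a x i : ideal a ->
  (forall y, C i y -> bounds a i (x *: y) -> bounds a i y) ->
  exact_at a i.+1 -> exact_at (adj a x) i.+1.
Proof.
move=> ia rx e2 u Cu hu.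
have [y Cy hy] := C_split ia (d_C Cu) hu.
have [|N [z Cz hz]] := rx y Cy.
  exists 0%N, u => //; rewrite scale1r -opprB -scaleN1r.
  exact: coordsZ.
have hu' : coords_in a (d i.+1 (w ^+ N *: u - x *: z)).
  rewrite dB !dZ.
  have -> : w ^+ N *: d i.+1 u - x *: d i.+1 z =
     w ^+ N *: (d i.+1 u - x *: y) + x *: (w ^+ N *: y - d i.+1 z).
    by rewrite !scalerBr !scalerA [x * _]mulrC addrA subrK.
  by apply: coords_lin => //; apply: coordsZ.
have Cu' : C i.+1 (w ^+ N *: u - x *: z) by apply: C_B; apply: C_Z.
have [M [v Cv hv]] := e2 _ Cu' hu'; exists (M + N)%N, v => //.
have -> : w ^+ (M + N) *: u - d i.+2 v =
    (x * w ^+ M) *: z + (w ^+ M *: (w ^+ N *: u - x *: z) - d i.+2 v).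
  rewrite scalerBr !scalerA exprD [w ^+ M * x]mulrC [RHS]addrA.
  by rewrite [_ *: z + _]addrC subrK.
apply: coordsD; first exact: ideal_adj.
  by rewrite -scalerA; apply: coordsZl; [exact: ideal_adj | exact: mem_adj1].
by apply: coords_sub hv => r; apply: sub_adj.
Qed.

(** By exactness at [i.+1] the cokernel there embeds into the term of degree i modulo [a], where [x]
    is regular. *)
Lemma exact_adj a x i : ideal a -> reg a x -> exact_at a i.+1 -> exact_at a i.+2 ->
  exact_at (adj a x) i.+2.
Proof.
move=> ia rx e1; apply: exact_adj0 => // y Cy [N [v Cv h]].
apply: (bounds_w (N := N)); apply: e1; first exact: C_Z.
apply: (coords_reg rx).
have -> : x *: d i.+1 (w ^+ N *: y) = d i.+1 (w ^+ N *: (x *: y) - d i.+2 v).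
  by rewrite dB d_d // subr0 !dZ !scalerA mulrC.
exact: d_coords.
Qed.

Variable l : nat.
Hypothesis base : forall a, ideal a -> grade 1 (span ps) a -> socle_at a l.

(** Dimension shifting: writing [x u = d v] up to [w] turns a socle element [u] of the i-th cokernel
    into a socle element [v] of the next one modulo [x], at the price of one unit of grade. If [v]
    is a boundary modulo [x], dividing by [x] shows that [u] bounds. *)
Lemma socle_chain k i a : (i + k = l)%N -> ideal a -> grade k.+1 (span ps) a ->
  (forall j, (i < j <= l)%N -> exact_at a j) -> socle_at a i.
Proof.
elim: k i a => [|k IH] i a ik ia g ex; first by rewrite -[i]addn0 ik; apply: base.
have [x [px rx gx]] := g; move=> u Cu hu.
have [N [v Cv hv]] := bounds_span ia hu px.
have iax := ideal_adj x ia.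
have : bounds (adj a x) i.+1 v.
  apply: (IH i.+1 (adj a x)) => //; first by rewrite addSnnS.
    move=> [|[|j]] // /andP[ij jl]; apply: exact_adj => //; apply: ex.
      by apply/andP; split; [exact: ij | exact: ltnW].
    by apply/andP; split; [exact: ltnW | exact: jl].
  move=> p /hu[M [y Cy hy]].
  have [|||L [z Cz hz]] := ex i.+1 _ (w ^+ M *: (p *: v) - (w ^+ N * x) *: y).
  - by rewrite ltnSn -ik addnS ltnS leq_addr.
  - by apply: C_B; apply: C_Z => //; apply: C_Z.
  - rewrite dB !dZ.
    have -> : w ^+ M *: (p *: d i.+1 v) - (w ^+ N * x) *: d i.+1 y =
       (- (w ^+ M * p)) *: (w ^+ N *: (x *: u) - d i.+1 v) +
       (w ^+ N * x) *: (w ^+ M *: (p *: u) - d i.+1 y).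
      rewrite scaleNr -scalerN opprB !scalerBr !scalerA addrA.
      rewrite (_ : w ^+ M * p * (w ^+ N * x) = w ^+ N * x * (w ^+ M * p)); last by ring.
      by rewrite subrK.
    by apply: coords_lin => //; apply: coordsZ.
  exists (L + M)%N, z => //.
  have -> : w ^+ (L + M) *: (p *: v) - d i.+2 z =
    (x * (w ^+ L * w ^+ N)) *: y +
    (w ^+ L *: (w ^+ M *: (p *: v) - (w ^+ N * x) *: y) - d i.+2 z).
    rewrite scalerBr !scalerA exprD addrA.
    rewrite (_ : w ^+ L * (w ^+ N * x) = x * (w ^+ L * w ^+ N)); last by ring.
    by rewrite [_ *: y + _]addrC subrK !mulrA.
  apply: coordsD => //.
    by rewrite -scalerA; apply: coordsZl => //; apply: mem_adj1.
  by apply: coords_sub hz => r; apply: sub_adj.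
move=> [L [z Cz hz]].
have Cvz : C i.+1 (w ^+ L *: v - d i.+2 z) by apply: C_B; [exact: C_Z | exact: d_C].
have [y Cy hy] := C_split ia Cvz hz.
exists (L + N)%N, y => //; apply: (coords_reg rx).
have -> : x *: (w ^+ (L + N) *: u - d i.+1 y) =
   w ^+ L *: (w ^+ N *: (x *: u) - d i.+1 v) + d i.+1 (w ^+ L *: v - d i.+2 z - x *: y).
  rewrite !dB !dZ d_d // subr0 scalerBr [in RHS]scalerBr addrA subrK !scalerA exprD.
  by congr (_ *: _ - _); ring.
by apply: coords_lin => //; exact: d_coords.
Qed.

Lemma torsion_bounds a i u (f : R -> nat) : ideal a -> socle_at a i -> C i u ->
  (forall p, p \in ps -> bounds a i (p ^+ f p *: u)) -> bounds a i u.
Proof.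
move=> ia so; have [n] := ubnP (\sum_(p <- ps) f p)%N; elim: n f u => // n IH f u fn Cu h.
have [/hasP[p pps /eqP fp0]|/hasPn fpos] := boolP (has (fun p => f p == 0%N) ps).
  by have := h p pps; rewrite fp0 scale1r.
apply: so => // p pps.
pose f' q := if q == p then (f p).-1 else f q.
have fp : (0 < f p)%N by rewrite lt0n fpos.
apply: (IH f') => [||q qps]; last 1 first.
- rewrite /f'; have [->|_] := eqVneq q p.
    by rewrite scalerA -exprSr prednK //; apply: h.
  by rewrite scalerA mulrC -scalerA; apply: boundsZ => //; apply: h.
- rewrite -ltnS; apply: leq_trans fn; rewrite ltnS.
  rewrite (big_rem p) //= [X in (_ <= X)%N](big_rem p) //= /f' eqxx -addSn.
  rewrite prednK // leq_add2l; apply: leq_sum => q _.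
  by case: eqP => // ->; apply: leq_pred.
- exact: C_Z.
Qed.

(** The acyclicity lemma of Peskine and Szpiro, by descending induction on the degree: homology
    killed by powers of [ps] is 0 because the cokernel has no socle. *)
Lemma acyclicity a : ideal a -> grade l (span ps) a ->
  (forall i u, (0 < i <= l)%N -> C i u -> coords_in a (d i u) ->
     forall p, p \in ps -> exists N, bounds a i (p ^+ N *: u)) ->
  forall i, (0 < i <= l)%N -> exact_at a i.
Proof.
move=> ia g tors.
suff h k i : (i + k = l)%N -> (0 < i)%N -> exact_at a i.
  by move=> i /andP[i0 il]; apply: (h (l - i)%N); rewrite ?subnKC.
have [n] := ubnP k; elim: n k i => // n IH k i kn ik i0 u Cu hu.
have so : socle_at a i.
  apply: (@socle_chain k) => //.
    by apply: grade_le g; rewrite -ik -[k.+1]add1n leq_add2r.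
  move=> j /andP[ij jl]; apply: (IH (l - j)%N).
  - by lia.
  - by rewrite subnKC.
  - exact: leq_trans ij.
have [f hf] : exists f : R -> nat, forall p, p \in ps -> bounds a i (p ^+ f p *: u).
  have h p : exists N, p \in ps -> bounds a i (p ^+ N *: u).
    have [pps|] := boolP (p \in ps); last by exists 0%N.
    by have [|N hN] := tors i u _ Cu hu p pps; [rewrite i0 -ik leq_addr | exists N].
  by have [f hf] := choice h; exists f.
exact: torsion_bounds hf.
Qed.

End Complex.

(** * Resolutions of R/I and R/I^2 by singular vectors *)

Section FockComplex.
Variables (R : idomainType) (t s r : nat).
Local Notation T := ('I_s * 'I_r)%type.
Local Notation B := ('I_t * 'I_r)%type.
Local Notation fock := (fock R t s r).
Implicit Types (phi psi : fock) (a : R -> Prop).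
Hypothesis nat_unit : forall n, n.+1%:R \is a @GRing.unit R.
Variable A : 'M[R]_(t, s).
Variable pr : nat -> fock -> fock.
Hypothesis prP : projector A pr.

Definition cof (k : {set T} * 'X_{1..#|{: B}|}) phi : R := coef phi k.1 k.2.

Definition basis (S : {set T}) (m : 'X_{1..#|{: B}|}) : fock :=
  [ffun S' : {set T} => if S' == S then 'X_[m] else 0].

Definition vac : fock := basis (@finset.set0 _) 0%MM.

Lemma coef_basis S m S' m' : coef (basis S m) S' m' = ((S' == S) && (m == m'))%:R.
Proof.
by rewrite /coef ffunE; case: eqP => _ /=; rewrite ?mcoeffX ?mcoeff0.
Qed.

Lemma fock_sum phi : phi = \sum_S \sum_(m <- msupp (phi S)) coef phi S m *: basis S m.
Proof.
apply/coefP=> S m; rewrite coef_sum (bigD1 S) //= [X in _ + X]big1 ?addr0 => [|S' SS'].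
  rewrite coef_sum {1}/coef [in LHS](mpolyE (phi S)) raddf_sum /=.
  by apply: eq_bigr => m' _; rewrite mcoeffZ mcoeffX coefZ coef_basis eqxx.
rewrite coef_sum big1 // => m' _.
by rewrite coefZ coef_basis eq_sym (negbTE SS') mulr0.
Qed.

Lemma cof_lin k c phi psi : cof k (c *: phi + psi) = c * cof k phi + cof k psi.
Proof. by rewrite /cof coefD coefZ. Qed.

Lemma linear_coords (L : fock -> fock) a phi : linear L -> ideal a ->
  coords_in cof a phi -> coords_in cof a (L phi).
Proof.
move=> hL ia h; rewrite (fock_sum phi).
have L0 : L 0 = 0 by have := hL (-1) 0 0; rewrite scaler0 addr0 scaleN1r addNr.
have LD x y : L (x + y) = L x + L y by have := hL 1 x y; rewrite !scale1r.
have LZ c x : L (c *: x) = c *: L x by have := hL c x 0; rewrite L0 !addr0.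
have main P : (forall x y, P x -> P y -> P (x + y)) -> P 0 ->
   (forall S m, P (coef phi S m *: basis S m)) ->
   P (\sum_S \sum_(m <- msupp (phi S)) coef phi S m *: basis S m).
  by move=> PD P0 Pb; elim/big_ind: _ => // S _; elim/big_ind: _.
apply: (main (fun x => coords_in cof a (L x))) => [x y hx hy||S m].
- by rewrite LD; apply: (coordsD cof_lin).
- by rewrite L0; apply: (coords0 cof_lin).
- by rewrite LZ; apply: (coordsZl cof_lin) => //; apply: (h (S, m)).
Qed.

(** Degree 0 is the vacuum line, a copy of R; all other degrees are one more than the number of
    bosons. *)
Definition cpx (i : nat) phi : Prop :=
  if i is p.+1 then singular p phi
  else forall k, k != (@finset.set0 _, 0%MM) -> cof k phi = 0.

Definition dcpx (i : nat) : fock -> fock :=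
  match i with 0 => fun _ => 0 | 1 => eps A | _ => diff A end.

Lemma dcpx_lin i : linear (dcpx i).
Proof.
move: i => [|[|i]] c f g /=; first by rewrite scaler0 addr0.
  exact: linearP.
exact: linearP.
Qed.

Lemma dcpx_coords a i phi : ideal a -> coords_in cof a phi -> coords_in cof a (dcpx i phi).
Proof. exact: linear_coords (dcpx_lin i). Qed.

Lemma cpx_lin i c phi psi : cpx i phi -> cpx i psi -> cpx i (c *: phi + psi).
Proof.
case: i => [|p]; last exact: singular_lin.
by move=> h1 h2 k hk; rewrite cof_lin h1 // h2 // mulr0 addr0.
Qed.

Lemma cpx_0 i : cpx i 0.
Proof. by case: i => [|p] /=; [move=> k _; apply: coef0 | exact: singular0]. Qed.

Lemma dcpx_C i phi : cpx i.+1 phi -> cpx i (dcpx i.+1 phi).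
Proof.
case: i => [|p] /=; last exact: singular_diff.
by move=> [h _] [S m] hk; apply: eps_vacuum.
Qed.

Lemma dcpx_d i phi : cpx i.+2 phi -> dcpx i.+1 (dcpx i.+2 phi) = 0.
Proof.
by case: i => [|p] /= _; [exact: eps_diff | exact: diff_sq].
Qed.

Lemma coef_sum_supp phi (q : {set T} -> 'X_{1..#|{: B}|} -> R) S m :
  coef (\sum_S \sum_(m <- msupp (phi S)) q S m *: basis S m) S m =
  (coef phi S m != 0)%:R * q S m.
Proof.
rewrite coef_sum (bigD1 S) //= [X in _ + X]big1 ?addr0 => [|S' SS']; last first.
  rewrite coef_sum big1 // => m' _.
  by rewrite coefZ coef_basis eq_sym (negbTE SS') mulr0.
have -> : (coef phi S m != 0) = (m \in msupp (phi S)) by rewrite mcoeff_msupp.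
rewrite coef_sum.
have [hm|hm] := boolP (m \in msupp (phi S)).
  rewrite (bigD1_seq m) ?msupp_uniq //= coefZ coef_basis !eqxx mulr1 mul1r.
  rewrite big1 ?addr0 // => m' mm'.
  by rewrite coefZ coef_basis eqxx (negbTE mm') mulr0.
rewrite mul0r big_seq big1 // => m' hm'; rewrite coefZ coef_basis eqxx /=.
by case: eqP hm' => [->|]; rewrite ?(negbTE hm) ?mulr0.
Qed.

(** Dividing coordinate by coordinate on the support of [phi] preserves the weight but not
    singularity; [pr] restores it and fixes [phi]. *)
Lemma cpx_split a x i phi : ideal a -> cpx i phi -> coords_in cof (adj a x) phi ->
  exists2 psi, cpx i psi & coords_in cof a (phi - x *: psi).
Proof.
move=> ia hC h.
have [q hq] := @choice _ _ (fun k r => a (cof k phi - r * x)) h.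
pose psi := \sum_S \sum_(m <- msupp (phi S)) q (S, m) *: basis S m.
have psiE k : cof k psi = (cof k phi != 0)%:R * q k.
  by case: k => S m; rewrite /cof /psi /= (coef_sum_supp phi (fun S m => q (S, m))).
have hpsi : coords_in cof a (phi - x *: psi).
  move=> k; rewrite -scaleNr addrC cof_lin psiE.
  have [->|_] := eqVneq (cof k phi) 0; first by rewrite mul0r mulr0 addr0; apply: ideal0.
  by rewrite mul1r mulNr addrC mulrC; apply: hq.
case: i hC => [|p] hC.
  by exists psi => // k hk; rewrite psiE hC // eqxx mul0r.
have wpsi : weight p psi.
  apply/(weightP nat_unit) => S m.
  have := psiE (S, m); rewrite /cof /= => -> c0.
  have {c0} : coef phi S m != 0 by apply: contraNneq c0 => ->; rewrite eqxx mul0r.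
  by have [/(weightP nat_unit) hw _] := hC; apply: hw.
exists (pr p psi); first exact: (proj_singular prP).
have hl := proj_linear prP p.
have -> : phi - x *: pr p psi = pr p (phi - x *: psi).
  by rewrite -!scaleNr [LHS]addrC [phi + _]addrC hl (proj_id prP hC).
exact: linear_coords.
Qed.

Local Notation exact_at := (exact_at cof dcpx cpx).
Local Notation bounds := (bounds cof dcpx cpx).
Local Notation socle_at := (socle_at cof dcpx cpx).

(** Nothing bounds in the last degree, so the cokernel is the last term itself, where a regular
    element has no torsion. *)
Lemma socle_top w ps l a : (forall phi, cpx l.+1 phi -> phi = 0) -> w = 1 -> ideal a ->
  grade 1 (span ps) a -> socle_at w ps a l.
Proof.
move=> h0 w1 ia [x [px rx _]] u Cu hu; rewrite w1 in hu *.
exists 0%N, 0; first exact: cpx_0.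
rewrite expr0 scale1r (d0 dcpx_lin) subr0.
apply: (coords_reg cof_lin rx).
apply: (span_min (b := fun x => coords_in cof a (x *: u))) px.
  split; first by rewrite scale0r; apply: (coords0 cof_lin).
    by move=> y z hy hz; rewrite scalerDl; apply: (coordsD cof_lin).
  by move=> c y hy; rewrite -scalerA; apply: (coordsZ cof_lin).
move=> p /hu[N [v /h0 ->]].
by rewrite (d0 dcpx_lin) subr0 expr1n scale1r.
Qed.

Lemma cpx_acyclicity w ps l :
  (forall a, ideal a -> grade 1 (span ps) a -> socle_at w ps a l) ->
  grade l (span ps) (@zero_ideal R) ->
  (forall i u, (0 < i <= l)%N -> cpx i u -> dcpx i u = 0 ->
     forall p, p \in ps -> exists N, bounds w (@zero_ideal R) i (p ^+ N *: u)) ->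
  forall i, (0 < i <= l)%N -> exact_at w (@zero_ideal R) i.
Proof.
move=> base g tors; apply: (acyclicity cof_lin dcpx_lin dcpx_coords cpx_lin cpx_0 dcpx_C
  dcpx_d cpx_split base) => //; first exact: ideal_zero.
move=> i u il Cu hu; apply: tors => //.
by apply/coefP=> S m; rewrite coef0; apply: (hu (S, m)).
Qed.

End FockComplex.

(** * Minors *)

Lemma enum_lift n (k : 'I_n.+1) :
  [seq lift k j | j <- enum 'I_n] = take k (enum 'I_n.+1) ++ drop k.+1 (enum 'I_n.+1).
Proof.
apply: (inj_map val_inj); rewrite map_cat map_take map_drop val_enum_ord -map_comp.
rewrite (@eq_map _ _ _ (bump k \o val)) // map_comp val_enum_ord.
have kn : (k <= n)%N by rewrite -ltnS.
rewrite take_iota drop_iota add0n subSS (minn_idPl (ltnW (ltn_ord k))).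
rewrite (_ : iota 0 n.+1.-1 = iota 0 k ++ iota k (n - k)); last first.
  by rewrite -[in RHS](add0n k) -iotaD add0n subnKC.
rewrite map_cat; congr (_ ++ _).
  rewrite -[RHS]map_id; apply/eq_in_map => i; rewrite mem_iota /= add0n /bump => ik.
  by rewrite leqNgt ik.
rewrite -[in RHS](add1n k) iotaDl; apply/eq_in_map => i; rewrite mem_iota /bump.
by case/andP=> ->.
Qed.

(** Arbitrary index functions keep the lists of minors finite enumerations; repetitions only add
    zeros ([minor_inj]). [minor_power A r] generates the r-th power of the ideal of maximal
    minors. *)
Definition minor (R : comNzRingType) t s (A : 'M[R]_(t, s)) k
    (f : {ffun 'I_k -> 'I_t} * {ffun 'I_k -> 'I_s}) : R := \det (mxsub f.1 f.2 A).
Definition minor_list (R : comNzRingType) t s (A : 'M[R]_(t, s)) k : seq R :=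
  [seq minor A f | f : {ffun 'I_k -> 'I_t} * {ffun 'I_k -> 'I_s}].
Definition minor_power (R : comNzRingType) t s (A : 'M[R]_(t, s)) r : seq R :=
  [seq \prod_(u < r) minor A (f u) |
     f : {ffun 'I_r -> {ffun 'I_t -> 'I_t} * {ffun 'I_t -> 'I_s}}].

Lemma minor_inj (R : comNzRingType) t s (A : 'M[R]_(t, s)) k f :
  @minor R t s A k f != 0 -> injective f.1 /\ injective f.2.
Proof.
move=> nz; split=> i j fij; apply/eqP; apply: contraNT nz => ij; apply/eqP.
  by apply: (determinant_alternate ij) => l; rewrite !mxE fij.
by rewrite /minor -det_tr; apply: (determinant_alternate ij) => l; rewrite !mxE fij.
Qed.

(** The witness is the adjugate of the chosen submatrix, put back at its rows and columns and
    extended by 0. *)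
Lemma minor_inverse (R : comNzRingType) t s (A : 'M[R]_(t, s)) k
    (f : {ffun 'I_k -> 'I_t} * {ffun 'I_k -> 'I_s}) : injective f.1 ->
  exists X : 'M[R]_(s, t), {in [set f.1 a | a in 'I_k] &,
    forall i l, (A *m X) i l = (i == l)%:R * minor A f}.
Proof.
move=> f_inj; pose M := mxsub f.1 f.2 A.
pose X : 'M[R]_(s, t) :=
  \matrix_(j, l) \sum_b \sum_a ((j == f.2 b)%:R * ((l == f.1 a)%:R * (\adj M) b a)).
exists X => _ _ /imsetP[i _ ->] /imsetP[l _ ->].
have e : (M *m \adj M) i l = (i == l)%:R * minor A f.
  by rewrite mul_mx_adj mxE; case: eqP; rewrite /= ?mulr1n ?mulr0n ?mul1r ?mul0r.
rewrite (inj_eq f_inj) -e !mxE.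
under eq_bigr => j _ do rewrite mxE mulr_sumr.
rewrite exchange_big; apply: eq_bigr => b _ /=.
rewrite (bigD1 (f.2 b)) //= [X in _ + X]big1 ?addr0 => [|j jb].
  rewrite eqxx (bigD1 l) //= [X in _ + X]big1 ?addr0 => [|a al]; first by rewrite eqxx !mul1r !mxE.
  by rewrite (inj_eq f_inj) eq_sym (negbTE al) mul0r mulr0.
by rewrite big1 ?mulr0 // => a _; rewrite (negbTE jb) mul0r.
Qed.

Section Wick.
Variables (R : idomainType) (t s r : nat).
Local Notation T := ('I_s * 'I_r)%type.
Local Notation B := ('I_t * 'I_r)%type.
Local Notation fock := (fock R t s r).
Implicit Types (phi psi : fock).
Hypothesis nat_unit : forall n, n.+1%:R \is a @GRing.unit R.
Variable A : 'M[R]_(t, s).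
Local Notation annihA := (@annihA R t s r A).
Local Notation fann := (@fannih R t s r).

Lemma fannZ x c phi : fann x (c *: phi) = c *: fann x phi.
Proof. exact: (@linearZ R fock fock *:%R). Qed.
Lemma fann0 x : fann x 0 = 0.
Proof. by rewrite -[0 in LHS](scale0r 0) fannZ scale0r. Qed.
Lemma annihAZ a c phi : annihA a (c *: phi) = c *: annihA a phi.
Proof. exact: (@linearZ R fock fock *:%R). Qed.
Lemma annihA0 a : annihA a 0 = 0.
Proof. by rewrite -[0 in LHS](scale0r 0) annihAZ scale0r. Qed.

Lemma fannih_foldr (x : T) (l : seq B) phi :
  fann x (foldr annihA phi l) = (-1) ^+ size l *: foldr annihA (fann x phi) l.
Proof.
elim: l => [|a l IH] /=; first by rewrite scale1r.
by rewrite fannih_annihA IH annihAZ exprS mulN1r scaleNr.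
Qed.

Lemma foldr_fannih_move x l1 l2 phi : foldr fann phi (l1 ++ x :: l2) =
  (-1) ^+ size l1 *: fann x (foldr fann phi (l1 ++ l2)).
Proof.
elim: l1 => [|y l1 IH] /=; first by rewrite scale1r.
by rewrite IH fannZ fannihC exprS mulN1r scalerN scaleNr.
Qed.

Lemma foldr_annihA0 l : foldr annihA 0 l = 0.
Proof. by elim: l => //= x l ->; rewrite annihA0. Qed.

Lemma foldr_annihA_scale l c phi : foldr annihA (c *: phi) l = c *: foldr annihA phi l.
Proof. by elim: l => //= x l ->; rewrite annihAZ. Qed.

(* Laplace expansion: both sides are expanded along the first row [f ord0]. *)
Lemma wick n (u : 'I_r) (f : 'I_n -> 'I_t) (e : 'I_n -> 'I_s) phi : injective e ->
  (forall j, j \notin codom e -> fann (j, u) phi = 0) ->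
  foldr annihA phi [seq (f i, u) | i <- enum 'I_n] =
  \det (mxsub f e A) *: foldr fann phi [seq (e i, u) | i <- enum 'I_n].
Proof.
elim: n f e phi => [|n IH] f e phi e_inj kill.
  by rewrite (size0nil (size_enum_ord 0)) /= det_mx00 scale1r.
rewrite [in LHS](enum_ordSl n) map_cons -map_comp [LHS]/=.
set l := [seq _ | i <- _]; have sl : size l = n by rewrite size_map size_enum_ord.
rewrite annihAE /=; transitivity (\sum_k A (f ord0) (e k) *: fann (e k, u) (foldr annihA phi l)).
  rewrite (bigID (mem (codom e))) /= [X in _ + X]big1 ?addr0 => [|j jN]; last first.
    by rewrite fannih_foldr kill // foldr_annihA0 !scaler0.
  rewrite (eq_bigl (mem [set e k | k in 'I_n.+1])) => [|j]; last first.
    by apply/codomP/imsetP => [[k ->]|[k _ ->]]; exists k.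
  by rewrite big_imset //= => i k _ _ /e_inj.
rewrite (expand_det_row _ ord0) scaler_suml; apply: eq_bigr => k _.
rewrite [mxsub f e A ord0 k]mxE -scalerA; congr (_ *: _).
rewrite fannih_foldr sl (IH (f \o lift ord0) (e \o lift k)) //; last first.
- move=> j; have [jk _|jk jN] := eqVneq j (e k).
    by rewrite jk; apply: (skew0 nat_unit); rewrite -fannihC.
  rewrite fannihC kill ?fann0 ?oppr0 //; apply: contra jN => /codomP[i ji].
  by case: (unliftP k i) ji => [i' ->|->] ji; [rewrite ji; apply/codomP; exists i' |
    rewrite ji eqxx in jk].
- by move=> i j /e_inj; apply: lift_inj.
rewrite [X in _ *: foldr _ _ X](_ : _ = [seq (e i, u) | i <- [seq lift k j | j <- enum 'I_n]]);
  last by rewrite -map_comp.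
have split_l : enum 'I_n.+1 = take k (enum 'I_n.+1) ++ k :: drop k.+1 (enum 'I_n.+1).
  by rewrite -{2}(nth_ord_enum k k) -drop_nth ?size_enum_ord // cat_take_drop.
have move2 l' : foldr fann (fann (e k, u) phi) l' = (-1) ^+ size l' *: fann (e k, u) (foldr fann phi l').
  elim: l' => [|y l' IHl] /=; first by rewrite scale1r.
  by rewrite IHl fannZ fannihC exprS mulN1r scalerN scaleNr.
have sl2 : size [seq (e i, u) | i <- [seq lift k j | j <- enum 'I_n]] = n.
  by rewrite 2!size_map size_enum_ord.
rewrite move2 sl2.
have -> : foldr fann phi [seq (e i, u) | i <- enum 'I_n.+1] =
   (-1) ^+ k *: fann (e k, u) (foldr fann phi [seq (e i, u) | i <- [seq lift k j | j <- enum 'I_n]]).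
  rewrite split_l map_cat /= foldr_fannih_move enum_lift map_cat size_map.
  by rewrite size_takel // size_enum_ord ltnW.
rewrite !scalerA /cofactor add0n; congr (_ *: _).
have sq m : (-1) ^+ m * (-1) ^+ m = 1 :> R by rewrite -expr2 sqrr_sign.
rewrite -mulrA mulrCA sq mulr1 mulrAC sq mul1r.
by congr (\det _); apply/matrixP=> i j; rewrite !mxE.
Qed.

Lemma foldr_annihA_rem (a : B) (l : seq B) phi : a \in l ->
  exists b : bool, foldr annihA phi l = (-1) ^+ b *: foldr annihA phi (a :: rem a l).
Proof.
elim: l => //= x l IH; rewrite inE; have [<- _|ax /= /IH[b ->]] := eqVneq x a.
  by exists false; rewrite scale1r.
exists (~~ b) => /=.
by rewrite annihAZ annihAC scalerN signrN scaleNr.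
Qed.

Lemma foldr_annihA_perm (l l' : seq B) phi : perm_eq l l' ->
  exists b : bool, foldr annihA phi l = (-1) ^+ b *: foldr annihA phi l'.
Proof.
elim: l' l => [|a l' IH] l pl.
  by rewrite (perm_nilP pl); exists false; rewrite scale1r.
have al : a \in l by rewrite (perm_mem pl) mem_head.
have [b ->] := foldr_annihA_rem phi al; have [|b' /= ->] := IH (rem a l).
  rewrite -(perm_cons a); apply: perm_trans pl; rewrite perm_sym; exact: perm_to_rem.
by exists (b (+) b'); rewrite annihAZ scalerA signr_addb.
Qed.

Local Notation basis := (@basis R t s r).

Lemma fannih_basis (x : T) S m : fann x (basis S m) =
  (x \in S)%:R *: ((-1) ^+ below x (S :\ x) *: basis (S :\ x) m).
Proof.
apply/coefP=> S' m'; rewrite !coefZ coef_basis /coef ffunE.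
have [xS'|xS'] := boolP (x \in S').
  rewrite mcoeff0; case: eqP => [e|]; last by rewrite /= !mulr0.
  by rewrite e setD11 in xS'.
rewrite ffunE mcoeffZ; have [xS|xS] := boolP (x \in S); last first.
  case: eqP => [e|_]; first by rewrite -e setU11 in xS.
  by rewrite mcoeff0 mulr0 mul0r.
rewrite mul1r; have [->|ne] := eqVneq S' (S :\ x).
  by rewrite setD1K // eqxx mcoeffX.
case: eqP => [e|_]; last by rewrite mcoeff0 !mulr0.
by rewrite -e setU1K ?eqxx in ne.
Qed.

Lemma foldr_fannih_basis (l : seq T) S m : exists c : R,
  foldr fann (basis S m) l = c *: basis [set x in S | x \notin l] m /\
  (uniq l -> {subset l <= S} -> exists b : bool, c = (-1) ^+ b).
Proof.
elim: l => [|x l [c [IH sgn]]] /=.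
  exists 1; split=> [|_ _]; last by exists false.
  by rewrite scale1r; congr basis; apply/setP=> y; rewrite inE andbT.
rewrite IH fannZ fannih_basis; set S1 := [set y in S | y \notin l].
have -> : S1 :\ x = [set y in S | y \notin x :: l].
  by apply/setP=> y; rewrite !inE negb_or andbCA.
eexists; split; first by rewrite !scalerA; reflexivity.
move=> /andP[xl ul] sl; rewrite !inE xl sl ?mem_head //= mul1r.
have [//|y yl|b ->] := sgn; first by apply: sl; rewrite inE yl orbT.
by eexists; rewrite -signr_addb; reflexivity.
Qed.

Lemma vac_basis (l : seq T) (S : {set T}) : uniq l -> S =i l ->
  exists b : bool, foldr fann (basis S 0%MM) l = (-1) ^+ b *: @vac R t s r.
Proof.
move=> ul Sl; have [c [-> h]] := foldr_fannih_basis l S 0%MM.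
have [|b ->] := h ul; first by move=> x; rewrite Sl.
exists b; congr (_ *: basis _ _); apply/setP=> x; rewrite !inE Sl.
by case: (x \in l).
Qed.

(* The copies [u] are expanded one after the other. *)
Lemma wick_copies (us : seq 'I_r) (f : 'I_r -> 'I_t -> 'I_t) (e : 'I_r -> 'I_t -> 'I_s) phi :
  (forall u, injective (e u)) ->
  (forall u j, j \notin codom (e u) -> fann (j, u) phi = 0) ->
  foldr annihA phi (flatten [seq [seq (f u i, u) | i <- enum 'I_t] | u <- us]) =
  (\prod_(u <- us) \det (mxsub (f u) (e u) A)) *:
    foldr fann phi (flatten [seq [seq (e u i, u) | i <- enum 'I_t] | u <- us]).
Proof.
move=> e_inj kill; elim: us => [|u us IH] /=; first by rewrite big_nil scale1r.
rewrite foldr_cat IH foldr_annihA_scale big_cons mulrC -scalerA; congr (_ *: _).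
rewrite [in RHS]foldr_cat; apply: wick => // j jN.
elim: (flatten _) => [|x l IHl] /=; first exact: kill.
by rewrite fannihC IHl fann0 oppr0.
Qed.

Lemma eps_basis (f : 'I_r -> 'I_t -> 'I_t) (e : 'I_r -> 'I_t -> 'I_s) (S : {set T}) :
  (forall u, injective (f u)) -> (forall u, injective (e u)) ->
  (forall j u, ((j, u) \in S) = (j \in codom (e u))) ->
  exists b : bool, eps A (basis S 0%MM) =
    ((-1) ^+ b * \prod_u \det (mxsub (f u) (e u) A)) *: @vac R t s r.
Proof.
move=> f_inj e_inj Se; pose us := index_enum 'I_r.
pose lf := flatten [seq [seq (f u i, u) | i <- enum 'I_t] | u <- us].
pose le := flatten [seq [seq (e u i, u) | i <- enum 'I_t] | u <- us].
have uf n m (g : 'I_r -> 'I_n -> 'I_m) : (forall u, injective (g u)) ->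
    uniq (flatten [seq [seq (g u i, u) | i <- enum 'I_n] | u <- us]).
  move=> g_inj; apply: allpairs_uniq_dep => //; first exact: index_enum_uniq.
    by move=> u _; exact: enum_uniq.
  by move=> [u i] [v j] _ _ /= [+ uv]; move: i j; rewrite uv => i j /g_inj ->.
have pf : perm_eq (enum {: B}) lf.
  apply: uniq_perm (enum_uniq _) (uf _ _ _ f_inj) _ => -[i u]; rewrite mem_enum inE.
  apply/esym/flatten_mapP; exists u; first exact: mem_index_enum.
  have /codomP[k ->] : i \in codom (f u) by rewrite (inj_card_onto (f_inj u)).
  by apply: map_f; rewrite mem_enum.
have [b eb] := foldr_annihA_perm (basis S 0%MM) pf.
have [|b' eb'] := @vac_basis le S (uf _ _ _ e_inj).
  move=> [j u]; rewrite Se; apply/codomP/flatten_mapP => [[k ->]|[v _ /mapP[k _ [-> ->]]]].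
    by exists u; [exact: mem_index_enum | apply: map_f; rewrite mem_enum].
  by exists k.
exists (b (+) b'); rewrite /eps eb (wick_copies us f e_inj) => [|u j jN].
  by rewrite -/le eb' !scalerA signr_addb; congr (_ *: _); ring.
by rewrite fannih_basis Se (negbTE jN) scale0r.
Qed.

End Wick.

Section Image.
Variables (R : idomainType) (t s r : nat).
Local Notation T := ('I_s * 'I_r)%type.
Local Notation fock := (fock R t s r).
Implicit Types (phi psi : fock).
Hypothesis nat_unit : forall n, n.+1%:R \is a @GRing.unit R.
Variable A : 'M[R]_(t, s).
Variable pr : nat -> fock -> fock.
Hypothesis prP : projector A pr.
Local Notation zero := (@zero_ideal R).
Local Notation vac := (vac R t s r).
Local Notation bounds := (bounds (@cof R t s r) (@dcpx R t s r A) (@cpx R t s r)).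
Local Notation exact_at := (exact_at (@cof R t s r) (@dcpx R t s r A) (@cpx R t s r)).
Local Notation socle_at := (socle_at (@cof R t s r) (@dcpx R t s r A) (@cpx R t s r)).

Lemma coef_vac_line phi : cpx 0 phi -> phi = coef phi finset.set0 0%MM *: vac.
Proof.
move=> h; apply/coefP=> S m; rewrite coefZ coef_basis.
have [e|ne] := eqVneq (S, m) (finset.set0, 0%MM).
  by case: e => -> ->; rewrite !eqxx mulr1.
have -> : coef phi S m = 0 by exact: (h (S, m) ne).
case: (S =P finset.set0) ne => [->|_ _]; rewrite /= ?mulr0 //.
by case: (0%MM =P m) => [<-|]; rewrite ?eqxx ?mulr0.
Qed.

(** A basis state of weight 0 has exactly t fermions in each copy, so its image is up to sign a
    product of r maximal minors. *)
Lemma span_eps phi : singular 0 phi ->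
  span (minor_power A r) (coef (eps A phi) finset.set0 0%MM).
Proof.
move=> [/(weightP nat_unit) hw _]; have iI := ideal_span (minor_power A r).
rewrite (fock_sum phi) linear_sum /= coef_sum; apply: ideal_sum => // S _.
rewrite linear_sum /= coef_sum; apply: ideal_sum => // m _.
rewrite [eps A _]linearZ /= coefZ.
have [->|/hw[/eqP]] := eqVneq (coef phi S m) 0; first by rewrite mul0r; apply: ideal0.
rewrite mdeg_eq0 => /eqP-> fd; apply: idealM => //.
have /choice[e he] : forall u, exists e : {ffun 'I_t -> 'I_s}, injective e /\
    forall j, ((j, u) \in S) = (j \in codom e).
  move=> u; pose Su := [set j | (j, u) \in S].
  have cS : t = #|Su|.
    have := fd u; rewrite /boson_degree big1 ?addn0 => [<-|i _]; last by rewrite mnm0E.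
    rewrite /fermi_degree -sum1_card [RHS]big_mkcond; apply: eq_bigr => j _.
    by rewrite inE; case: (_ \in _).
  exists [ffun k => enum_val (cast_ord cS k)]; split=> [k l|j].
    by rewrite !ffunE => /enum_val_inj/cast_ord_inj.
  apply/idP/codomP => [jS|[k ->]]; last first.
    by rewrite ffunE; have := enum_valP (cast_ord cS k); rewrite inE.
  have jSu : j \in Su by rewrite inE.
  exists (cast_ord (esym cS) (enum_rank_in jSu j)).
  by rewrite ffunE cast_ordKV enum_rankK_in.
have [b ->] := @eps_basis R t s r nat_unit A (fun _ => id) e S
  (fun u i j => id) (fun u => (he u).1) (fun j u => (he u).2 j).
rewrite coefZ coef_basis !eqxx mulr1; apply: idealM => //; apply: mem_span.
apply/mapP; exists [ffun u => ([ffun i => i], e u)]; first by rewrite mem_enum.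
apply: eq_bigr => u _; rewrite ffunE /minor /=; congr (\det _).
by apply/matrixP=> i j; rewrite !mxE ffunE.
Qed.

(** The state with the chosen columns occupied need not be singular; [pr] makes it so without
    changing its image under [eps]. *)
Lemma eps_onto y : span (minor_power A r) y ->
  exists2 phi, singular 0 phi & eps A phi = y *: vac.
Proof.
apply: (span_min (b := fun y => exists2 phi, singular 0 phi & eps A phi = y *: vac)).
  split=> [|x z [f hf ef] [g hg eg]|c x [f hf ef]].
  - by exists 0; rewrite ?scale0r ?linear0 //; apply: singular0.
  - exists (1 *: f + g); first exact: singular_lin.
    by rewrite linearP /= ef eg scale1r scalerDl.
  - exists (c *: f + 0); first exact/singular_lin/singular0.
    by rewrite addr0 linearZ /= ef scalerA.
move=> _ /mapP[f _ ->].
have [->|nz] := eqVneq (\prod_(u < r) minor A (f u)) 0.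
  by exists 0; rewrite ?scale0r ?linear0 //; apply: singular0.
have f_inj u : injective (f u).1 /\ injective (f u).2.
  by apply: (@minor_inj R t s A); move/prodf_neq0: nz; apply.
pose S : {set T} := [set x | x.1 \in codom (f x.2).2].
have [|b eb] := @eps_basis R t s r nat_unit A (fun u => (f u).1) (fun u => (f u).2) S
  (fun u => (f_inj u).1) (fun u => (f_inj u).2); first by move=> j u; rewrite inE.
have wS : weight 0 (@basis R t s r S 0%MM).
  apply/(weightP nat_unit) => S' m; rewrite coef_basis.
  case: (S' =P S) => [->|]; last by rewrite eqxx.
  case: (0%MM =P m) => [<- _|]; last by rewrite andbF eqxx.
  split=> [|u]; first exact: mdeg0.
  rewrite /boson_degree big1 ?addn0 => [|i _]; last by rewrite mnm0E.
  rewrite /fermi_degree -[RHS](card_ord t) -(card_codom (f_inj u).2) -sum1_card [RHS]big_mkcond.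
  by apply: eq_bigr => j _; rewrite inE; case: (_ \in _).
exists ((-1) ^+ b *: pr 0 (basis R S 0%MM) + 0).
  by apply: singular_lin; [exact: (proj_singular prP) | exact: singular0].
rewrite addr0 linearZ /= (proj_eps prP) // eb scalerA mulrA -expr2 sqrr_sign mul1r.
by [].
Qed.

(** This identifies the cokernel in degree 0 with R/(I^r + a). *)
Lemma bounds_vac a y : ideal a -> bounds 1 a 0 (y *: vac) <->
  exists2 v, span (minor_power A r) v & a (y - v).
Proof.
move=> ia; split=> [[N [f hf h]]|[v hv hyv]].
  exists (coef (eps A f) finset.set0 0%MM); first exact: span_eps.
  have := h (finset.set0, 0%MM); rewrite /cof expr1n scale1r coefB coefZ coef_basis !eqxx.
  by rewrite mulr1.
have [f hf ef] := eps_onto hv; exists 0%N, f => //.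
rewrite expr1n scale1r [dcpx _ _ _]ef -scalerBl => -[S m].
by rewrite /cof coefZ mulrC; apply: idealM.
Qed.

Lemma bounds_zero w i u v : cpx i.+1 v -> u = dcpx A i.+1 v -> bounds w zero i u.
Proof.
move=> hv ->; exists 0%N, v => //; rewrite scale1r subrr => -[S m].
exact: coef0.
Qed.

Lemma minor_torsion w i u p : (0 < i)%N -> cpx i u -> dcpx A i u = 0 ->
  p \in minor_list A t -> exists N, bounds w zero i (p ^+ N *: u).
Proof.
move=> i0 Cu du /mapP[f _ ->]; have [->|nz] := eqVneq (minor A f) 0.
  exists 1%N; apply: (@bounds_zero _ _ _ 0); first exact: cpx_0.
  by rewrite expr1 scale0r (d0 (@dcpx_lin R t s r A)).
have [X AX] := minor_inverse A (minor_inj nz).1.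
have full : [set f.1 a | a in 'I_t]%SET = finset.setT.
  by apply/eqP; rewrite eqEcard subsetT cardsT (card_imset _ (minor_inj nz).1) !card_ord /=.
case: i i0 Cu du => [|[|p']] //= _ Cu du.
  have [N [psi hpsi e]] := exact_full0 nat_unit AX prP full Cu du.
  by exists N; exact: bounds_zero hpsi e.
have [N [psi hpsi e]] := exact_full nat_unit AX nz prP full Cu du.
by exists N; exact: bounds_zero hpsi e.
Qed.

Lemma minor_acyclic l : (r * s < r * t + l)%N -> forall ps,
  grade l (span ps) zero ->
  (forall i u, (0 < i <= l)%N -> cpx i u -> dcpx A i u = 0 ->
     forall p, p \in ps -> exists N, bounds 1 zero i (p ^+ N *: u)) ->
  forall i, (0 < i <= l)%N -> exact_at 1 zero i.
Proof.
move=> top ps g tors; apply: (cpx_acyclicity nat_unit prP (ps := ps)) => //.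
move=> a ia ga; apply: socle_top => // phi [hw _]; exact: weight_top nat_unit _ _ hw top.
Qed.

(* Depth sensitivity at the end of the resolution: [grade l.+1] kills the socle of R/I^r. *)
Lemma power_socle l a ps : (r * s < r * t + l)%N -> ideal a ->
  grade l.+1 (span ps) a ->
  (forall i, (0 < i <= l)%N -> exact_at 1 a i) ->
  forall y, (forall p, p \in ps -> exists2 v, span (minor_power A r) v & a (p * y - v)) ->
  exists2 v, span (minor_power A r) v & a (y - v).
Proof.
move=> top ia g ex y hy; apply/bounds_vac => //.
have base b : ideal b -> grade 1 (span ps) b -> socle_at 1 ps b l.
  move=> ib gb; apply: socle_top => // phi [hw _]; exact: weight_top nat_unit _ _ hw top.
have sa := (socle_chain (@cof_lin R t s r) (@dcpx_lin R t s r A)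
  (@dcpx_coords R t s r A) (@cpx_lin R t s r) (@cpx_0 R t s r) (@dcpx_C R t s r nat_unit A)
  (@dcpx_d R t s r nat_unit A) (@cpx_split R t s r nat_unit A pr prP) base (add0n l) ia g ex).
apply: sa => [k kn|p /hy h]; last by rewrite scalerA; apply/bounds_vac.
rewrite /cof coefZ coef_basis; case: (k.1 =P finset.set0) kn => [e|_ _]; rewrite /= ?mulr0 //.
case: (0%MM =P k.2) => [e'|]; rewrite ?mulr0 //.
by rewrite [k]surjective_pairing e -e' eqxx.
Qed.

End Image.

(** * Exactness *)

Section Linear.
Variables (R : comNzRingType) (U V : lmodType R) (L : U -> V).
Hypothesis hL : linear L.
Lemma lin0 : L 0 = 0.
Proof. by have := hL (-1) 0 0; rewrite scaler0 addr0 scaleN1r addNr. Qed.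
Lemma linZ c x : L (c *: x) = c *: L x.
Proof. by have := hL c x 0; rewrite lin0 !addr0. Qed.
Lemma linB x y : L (x - y) = L x - L y.
Proof. by rewrite addrC -scaleN1r hL scaleN1r addrC. Qed.
End Linear.

(** * Two copies, with a (t-1)-minor inverted *)

Section CorankOne.
Variables (R : idomainType) (t s c : nat).
Local Notation fock := (fock R t s 2).
Implicit Types (phi psi : fock).
Hypothesis nat_unit : forall n, n.+1%:R \is a @GRing.unit R.
(** The codimension is [c.+2] here, so the resolution of R/I^2 has length [2 * c + 3]. *)
Hypotheses (sE : s.+1 = (t + c.+2)%N) (t_gt0 : (0 < t)%N).
Variable A : 'M[R]_(t, s).
Local Notation zero := (@zero_ideal R).
Local Notation pr := (@proj2 R t s).
Local Notation prP := (projector2 nat_unit A).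
Local Notation cof := (@cof R t s 2).
Local Notation cof_lin := (@cof_lin R t s 2).
Local Notation dcpx := (@dcpx R t s 2 A).
Local Notation dcpx_lin := (@dcpx_lin R t s 2 A).
Local Notation cpx := (@cpx R t s 2).
Local Notation bounds := (bounds cof dcpx cpx).
Local Notation exact_at := (exact_at cof dcpx cpx).
Local Notation socle_at := (socle_at cof dcpx cpx).

Lemma coords_torsion (a : R -> Prop) ps (w : R) (x : fock) : ideal a ->
  grade 1 (span ps) a ->
  (forall p, p \in ps -> exists N, coords_in cof a (w ^+ N *: (p *: x))) ->
  exists N, coords_in cof a (w ^+ N *: x).
Proof.
move=> ia [z [sz rz _]] h.
have [N hN] : exists N, forall p, p \in ps -> coords_in cof a (p *: (w ^+ N *: x)).
  elim: ps h {sz} => [|p ps IH] h; first by exists 0%N.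
  have [|N hN] := IH; first by move=> q qps; apply: h; rewrite inE qps orbT.
  have [M hM] := h p (mem_head _ _); exists (M + N)%N => q; rewrite inE => /orP[/eqP->|qps].
    have -> : p *: (w ^+ (M + N) *: x) = w ^+ N *: (w ^+ M *: (p *: x)).
      by rewrite !scalerA exprD; congr (_ *: _); ring.
    exact: (coordsZ cof_lin) ia hM.
  have -> : q *: (w ^+ (M + N) *: x) = w ^+ M *: (q *: (w ^+ N *: x)).
    by rewrite !scalerA exprD; congr (_ *: _); ring.
  by apply: (coordsZ cof_lin) (ia) (hN _ qps).
exists N; apply: (coords_reg cof_lin rz).
apply: (span_min (b := fun z => coords_in cof a (z *: (w ^+ N *: x)))) sz => //.
split=> [|y q hy hq|r y hy]; rewrite ?scale0r; first exact: (coords0 cof_lin).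
  by rewrite scalerDl; apply: (coordsD cof_lin).
by rewrite -[(r * y) *: _]scalerA; apply: (coordsZ cof_lin).
Qed.

Section Localized.
Variables (X : 'M[R]_(s, t)) (w : R) (i0 : 'I_t).
Hypothesis AX : {in [set~ i0] &, forall i l, (A *m X) i l = (i == l)%:R * w}.
Hypothesis w_neq0 : w != 0.
Local Notation red_map := (red_map A X w [set~ i0]%SET pr).
Local Notation red_homot := (red_homot A X w [set~ i0]%SET pr).

Lemma red_map_vanish n p phi : (c.+1 < p < n)%N -> weight p phi -> red_map n p phi = 0.
Proof.
move=> /andP[cp pn] wp; apply: (singular_vanish nat_unit AX w_neq0 (p := p)).
- exact: (red_map_singular X w _ prP n wp).
- by rewrite -ltnS sE; lia.
- by move=> i u ii0; apply: (lowerX_red nat_unit AX w_neq0 prP) => //; rewrite !inE.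
Qed.

(** The base of [socle_chain] at a place where the complex does not end: [red_map] is 0 one degree
    higher and so kills boundaries. If all [p *: u] bound, then [red_map u] and [diff u] are in [a]
    up to powers of [w], and the homotopy makes [u] bound. *)
Lemma corank_socle ps a : ideal a -> grade 1 (span ps) a -> socle_at w ps a c.+2.
Proof.
move=> ia ga u Cu hu; pose n := c.+4.
have h1 p : p \in ps ->
    exists2 N, coords_in cof a (w ^+ N *: (p *: red_map n c.+1 u)) &
               coords_in cof a (w ^+ N *: (p *: diff A u)).
  move=> /hu[N [v Cv hv]]; have [wv _] : singular c.+2 v by exact: Cv.
  exists N.
    have := linear_coords (red_map_linear X w [set~ i0]%SET prP n c.+1) ia hv.
    rewrite (linB (red_map_linear _ _ _ prP _ _)) (red_map_diff nat_unit X w _ prP n wv).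
    have -> : red_map n c.+2 v = 0 by apply: red_map_vanish => //; rewrite /n; lia.
    rewrite [diff A 0](lin0 (dcpx_lin c.+3)) subr0.
    by rewrite !(linZ (red_map_linear _ _ _ prP _ _)).
  have := dcpx_coords A c.+2 ia hv; rewrite [dcpx _ _](linB (dcpx_lin c.+2)) [dcpx _ (dcpx _ v)]diff_sq // subr0.
  by rewrite !(linZ (dcpx_lin c.+2)).
have [N hN] : exists N, coords_in cof a (w ^+ N *: red_map n c.+1 u).
  by apply: (coords_torsion ia ga) => p /h1[N hN _]; exists N.
have [M hM] : exists N, coords_in cof a (w ^+ N *: diff A u).
  by apply: (coords_torsion ia ga) => p /h1[K _ hK]; exists K.
have Cu' : singular c.+1 u by exact: Cu.
have [e eu [K eK]] := @red_constE R t 2 nat_unit w [set~ i0]%SET n.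
have hr : @red_const R t 2 w [set~ i0]%SET n *: u = _ :=
  red_homotP nat_unit X w [set~ i0]%SET prP n Cu'.
have bE : bounds w a c.+2 (w ^+ (N + M) *: (@red_const R t 2 w [set~ i0]%SET n *: u)).
  exists 0%N, (w ^+ (N + M) *: red_homot n c.+1 u).
    apply: (C_Z (@cpx_lin R t s 2) (@cpx_0 R t s 2)).
    have [wu _] := Cu'; exact: (red_homot_singular X w _ prP n wu).
  rewrite scale1r [dcpx _ _](linZ (dcpx_lin c.+3)) -scalerBr hr [dcpx _ _]/= [diff A _ + _]addrC addrA addrK.
  rewrite scalerDr; apply: (coordsD cof_lin ia).
    by rewrite exprD mulrC -scalerA; exact: (coordsZ cof_lin _ ia hN).
  rewrite exprD -scalerA; apply: (coordsZ cof_lin _ ia).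
  rewrite -(linZ (red_homot_linear _ _ _ prP _ _)).
  exact: linear_coords (red_homot_linear _ _ _ prP _ _) ia hM.
apply: (bounds_w (N := N + M + K)).
have := boundsZ cof_lin dcpx_lin (@cpx_lin R t s 2) (@cpx_0 R t s 2) e^-1 ia bE.
rewrite !scalerA eK; congr (bounds _ _ _ (_ *: _)).
rewrite [w ^+ (N + M + K)]exprD; apply: etrans (_ : (e^-1 * e) * (w ^+ (N + M) * w ^+ K) = _).
  by ring.
by rewrite mulVr // mul1r.
Qed.

(** Up to degree [c.+2] the acyclicity lemma applies to the maximal minors; beyond it [red_map]
    vanishes and the homotopy contracts. *)
Lemma corank_exact : grade c.+2 (span (minor_list A t)) zero ->
  forall i u, (0 < i)%N -> cpx i u -> dcpx i u = 0 -> bounds w zero i u.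
Proof.
move=> g i u i0' Cu du; have iz := ideal_zero R.
have [ic|ci] := leqP i c.+2.
  have ex := cpx_acyclicity nat_unit prP (w := w) (ps := minor_list A t) (l := c.+2)
    (fun a ia ga => corank_socle ia ga) g.
  apply: ex => [j v /andP[j0 _] Cv dv p pm||//|k]; last first.
  - by rewrite du; apply: (coords0 cof_lin).
  - by rewrite i0'.
  exact: (minor_torsion nat_unit prP).
case: i ci i0' Cu du => [//|[//|p]] cp _ Cu du; rewrite !ltnS in cp.
have Cu' : singular p.+1 u by exact: Cu.
have [wu _] := Cu'.
have [e eu [K eK]] := @red_constE R t 2 nat_unit w [set~ i0]%SET p.+2.
have := red_homotP nat_unit X w [set~ i0]%SET prP p.+2 Cu'.
have -> : red_map p.+2 p.+1 u = 0 by apply: red_map_vanish => //; lia.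
rewrite [diff A u](_ : _ = 0) // add0r.
rewrite (lin0 (red_homot_linear _ _ _ prP _ _)) addr0 eK => h.
apply: (bounds_w (N := K)).
apply: (@bounds_zero _ _ _ _ _ _ _ _ (e^-1 *: red_homot p.+2 p.+1 u)).
  apply: (C_Z (@cpx_lin R t s 2) (@cpx_0 R t s 2)).
  exact: (red_homot_singular X w _ prP _ wu).
rewrite [dcpx _ _](linZ (dcpx_lin p.+3)) [dcpx _ _]/= -h scalerA mulrA mulVr //.
by rewrite mul1r.
Qed.

End Localized.

Lemma corank_torsion : grade c.+2 (span (minor_list A t)) zero ->
  forall i u, (0 < i)%N -> cpx i u -> dcpx i u = 0 ->
  forall p, p \in minor_list A t.-1 -> exists N, bounds 1 zero i (p ^+ N *: u).
Proof.
move=> g i u i0 Cu du _ /mapP[f _ ->].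
have [->|nz] := eqVneq (minor A f) 0.
  exists 1%N; apply: (@bounds_zero _ _ _ _ _ _ _ _ 0); first exact: cpx_0.
  by rewrite expr1 scale0r (d0 dcpx_lin).
have [X] := minor_inverse A (minor_inj nz).1.
have : #|~: [set f.1 a | a in 'I_t.-1]%SET| == 1%N.
  rewrite cardsCs finset.setCK card_ord (card_imset _ (minor_inj nz).1) card_ord.
  by rewrite -[X in (X - _)%N](prednK t_gt0) subSn // subnn.
case/cards1P=> i1 e1; rewrite -(finset.setCK [set f.1 a | a in 'I_t.-1]%SET) e1 => AX.
have [N [v Cv hv]] := corank_exact AX nz g i0 Cu du.
exists N, 0%N, v => //; by rewrite scale1r.
Qed.

Lemma square_exact i : grade c.+2 (span (minor_list A t)) zero ->
  grade (2 * c + 3) (span (minor_list A t.-1)) zero ->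
  (0 < i <= 2 * c + 3)%N -> exact_at 1 zero i.
Proof.
move=> gI gJ; apply: (minor_acyclic nat_unit prP _ gJ); first by lia.
by move=> j u /andP[j0 _] Cu du; apply: corank_torsion.
Qed.

End CorankOne.

Lemma ideal_exact (R : idomainType) t s c (A : 'M[R]_(t, s)) i :
  (forall n, n.+1%:R \is a @GRing.unit R) -> s.+1 = (t + c)%N ->
  grade c (span (minor_list A t)) (@zero_ideal R) -> (0 < i <= c)%N ->
  exact_at (@cof R t s 1) (dcpx A) (@cpx R t s 1) 1 (@zero_ideal R) i.
Proof.
move=> nat_unit sE g; apply: (minor_acyclic nat_unit (projector1 A) _ g); first by lia.
by move=> j u /andP[j0 _] Cu du p; apply: (minor_torsion nat_unit (projector1 A)).
Qed.

(* A vector with a unit coefficient in the last term for two copies *)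
Transparent lower raise fannih fcreate bosons gl.
Section TopVector.
Variables (R : idomainType) (t s k : nat).
Hypothesis nat_unit : forall n, n.+1%:R \is a @GRing.unit R.
Hypotheses (t2 : (1 < t)%N) (sE : s = (t + k)%N).
Local Notation T := ('I_s * 'I_2)%type.
Local Notation B := ('I_t * 'I_2)%type.
Local Notation fock := (fock R t s 2).
Let i0 : 'I_t := Ordinal (ltnW t2).
Let i1 : 'I_t := Ordinal t2.
Let u0 : 'I_2 := ord0.
Let u1 : 'I_2 := ord_max.

(** A 2 x 2 determinant in bosons of two rows and both copies, hence invariant under SL_2; two rows
    exist because [1 < t]. The ring is a parameter so that the same polynomial can be taken over the
    integers. *)
Definition mode_minor (S : comNzRingType) : {mpoly S[#|{: B}|]} :=
  'X_(enum_rank (i0, u0)) * 'X_(enum_rank (i1, u1)) -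
  'X_(enum_rank (i0, u1)) * 'X_(enum_rank (i1, u0)).

(** The bosonic half of [gl u v], up to sign, as a derivation. *)
Definition shift (u v : 'I_2) (q : {mpoly R[#|{: B}|]}) :=
  \sum_i 'X_(enum_rank (i, v)) * q^`M(enum_rank (i, u)).

Lemma shiftM u v p q : shift u v (p * q) = shift u v p * q + p * shift u v q.
Proof.
rewrite /shift mulr_suml mulr_sumr -big_split; apply: eq_bigr => i _ /=.
by rewrite mderivM; ring.
Qed.

Lemma shiftX u v i w : shift u v 'X_(enum_rank (i, w)) = (w == u)%:R * 'X_(enum_rank (i, v)).
Proof.
have dX (a b : B) : ('X_(enum_rank b))^`M(enum_rank a) = (b == a)%:R :> {mpoly R[#|{: B}|]}.
  rewrite mderivX mnm1E (inj_eq enum_rank_inj); case: eqP => [->|_]; last by rewrite scale0r.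
  by rewrite scale1r (_ : (_ - _)%MM = 0%MM) ?mpolyX0 //; apply/mnmP=> j; rewrite mnmBE subnn mnm0E.
rewrite /shift (bigD1 i) //= big1 ?addr0 => [|j ji].
  by rewrite dX xpair_eqE eqxx mulrC.
by rewrite dX xpair_eqE eq_sym (negbTE ji) mulr0.
Qed.

Lemma shift_minor (u v : 'I_2) : (u <= v)%N -> shift u v (mode_minor R) = (u == v)%:R * mode_minor R.
Proof.
have shiftB p q : shift u v (p - q) = shift u v p - shift u v q.
  by rewrite /shift -sumrB; apply: eq_bigr => i _; rewrite mderivB mulrBr.
have o2 (x : 'I_2) : x = u0 \/ x = u1.
  by case: x => [[|[|//]] h]; [left | right]; apply: val_inj.
rewrite /mode_minor shiftB !shiftM !shiftX.
by case: (o2 u) (o2 v) => -> [] -> //= _; ring.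
Qed.

Lemma shift_power (u v : 'I_2) j : (u <= v)%N ->
  shift u v (mode_minor R ^+ j) = ((u == v)%:R * j%:R) * mode_minor R ^+ j.
Proof.
move=> uv; elim: j => [|j IH].
  rewrite mulr0 mul0r expr0 /shift big1 // => i _.
  by rewrite -mpolyC1 mderivC mulr0.
by rewrite exprS shiftM IH shift_minor // -natr1; ring.
Qed.

Definition top_vector : fock := [ffun S => if S == setT then mode_minor R ^+ k else 0].

Lemma raise_lower_top u v S : (\sum_i raise (i, v) (lower (i, u) top_vector) : fock) S =
  if S == setT then shift u v (mode_minor R ^+ k) else 0.
Proof.
rewrite sum_ffunE; case: eqP => [->|ne].
  by apply: eq_bigr => i _; rewrite !ffunE eqxx.
rewrite big1 // => i _; rewrite !ffunE.
by case: eqP => // _; rewrite mderiv0 mulr0.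
Qed.

Lemma coef_raise_lower_top u v S m : coef (\sum_i raise (i, v) (lower (i, u) top_vector)) S m =
  (if S == setT then shift u v (mode_minor R ^+ k) else 0)@_m.
Proof. exact: (congr1 (mcoeff m) (raise_lower_top u v S)). Qed.

(** With all modes filled each copy has [s] fermions, and the k-th power of the determinant puts k
    bosons into each copy: the weight is [s - k = t]. *)
Lemma top_vector_singular : singular (2 * k) top_vector.
Proof.
split; first split=> [|u].
- apply/coefP=> S m; have -> : bosons top_vector =
    \sum_(u < 2) \sum_i raise (i, u) (lower (i, u) top_vector).
    by rewrite bosonsE exchange_big pair_big; apply: eq_bigr => -[].
  rewrite coef_sum; under eq_bigr => u _ do rewrite coef_raise_lower_top.
  rewrite coefZ !big_ord_recl big_ord0 addr0 [coef _ _ _]/coef [top_vector _]ffunE.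
  case: eqP => _; last by rewrite mcoeff0 addr0 mulr0.
  rewrite !shift_power // !eqxx !mul1r !mulr_natl !mcoeffMn -mulrnDr.
  by rewrite addnn -mul2n.
- apply/coefP=> S m; rewrite glE coefB coef_raise_lower_top coef_sum coefZ.
  under eq_bigr => j _ do rewrite coef_number.
  rewrite /coef ffunE; case: (S =P setT) => [->|_]; last first.
    by rewrite mcoeff0 mulr0 subr0 big1 // => j _; rewrite mulr0.
  under eq_bigr => j _ do rewrite inE mul1r.
  rewrite sumr_const card_ord shift_power // eqxx mul1r.
  rewrite mulr_natl mcoeffMn -mulrnBr ?sE ?leq_addl // addnK.
  by rewrite mulr_natl.
move=> u v uv; apply/coefP=> S m; rewrite glE coefB coef_raise_lower_top coef_sum coef0.
rewrite big1 => [|j _].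
  case: ifP => _; last by rewrite mcoeff0 subr0.
  by rewrite shift_power ?(ltnW uv) // -val_eqE (ltn_eqF uv) !mul0r mcoeff0 subr0.
rewrite /coef !ffunE; case: ifP => _; last by rewrite mcoeff0.
case: ifP => _; first by rewrite scaler0 mcoeff0.
case: eqP => [/setP/(_ (j, u))|_]; last by rewrite !scaler0 mcoeff0.
have uv' : (u == v) = false by rewrite -val_eqE (ltn_eqF uv).
by rewrite !inE xpair_eqE uv' andbF eqxx.
Qed.

(** The polynomial has integer coefficients and is nonzero over the integers, and nonzero integers
    are units in R. *)
Lemma top_vector_unit : exists S m, coef top_vector S m \is a GRing.unit.
Proof.
exists setT; pose p : {mpoly int[_]} := mode_minor int ^+ k.
have p_neq0 : p != 0.
  apply: expf_neq0; apply: contraTneq isT => /(congr1 (fun q => q@_(U_(enum_rank (i0, u0)) + U_(enum_rank (i1, u1)))%MM)).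
  rewrite mcoeff0 /mode_minor -!mpolyXD mcoeffB !mcoeffX eqxx.
  case: eqP => [/mnmP/(_ (enum_rank (i0, u0)))|_]; last by rewrite subr0.
  by rewrite !mnmDE !mnm1E !(inj_eq enum_rank_inj) !xpair_eqE.
have [m hm] : exists m, p@_m != 0 by exists (mlead p); rewrite mleadc_eq0.
exists m; rewrite /coef ffunE eqxx.
have -> : mode_minor R ^+ k = map_mpoly intr p.
  by rewrite rmorphXn rmorphB !rmorphM /= !map_mpolyX.
rewrite mcoeff_map_mpoly; move: (p@_m) hm => [[|z]|z] // _ /=.
  exact: nat_unit.
by rewrite NegzE mulrNz unitrN; exact: nat_unit.
Qed.
End TopVector.
Opaque lower raise fannih fcreate bosons gl.

(** * Regular sequences on I/I^2 *)

Section Ideals.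
Variable R : comNzRingType.
Implicit Types (a b : R -> Prop) (x y : R).

Definition isum a b y : Prop := exists2 v, a v & b (y - v).
Lemma ideal_isum a b : ideal a -> ideal b -> ideal (isum a b).
Proof.
move=> ia ib; split=> [|x y [u hu hx] [v hv hy]|r x [u hu hx]].
- by exists 0; rewrite ?subr0; apply: ideal0.
- exists (u + v); first exact: idealD.
  by rewrite opprD addrACA; apply: idealD.
- by exists (r * u); [apply: idealM | rewrite -mulrBr; apply: idealM].
Qed.
Lemma isum_l a b y : ideal b -> a y -> isum a b y.
Proof. by move=> ib ay; exists y; rewrite ?subrr //; apply: ideal0. Qed.
Lemma isum_r a b y : ideal a -> b y -> isum a b y.
Proof. by move=> ia hb; exists 0; rewrite ?subr0 //; apply: ideal0. Qed.

Definition gen a (s : seq R) : R -> Prop := foldl (@adj R) a s.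
Lemma gen_rcons a s x : gen a (rcons s x) = adj (gen a s) x.
Proof. by rewrite /gen foldl_rcons. Qed.
Lemma gen_ideal a s : ideal a -> ideal (gen a s).
Proof. by move=> ia; elim/last_ind: s => //= s x IH; rewrite gen_rcons; apply: ideal_adj. Qed.
Lemma sub_gen a s y : a y -> gen a s y.
Proof.
move=> ay; elim/last_ind: s => [//|s x IH]; rewrite gen_rcons; exact: sub_adj.
Qed.
Lemma gen_min a b s : ideal b -> (forall y, a y -> b y) -> (forall x, x \in s -> b x) ->
  forall y, gen a s y -> b y.
Proof.
move=> ib ab; elim/last_ind: s => [_ //|s x IH] h; rewrite gen_rcons.
apply: adj_min => //; last by apply: h; rewrite mem_rcons mem_head.
by apply: IH => z zs; apply: h; rewrite mem_rcons inE zs orbT.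
Qed.
Lemma mem_gen a s x : ideal a -> x \in s -> gen a s x.
Proof.
move=> ia; elim/last_ind: s => // s y IH; rewrite mem_rcons inE gen_rcons.
case/orP=> [/eqP->|/IH h]; last exact: sub_adj.
exact/mem_adj1/gen_ideal.
Qed.

Fixpoint regs (a : R -> Prop) (s : seq R) : Prop :=
  if s is x :: s' then reg a x /\ regs (adj a x) s' else True.
Lemma regs_rcons a s x : regs a (rcons s x) <-> regs a s /\ reg (gen a s) x.
Proof. by elim: s a => [|y s IH] a /=; [split=> [[]|[]] | rewrite IH; tauto]. Qed.
Lemma regs_grade a s k (P : R -> Prop) : regs a s -> (forall x, x \in s -> P x) ->
  grade k P (gen a s) -> grade (size s + k) P a.
Proof.
elim: s a => //= x s IH a [rx rs] h g; exists x; split=> //; first exact/h/mem_head.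
by apply: IH => // y ys; apply: h; rewrite inE ys orbT.
Qed.
End Ideals.

Section FockExact.
Variables (R : idomainType) (t s r : nat).
Hypothesis nat_unit : forall n, n.+1%:R \is a @GRing.unit R.
Variable A : 'M[R]_(t, s).
Variable pr : nat -> fock R t s r -> fock R t s r.
Hypothesis prP : projector A pr.
Local Notation exact_at := (exact_at (@cof R t s r) (@dcpx R t s r A) (@cpx R t s r) 1).

Lemma cpx_exact_adj a x i : ideal a -> reg a x -> exact_at a i.+1 -> exact_at a i.+2 ->
  exact_at (adj a x) i.+2.
Proof.
exact: (exact_adj (@cof_lin R t s r) (@dcpx_lin R t s r A)
  (@dcpx_coords R t s r A) (@cpx_lin R t s r) (@cpx_0 R t s r) (@dcpx_C R t s r nat_unit A)
  (@dcpx_d R t s r nat_unit A) (@cpx_split R t s r nat_unit A pr prP)).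
Qed.

(** The cokernel in degree 0 is R/(I^r + a), which has torsion of its own, so in degree 1 regularity
    on it must be assumed. *)
Lemma cpx_exact_adj1 a x : ideal a -> reg (isum (span (minor_power A r)) a) x ->
  exact_at a 1 -> exact_at (adj a x) 1.
Proof.
move=> ia rx; apply: (exact_adj0 (@cof_lin R t s r) (@dcpx_lin R t s r A)
  (@cpx_lin R t s r) (@cpx_0 R t s r) (@dcpx_C R t s r nat_unit A)
  (@cpx_split R t s r nat_unit A pr prP)) => // y /coef_vac_line->.
by rewrite scalerA => /(bounds_vac nat_unit prP _ ia) h; apply/(bounds_vac nat_unit prP _ ia)/rx.
Qed.

Lemma cpx_exact_adjs a x l : ideal a -> reg a x -> reg (isum (span (minor_power A r)) a) x ->
  (forall i, (0 < i <= l)%N -> exact_at a i) ->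
  (forall i, (0 < i <= l)%N -> exact_at (adj a x) i).
Proof.
move=> ia rx rx' ex [|[|i]] // /andP[_ il]; first by apply: cpx_exact_adj1 => //; apply: ex.
by apply: cpx_exact_adj => //; apply: ex; rewrite //= ltnW.
Qed.
End FockExact.

Section Conormal.
Variables (R : idomainType) (t s_ c : nat).
Hypothesis nat_unit : forall n, n.+1%:R \is a @GRing.unit R.
Hypothesis noeth : noetherian R.
Hypotheses (sE : s_.+1 = (t + c.+2)%N) (t_gt0 : (0 < t)%N).
Variable A : 'M[R]_(t, s_).
Local Notation zero := (@zero_ideal R).
Local Notation ex r := (exact_at (@cof R t s_ r) (@dcpx R t s_ r A) (@cpx R t s_ r) 1).
Local Notation I r := (span (minor_power A r)).

Lemma nat_inverse m : exists d : R, m.+1%:R * d = 1.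
Proof. by exists (m.+1%:R)^-1; rewrite mulrV. Qed.

Lemma ideal_I r : ideal (I r). Proof. exact: ideal_span. Qed.
Hint Resolve ideal_I : core.

Lemma span_minor_power1 y : I 1 y <-> span (minor_list A t) y.
Proof.
split; apply: span_min; rewrite ?[ideal _]/(ideal _); try exact: ideal_span.
  move=> _ /mapP[f _ ->]; rewrite big_ord1; apply: mem_span; apply/mapP.
  by exists (f ord0); rewrite ?mem_enum.
move=> _ /mapP[f _ ->]; apply: mem_span; apply/mapP; exists [ffun=> f]; first by rewrite mem_enum.
by rewrite big_ord1 ffunE.
Qed.

Lemma mul_I x y : I 1 x -> I 1 y -> I 2 (x * y).
Proof.
move=> /span_minor_power1 hx /span_minor_power1 hy.
apply: (span_min (b := fun x => I 2 (x * y))) hx.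
  exact: (ideal_colon y (ideal_I 2)).
move=> _ /mapP[f _ ->]; rewrite mulrC; apply: (span_min (b := fun y => I 2 (y * _))) hy.
  exact: (ideal_colon _ (ideal_I 2)).
move=> _ /mapP[g _ ->]; apply: mem_span; apply/mapP.
exists [ffun u : 'I_2 => if u == ord0 then g else f]; first by rewrite mem_enum.
by rewrite !big_ord_recl big_ord0 !ffunE /= mulr1.
Qed.

Lemma I2_sub (b : R -> Prop) : ideal b -> (forall x y, I 1 x -> I 1 y -> b (x * y)) ->
  forall y, I 2 y -> b y.
Proof.
move=> ib h; apply: span_min => // _ /mapP[f _ ->]; rewrite !big_ord_recl big_ord0 mulr1.
by apply: h; apply/span_minor_power1/mem_span/mapP; eexists; rewrite ?mem_enum.
Qed.

Lemma I2_I1 y : I 2 y -> I 1 y.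
Proof. by apply: I2_sub => // x z _; apply: idealM. Qed.

Definition acyclic (a : R -> Prop) : Prop :=
  (forall i, (0 < i <= c.+2)%N -> ex 1 a i) /\ (forall i, (0 < i <= 2 * c + 3)%N -> ex 2 a i).

Definition good (a : R -> Prop) (x : R) : Prop :=
  [/\ reg a x, reg (isum (I 1) a) x & reg (isum (I 2) a) x].

Lemma acyclic0 : grade c.+2 (span (minor_list A t)) zero ->
  grade (2 * c + 3) (span (minor_list A t.-1)) zero -> acyclic zero.
Proof.
move=> gI gJ; split=> i il; first exact: ideal_exact nat_unit sE gI il.
exact: square_exact nat_unit sE t_gt0 _ _ gI gJ il.
Qed.

Lemma acyclic_adj a x : ideal a -> good a x -> acyclic a -> acyclic (adj a x).
Proof.
move=> ia [rx r1 r2] [e1 e2]; split.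
  exact (cpx_exact_adjs nat_unit (projector1 A) ia rx r1 e1).
exact (cpx_exact_adjs nat_unit (projector2 nat_unit A) ia rx r2 e2).
Qed.

Lemma socle1 a ps : ideal a -> grade c.+3 (span ps) a -> acyclic a ->
  nosocle ps (isum (I 1) a).
Proof.
move=> ia g [e1 _] y; apply: (power_socle nat_unit (projector1 A) _ ia g e1).
by rewrite !mul1n; lia.
Qed.

Lemma socle2 a ps : ideal a -> grade (2 * c + 4) (span ps) a -> acyclic a ->
  nosocle ps (isum (I 2) a).
Proof.
move=> ia g [_ e2] y; apply: (@power_socle _ _ _ _ nat_unit A _ (projector2 nat_unit A) (2 * c + 3)) => //.
  by lia.
by rewrite -addnS.
Qed.

(** [2 * c + 4] is one more than the length of the longer complex: this grade excludes a socle in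
    R/(I^2 + a), and a fortiori in R/(I + a) and R/a. *)
Lemma good_exists a ps k : ideal a -> grade (2 * c + 4 + k) (span ps) a -> acyclic a ->
  exists x, [/\ span ps x, good a x & grade (2 * c + 3 + k) (span ps) (adj a x)].
Proof.
move=> ia g ac.
have [|||n [ra r1 r2]] := avoidance noeth nat_inverse ia (ideal_isum (ideal_I 1) ia)
    (ideal_isum (ideal_I 2) ia) (ps := ps).
- by apply: (grade_nosocle (k := 0)) => //; apply: grade_le g; lia.
- by apply: socle1 => //; apply: grade_le g; lia.
- by apply: socle2 => //; apply: grade_le g; lia.
exists (mixed n ps); split=> //; first exact: span_mixed.
apply: (grade_adj noeth nat_inverse) => //; first exact: span_mixed.
by rewrite -addSn -addnS.
Qed.

Inductive good_seq : seq R -> Prop :=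
| GoodNil : good_seq [::]
| GoodRcons s x : good_seq s -> good (gen zero s) x -> good_seq (rcons s x).

Lemma good_seq_exists ps k l : acyclic zero -> grade (2 * c + 3 + (k + l)) (span ps) zero ->
  exists s, [/\ size s = k, forall x, x \in s -> span ps x, good_seq s,
     acyclic (gen zero s) & grade (2 * c + 3 + l) (span ps) (gen zero s)].
Proof.
move=> ac; elim: k l => [|k IH] l g; first by exists [::]; rewrite add0n in g; split=> //; exact: GoodNil.
have [|s' [sz sP gs as' gr]] := IH l.+1; first by rewrite -(addSnnS k).
have igs := gen_ideal s' (ideal_zero R).
have [|x [px gx grx]] := @good_exists _ ps l igs _ as'; first by rewrite (_ : (2 * c + 4 + l = 2 * c + 3 + l.+1)%N) //; lia.
exists (rcons s' x); rewrite size_rcons sz gen_rcons; split=> //.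
- by move=> y; rewrite mem_rcons inE => /orP[/eqP->|/sP].
- by constructor.
- exact: acyclic_adj.
Qed.

Fixpoint cn_rev (s : seq R) : R -> Prop :=
  if s is x :: s' then fun y => exists2 v, I 1 v & cn_rev s' (y - v * x) else I 2.
(* [cn s] is the preimage in [I] of the submodule [s (I/I^2)]. *)
Definition cn s := cn_rev (rev s).
Lemma cn_rcons s x y : cn (rcons s x) y <-> exists2 v, I 1 v & cn s (y - v * x).
Proof. by rewrite /cn rev_rcons. Qed.
Lemma ideal_cn s : ideal (cn s).
Proof.
elim/last_ind: s => [|s x IH]; first exact: ideal_I.
split=> [|y z /cn_rcons[u hu hy] /cn_rcons[v hv hz]|r y /cn_rcons[u hu hy]]; apply/cn_rcons.
- by exists 0; rewrite ?mul0r ?subr0; [exact: ideal0 | exact: ideal0].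
- exists (u + v); first exact: idealD.
  by rewrite mulrDl opprD addrACA; apply: idealD.
- by exists (r * u); [apply: idealM | rewrite -mulrA -mulrBr; apply: idealM].
Qed.
Lemma cn_sub s y : cn s y -> I 1 y /\ isum (I 2) (gen zero s) y.
Proof.
elim/last_ind: s y => [|s x IH] y.
  by move=> h; split; [exact: I2_I1 | exact: isum_l (ideal_zero R) h].
move=> /cn_rcons[v hv /IH[h1 [w hw hy]]]; split.
  by rewrite -[y](subrK (v * x)); apply: (idealD (ideal_I 1)) h1 _; rewrite mulrC; exact: idealM (ideal_I 1) _ _ hv.
exists w => //; rewrite gen_rcons; exists v; by rewrite addrAC.
Qed.
Lemma cn_rcons_sub s x y : cn s y -> cn (rcons s x) y.
Proof. by move=> h; apply/cn_rcons; exists 0; rewrite ?mul0r ?subr0 //; apply: ideal0. Qed.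
Lemma cn_mem s x v : I 1 v -> x \in s -> cn s (v * x).
Proof.
move=> hv; elim/last_ind: s => // s y IH; rewrite mem_rcons inE => /orP[/eqP->|/IH]; last first.
  exact: cn_rcons_sub.
by apply/cn_rcons; exists v; rewrite // subrr; exact: ideal0 (ideal_cn s).
Qed.

(* Regularity on R/I makes (s) meet I in s I. *)
Lemma good_gen s y : good_seq s -> gen zero s y -> I 1 y -> cn s y.
Proof.
move=> gs; elim: gs y => {s} [|s x gs IH [rx r1 r2]] y.
  by move=> -> _; exact: (ideal0 (ideal_I 2)).
rewrite gen_rcons => -[r hr] hy; apply/cn_rcons.
have igs := gen_ideal s (ideal_zero R).
have [v hv hq] : isum (I 1) (gen zero s) r.
  apply: r1; exists y; first exact: hy.
  by rewrite mulrC -opprB; apply: idealN.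
exists v => //; apply: IH.
  have -> : y - v * x = (y - r * x) + x * (r - v) by ring.
  by apply: (idealD igs) => //; apply: (idealM igs).
by rewrite [v * x]mulrC; apply: (idealB (ideal_I 1)) => //; apply: (idealM (ideal_I 1)).
Qed.

Lemma good_cn s y : good_seq s -> I 1 y -> isum (I 2) (gen zero s) y -> cn s y.
Proof.
move=> gs hy [q hq h]; rewrite -[y](subrK q); apply: (idealD (ideal_cn s)).
  apply: good_gen => //; apply: idealB => //; exact: I2_I1.
by elim/last_ind: (s) => // s' x; apply: cn_rcons_sub.
Qed.

Definition creg s : Prop := forall i, (i < size s)%N ->
  forall y, I 1 y -> cn (take i s) (s`_i * y) -> cn (take i s) y.

(** By [good_cn] the module I/(I^2 + sI) embeds into R/(I^2 + (s)), where the next element is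
    regular. *)
Lemma good_creg s : good_seq s -> creg s.
Proof.
elim=> {s} [|s x gs IH [rx r1 r2]] i //; rewrite size_rcons ltnS leq_eqVlt nth_rcons.
case/orP=> [/eqP->|lt] y hy.
  rewrite ltnn eqxx -cats1 take_size_cat // => /cn_sub[_ h].
  by apply: good_cn => //; apply: r2.
by rewrite lt -cats1 takel_cat ?(ltnW lt) //; apply: IH.
Qed.

Lemma good_regs s : good_seq s -> regs zero s.
Proof.
by elim=> {s} // s x gs IH [rx _ _]; apply/regs_rcons.
Qed.

(** Elements regular only on R modulo their predecessors may have torsion on the degree 0 cokernel;
    each of them costs one degree of exactness at the bottom. *)
Lemma exact_tail k a ps : ideal a -> (k <= 2 * c + 2)%N -> grade (2 * c + 2) (span ps) a ->
  (forall i, (0 < i <= 2 * c + 3)%N -> ex 2 a i) ->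
  exists s, [/\ size s = k, forall x, x \in s -> span ps x, regs a s,
    grade (2 * c + 2 - k) (span ps) (gen a s) &
    forall i, (k < i <= 2 * c + 3)%N -> ex 2 (gen a s) i].
Proof.
move=> ia + g e; elim: k => [|k IH] kc; first by exists [::]; rewrite subn0; split.
have [s' [sz sP rs gs es]] := IH (ltnW kc).
have := gs; rewrite (_ : (2 * c + 2 - k = (2 * c + 2 - k.+1).+1)%N); last by lia.
move=> -[x [px rx gx]].
exists (rcons s' x); rewrite size_rcons sz gen_rcons; split=> //.
- by move=> y; rewrite mem_rcons inE => /orP[/eqP->|/sP].
- exact/regs_rcons.
move=> [|[|i]] // /andP[ki ic]; apply: (cpx_exact_adj nat_unit (projector2 nat_unit A)) => //.
- exact: gen_ideal.
- by apply: es; rewrite -ltnS ki /= ltnW.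
- by apply: es; rewrite ic andbT ltnW.
Qed.

(* The residue field has projective dimension [n + 1], so the resolution of [I^2] cannot stay
   exact modulo a system of parameters: the top vector gives a nonzero homology class. *)
Lemma creg_bound s ms f : (2 <= t)%N -> good_seq s -> acyclic (gen zero s) ->
  grade (2 * c + 3) (span ms) (gen zero s) ->
  (forall i j, span ms (A i j)) -> (forall x, x \in s -> span ms x) ->
  (forall s', regs zero s' -> (forall x, x \in s' -> span ms x) ->
     size s' = (size s + (2 * c + 3))%N -> ~ nosocle ms (gen zero s')) ->
  span ms f -> ~ (forall y, I 1 y -> cn s (f * y) -> cn s y).
Proof.
move=> t2 gs ac g hA sP hmax mf hf; pose a := gen zero s.
have ia : ideal a by exact/gen_ideal/ideal_zero.
(* A socle element of R/(I^2 + a) lies in I + a, as R/(I + a) has no socle. Its part [v] in I is a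
   socle element of the conormal module modulo [s], which the assumed regularity of [f] excludes. *)
have n2 : nosocle ms (isum (I 2) a).
  move=> y hy.
  have [v hv hyv] : isum (I 1) a y.
    apply: (socle1 (ps := ms) ia _ ac); first by apply: grade_le g; lia.
    by move=> p /hy[q hq h]; exists q; [exact: I2_I1|].
  have vy p : isum (I 2) a (p * y) -> isum (I 2) a (p * v).
    move=> [q hq h]; exists q => //.
    have -> : p * v - q = (p * y - q) - p * (y - v) by ring.
    by apply: idealB => //; apply: idealM.
  have mv p : span ms p -> cn s (p * v).
    apply: (span_min (ideal_colon v (ideal_cn s))) => q qm.
    by apply: good_cn => //; [apply: idealM | apply/vy/hy].
  have [_ [q hq h]] := cn_sub (hf v hv (mv f mf)); exists q => //.
  have -> : y - q = (y - v) + (v - q) by ring.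
  exact: idealD.
have na : nosocle ms a by apply: (grade_nosocle (k := 0)) => //; apply: grade_le g; lia.
(* This [x] is regular on R/(I^2 + a) too, so no degree of exactness is lost modulo [x]. *)
have [n [rx r2 _]] := avoidance noeth nat_inverse ia (ideal_isum (ideal_I 2) ia) ia na n2 na.
set x := mixed n ms in rx r2; have px : span ms x by exact: span_mixed.
have gx : grade (2 * c + 2) (span ms) (adj a x).
  by apply: (grade_adj noeth nat_inverse) => //; rewrite -addnS.
have iax := ideal_adj x ia.
have ex2 := cpx_exact_adjs nat_unit (projector2 nat_unit A) ia rx r2 ac.2.
(* [2 * c + 2] further elements leave exactness in the last degree [2 * c + 3] alone. *)
have [s' [sz sP' rs' _ es']] := exact_tail iax (leqnn _) gx ex2.
have ea' : gen (adj a x) s' = gen zero (s ++ x :: s') by rewrite /a /gen foldl_cat.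
set a' := gen (adj a x) s' in es' ea'.
have ia' : ideal a' by exact: gen_ideal.
(* The sequence now has the length at which [hmax] provides a nonzero socle element [z]. *)
have /existsNP[z /not_implyP[hz nz]] : ~ nosocle ms (gen zero (s ++ x :: s')).
  apply: hmax => [|y|].
- have : regs a (x :: s') by [].
  have : regs zero s by exact: good_regs.
  rewrite /a; elim: (s) (zero) => //= y s1 IH b [ry r1] h; split=> //; exact: IH.
- by rewrite mem_cat inE => /or3P[/sP|/eqP->|/sP'].
- by rewrite size_cat /= sz -addnS.
rewrite -ea' in hz nz; apply: nz.
have sE2 : s_ = (t + c.+1)%N by apply: succn_inj; rewrite sE addnS.
have [S [m um]] := top_vector_unit s_ c.+1 nat_unit t2.
have hs : singular (2 * c).+2 (top_vector R s_ c.+1 t2).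
  have := top_vector_singular R t2 sE2.
  by rewrite (_ : (2 * c.+1 = (2 * c).+2)%N) //; lia.
set w0 := top_vector _ _ _ _ in um hs.
have dA : coords_in (@cof R t s_ 2) (span ms) (diff A w0).
  rewrite diffE => -[S' m']; rewrite /cof coef_sum; apply: ideal_sum => [|b _].
    exact: ideal_span.
  rewrite annihAE coef_sum; apply: ideal_sum => [|j _]; first exact: ideal_span.
  rewrite coefZ mulrC; apply: idealM; [exact: ideal_span | exact: hA].
(* [z] kills the entries of [A] modulo [a'], so [z *: w0] is a cycle there. No nonzero boundary
   reaches the last degree, and the unit coefficient of [w0] then puts [z] into [a']. *)
have [|||N [v [Cv _] hv]] := es' (2 * c).+3 _ (z *: w0).
- by rewrite addn2 addn3 ltnSn.
- exact: (C_Z (@cpx_lin R t s_ 2) (@cpx_0 R t s_ 2) (i := (2 * c).+3)).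
- rewrite [dcpx _ _ _](linZ (@dcpx_lin R t s_ 2 A (2 * c).+3)) => -[S' m'].
  rewrite /cof coefZ mulrC; apply: (span_min (ideal_colon z ia')) (dA (S', m')) => p /hz.
  by [].
have v0 : v = 0.
  by apply: (weight_top nat_unit Cv); lia.
have := hv (S, m); rewrite v0 (lin0 (@dcpx_lin R t s_ 2 A _)) subr0 expr1n scale1r /cof coefZ.
move=> h; rewrite -[z]mulr1 -(mulrV um) mulrA mulrC; exact: idealM.
Qed.
End Conormal.

(** * Noetherianity of polynomial rings *)

Lemma nondecreasing_subsequence (g : nat -> nat) : exists2 sigma : nat -> nat,
  {homo sigma : i j / (i < j)%N} & forall i, (g (sigma i) <= g (sigma i.+1))%N.
Proof.
have h N : exists i, (N <= i)%N /\ forall j, (N <= j)%N -> (g i <= g j)%N.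
  have ex : exists v, `[< exists2 i, (N <= i)%N & g i = v >].
    by exists (g N); apply/asboolP; exists N.
  case: (ex_minnP ex) => v /asboolP[i Ni <-] hmin; exists i; split=> // j Nj.
  by apply: hmin; apply/asboolP; exists j.
have [next hn] := choice h.
pose sigma := fix sg i := if i is i'.+1 then next (sg i').+1 else next 0%N.
exists sigma.
  by apply: homo_ltn => [i j k|i /=]; [exact: ltn_trans | have [] := hn (sigma i).+1].
have lo i : exists2 N, sigma i = next N & (N <= sigma i)%N.
  by case: i => [|i] /=; [exists 0%N | exists (sigma i).+1 => //; have [] := hn (sigma i).+1].
move=> i; have [N e Ni] := lo i; rewrite {1}e; have [_] := hn N; apply.
by apply: leq_trans Ni _; have [h1 _] := hn (sigma i).+1; apply: leq_trans h1.
Qed.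

(** Passing to a subsequence once per coordinate makes all exponents nondecreasing. *)
Lemma dickson n (m : nat -> 'X_{1..n}) : exists i j, (i < j)%N /\ (m i <= m j)%MM.
Proof.
suff h k : exists2 sigma : nat -> nat, {homo sigma : i j / (i < j)%N} &
    forall l : 'I_n, (l < k)%N -> forall i j, (i <= j)%N -> (m (sigma i) l <= m (sigma j) l)%N.
  have [sigma hs hm] := h n; exists (sigma 0%N), (sigma 1%N); split; first exact: hs.
  by apply/mnm_lepP => l; apply: hm.
elim: k => [|k [sigma hs hm]]; first by exists id.
have [kn|nk] := ltnP k n; last first.
  by exists sigma => // l _; apply: hm; apply: leq_trans (ltn_ord l) nk.
have [tau ht hg] := nondecreasing_subsequence (fun i => m (sigma i) (Ordinal kn)).
exists (sigma \o tau) => [i j ij|l]; first exact/hs/ht.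
rewrite ltnS leq_eqVlt => /orP[/eqP lk|lk] i j ij /=; last first.
  apply: hm => //; have [->|ne] := eqVneq i j; first by [].
  by apply/ltnW/ht; rewrite ltn_neqAle ne.
have -> : l = Ordinal kn by apply: val_inj.
exact: (homo_leq leqnn leq_trans hg).
Qed.

Section Noetherian.
Variables (K : fieldType) (n : nat).
Local Notation R := {mpoly K[n]}.

Definition leads (a : R -> Prop) (m : 'X_{1..n}) : Prop :=
  exists f, [/\ a f, f != 0 & mlead f = m].

Lemma leads_up a m m' : ideal a -> leads a m -> (m <= m')%MM -> leads a m'.
Proof.
move=> ia [f [af f0 <-]] mm; exists ('X_[m' - mlead f] * f); split.
- exact: idealM.
- by rewrite mulf_neq0 // -msupp_eq0 msuppX.
- by rewrite mleadM ?mleadXm ?submK // -?msupp_eq0 ?msuppX // msupp_eq0.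
Qed.

Lemma leads_eq a b : ideal a -> ideal b -> (forall x, a x -> b x) ->
  (forall m, leads b m -> leads a m) -> forall x, b x -> a x.
Proof.
move=> ia ib ab ls x; move: {2}(mlead x) (erefl (mlead x)) => m.
elim/(well_founded_ind (@ltom_wf n)): m x => m IH x xm bx.
have [->|x0] := eqVneq x 0; first exact: ideal0.
have [f [af f0 fm]] : leads a m by apply: ls; exists x.
pose c := (x@_m / f@_m) *: f; have ac : a c.
  by rewrite /c -mul_mpolyC; apply: idealM.
rewrite -[x](subrK c); apply: idealD => //.
have [->|y0] := eqVneq (x - c) 0; first exact: ideal0.
apply: (IH (mlead (x - c))) => //; last by apply: idealB => //; apply: ab.
rewrite lt_neqAle; apply/andP; split; last first.
  apply: le_trans (mleadB_le _ _) _; rewrite leUx xm lexx /= -fm.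
  exact: mleadZ_le.
apply: contraNneq y0 => e; rewrite -mleadc_eq0 e mcoeffB mcoeffZ.
by rewrite mulfVK ?subrr // -fm mleadc_eq0.
Qed.

(** A strictly increasing chain acquires a new leading monomial at each step by [leads_eq], and
    Dickson's lemma makes one of them a multiple of an earlier one. *)
Lemma mpoly_noetherian : noetherian R.
Proof.
move=> F [a0 ia0 Fa0]; apply: contrapT => hmax.
pose T := {a : R -> Prop | ideal a /\ F a}.
have /choice[next hn] : forall a : T, exists b : T,
    (forall x, proj1_sig a x -> proj1_sig b x) /\ exists x, proj1_sig b x /\ ~ proj1_sig a x.
  move=> [a [ia Fa]]; apply: contrapT => h; apply: hmax.
  exists a; split=> // b ib Fb ab x bx; apply: contrapT => nax; apply: h.
  by exists (exist _ b (conj ib Fb)); split=> //; exists x.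
pose A i := iter i next (exist _ a0 (conj ia0 Fa0)).
have iA i : ideal (proj1_sig (A i)) := (proj2_sig (A i)).1.
have up i j x : (i <= j)%N -> proj1_sig (A i) x -> proj1_sig (A j) x.
  by move=> /subnK<-; elim: (j - i)%N x => //= k IH x /IH; exact: (hn _).1.
have /choice[m hm] : forall i, exists m, leads (proj1_sig (A i.+1)) m /\
    ~ leads (proj1_sig (A i)) m.
  move=> i; apply: contrapT => h; have [_ [x [hx nx]]] := hn (A i); apply: nx.
  apply: (@leads_eq _ (proj1_sig (A i.+1))) => // [y|m lm]; first exact: (hn _).1.
  by apply: contrapT => nl; apply: h; exists m.
have [i [j [ij mij]]] := dickson m; case: (hm j) => _; apply.
apply: leads_up (mij) => //; have [[f [hf f0 fm]] _] := hm i.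
by exists f; split=> //; apply: up hf.
Qed.
End Noetherian.

(** It is meant for the stalks, whose ideals embed as an ordered set into those of the polynomial
    ring. *)
Lemma noetherian_transfer (R S : comNzRingType) (phi : (S -> Prop) -> R -> Prop) :
  noetherian R -> (forall a, ideal a -> ideal (phi a)) ->
  (forall a b, ideal a -> ideal b -> (forall x, a x -> b x) -> forall x, phi a x -> phi b x) ->
  (forall a b, ideal a -> ideal b -> (forall x, phi a x -> phi b x) -> forall x, a x -> b x) ->
  noetherian S.
Proof.
move=> nR hi hm hj F [a0 ia0 Fa0].
have [|_ [_ [a [ia Fa ->]] amax]] := nR (fun c => exists a, [/\ ideal a, F a & c = phi a]).
  by exists (phi a0); [exact: hi | exists a0].
exists a; split=> // b ib Fb ab; apply: hj => //.
by apply: amax; [exact: hi | exists b | exact: hm].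
Qed.

Section Radical.
Variable R : comNzRingType.
Hypothesis noeth : noetherian R.
Definition isprime (a : R -> Prop) : Prop :=
  [/\ ideal a, ~ a 1 & forall x y, a (x * y) -> a x \/ a y].

Lemma prime_exp a x k : isprime a -> a (x ^+ k) -> a x.
Proof.
move=> [_ n1 p]; elim: k => [|k IH]; first by rewrite expr0 => /n1.
by rewrite exprS => /p[].
Qed.

Lemma prime_prod a (T : finType) (F : T -> R) : isprime a -> a (\prod_i F i) -> exists i, a (F i).
Proof.
move=> [_ n1 p]; elim/big_ind: _ => [/n1|x y hx hy /p[/hx|/hy]|i _ h] //; by exists i.
Qed.

(** An ideal over [a] that is maximal among those avoiding all powers of [x] is prime. *)
Lemma radical_prime a x : ideal a -> (forall q, isprime q -> (forall y, a y -> q y) -> q x) ->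
  exists k, a (x ^+ k).
Proof.
move=> ia h; apply: contrapT => nx.
pose F b := (forall y, a y -> b y) /\ forall k, ~ b (x ^+ k).
have [|q [iq [aq qx] qmax]] := @noeth F.
  by exists a => //; split=> // k ak; apply: nx; exists k.
have out y : ~ q y -> exists k, adj q y (x ^+ k).
  move=> ny; apply: contrapT => h2; apply: ny.
  apply: (qmax (adj q y)); [exact: ideal_adj | split=> [z /aq|k hk] | |].
  - exact: sub_adj.
  - by apply: h2; exists k.
  - by move=> z; apply: sub_adj.
  - exact: mem_adj1.
have pq : isprime q.
  split=> // [q1|y z qyz]; first by apply: (qx 0%N); rewrite expr0.
  apply: contrapT => /not_orP[/out[k [r hr]] /out[l [r' hr']]].
  apply: (qx (k + l)%N); rewrite exprD.
  have -> : x ^+ k * x ^+ l = x ^+ l * (x ^+ k - r * y) + r * y * (x ^+ l - r' * z) +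
     r * r' * (y * z) by ring.
  by apply: idealD => //; [apply: idealD => // |]; apply: idealM.
by apply: (qx 1%N); rewrite expr1; apply: h.
Qed.
End Radical.

(** * The conormal module *)

Local Open Scope quotient_scope.

Section SubmodGen.
Variables (R : comNzRingType) (V : lmodType R).
Implicit Types (S : V -> Prop) (P : V -> Prop).

Lemma submod_gen_min S P : P 0 -> (forall r x y, P x -> P y -> P (r *: x + y)) ->
  (forall x, S x -> P x) -> forall x, x \in submod_gen S -> P x.
Proof.
move=> P0 Plin SP _ /asboolP[k [r [x [Sx ->]]]].
by elim/big_ind: _ => // [u v Pu Pv|i _]; [rewrite -[u]scale1r; apply: Plin|
  rewrite -[_ *: _]addr0; apply: Plin => //; apply: SP].
Qed.

Lemma mem_submod_gen S x : S x -> x \in submod_gen S.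
Proof.
move=> Sx; apply/asboolP; exists 1%N, (fun=> 1), (fun=> x).
by rewrite big_ord1 scale1r.
Qed.

Lemma ideal_smul_min (s : seq R) P : P 0 -> (forall r x y, P x -> P y -> P (r *: x + y)) ->
  (forall r x, r \in s -> P (r *: x)) -> forall x, x \in ideal_smul V (mem s) -> P x.
Proof.
move=> P0 Pl sP; apply: submod_gen_min => // _ [r [x [rs ->]]]; exact: sP.
Qed.

Lemma mem_ideal_smul (s : seq R) r x : r \in s -> r *: x \in ideal_smul V (mem s).
Proof. by move=> rs; apply: mem_submod_gen; exists r, x. Qed.
End SubmodGen.

Lemma ideal_submod (R : comNzRingType) (I : submodClosed R^o) : ideal (fun y : R => y \in I).
Proof.
split=> [|x y hx hy|r x hx]; [exact: rpred0 | exact: rpredD | exact: (rpredZ (r : R) hx)].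
Qed.

Lemma ideal_smul_gen (R : comNzRingType) (s : seq R) (x : R) :
  (x : R^o) \in ideal_smul R^o (mem s) <-> gen (@zero_ideal R) s x.
Proof.
have ig := gen_ideal s (ideal_zero R); split.
  apply: (ideal_smul_min (V := R^o) (P := gen (@zero_ideal R) s)) => [|r y z hy hz|r y rs].
  - exact: ideal0 ig.
  - by apply: (idealD ig) => //; apply: (idealM ig).
  - by rewrite [_ *: _]mulrC; apply: (idealM ig); apply: mem_gen rs; exact: ideal_zero.
apply: (gen_min (b := fun x : R => (x : R^o) \in ideal_smul R^o (mem s))) => [|_ ->|y ys].
- exact: (ideal_submod (ideal_smul R^o (mem s))).
- exact: rpred0.
- by rewrite -[y]mulr1; apply: (mem_ideal_smul (V := R^o) 1 ys).
Qed.

Lemma minors_idealP (K : fieldType) (n t s : nat) (A : 'M[{mpoly K[n]}]_(t, s)) k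
    (f : {mpoly K[n]}) : f \in minors_ideal k A <-> span (minor_list A k) f.
Proof.
have ii := ideal_submod (minors_ideal k A); split.
  have isp := ideal_span (minor_list A k).
  apply: (submod_gen_min (V := {mpoly K[n]}^o) (P := span (minor_list A k))) => [|r x y hx hy|_ [[f1 f2] /= [i1 i2] <-]].
  - exact: ideal0.
  - by apply: (idealD isp) => //; apply: (idealM isp).
  apply/mem_span/mapP; exists ([ffun i => f1 i], [ffun i => f2 i]); first by rewrite mem_enum.
  by congr (\det _); apply/matrixP=> i j; rewrite !mxE !ffunE.
apply: (span_min ii) => _ /mapP[g _ ->].
have [->|nz] := eqVneq (minor A g) 0; first exact: ideal0 ii.
apply: (mem_submod_gen (V := {mpoly K[n]}^o)); exists (g.1 : _ -> _, g.2 : _ -> _) => //.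
exact: minor_inj nz.
Qed.

Section Conormal.
Variables (R : idomainType) (t s : nat) (A : 'M[R]_(t, s)) (I : submodClosed R^o).
Local Notation P r := (span (minor_power A r)).
Hypothesis idealP1 : forall f : R, f \in I <-> P 1 f.
Local Notation N := (conormal I).
Local Notation T := (ideal_smul (submodule I) (I : {pred R})).

Lemma squareP (y : submodule I) : y \in T <-> P 2 (submod_val y).
Proof.
split.
  apply: (submod_gen_min (V := submodule I) (P := fun y => P 2 (submod_val y))) => [|r x z hx hz|_ [r [x [ri ->]]]].
  - exact: ideal0 (ideal_span _).
  - rewrite [submod_val _]/(r * submod_val x + submod_val z).
    by apply: (idealD (ideal_span _)) => //; apply: (idealM (ideal_span _)).
  - rewrite [submod_val _]/(r * submod_val x); apply: mul_I; first exact/idealP1.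
    by apply/idealP1; exact: (valP x).
suff h v : P 2 v -> exists2 y : submodule I, y \in T & submod_val y = v.
  by move=> /h[z zT e]; rewrite -(val_inj e).
apply: (@I2_sub _ t s A (fun v => exists2 y : submodule I, y \in T & submod_val y = v)) => [|x z].
  split=> [|x z [u hu <-] [w hw <-]|r x [u hu <-]].
  - by exists 0; rewrite ?rpred0.
  - by exists (u + w); rewrite ?rpredD.
  - by exists (r *: u); rewrite ?rpredZ.
move=> /idealP1 xI /idealP1 zI; exists (x *: (Submodule zI : submodule I)) => //.
by apply: mem_submod_gen; exists x, (Submodule zI).
Qed.

Local Notation pi := (\pi_{ideal_quot (submod_pred T)} : submodule I -> N).

Lemma pi_eq y z : pi y = pi z <-> P 2 (submod_val y - submod_val z).
Proof.
rewrite -[submod_val y - submod_val z]/(submod_val (y - z)) -squareP -[_ \in T]/(_ \in submod_pred T).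
by rewrite Quotient.idealrBE; split=> [->|/eqP].
Qed.

Lemma pi_scale r y : r *: pi y = pi (r *: y).
Proof. exact: quotient_scale_pi. Qed.
Lemma piD y z : pi y + pi z = pi (y + z).
Proof. by rewrite !piE. Qed.

Definition cnN q (x : N) : Prop := cn A q (submod_val (repr x)).
Lemma cnN_pi q y : cnN q (pi y) <-> cn A q (submod_val y).
Proof.
have h : P 2 (submod_val (repr (pi y)) - submod_val y) by apply/pi_eq; rewrite reprK.
have h' : cn A q (submod_val (repr (pi y)) - submod_val y).
  by elim/last_ind: (q) => // q' x; apply: cn_rcons_sub.
have ic := ideal_cn A q; split=> [h1|]; last exact: ideal_sub ic h'.
exact: ideal_subr ic h' h1.
Qed.

Lemma conormal_smul q x : x \in ideal_smul N (mem q) <-> cnN q x.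
Proof.
have ic := ideal_cn A q; split.
  apply: (ideal_smul_min (P := cnN q)) => [|r y z|r y rq].
  - have -> : (0 : N) = pi 0 by rewrite -[0 in LHS](scale0r (pi 0)) pi_scale scale0r.
    by apply/cnN_pi; exact: ideal0 ic.
  - rewrite -[y]reprK -[z]reprK => /cnN_pi hy /cnN_pi hz; rewrite pi_scale piD.
    by apply/cnN_pi; apply: (idealD ic) => //; apply: (idealM ic).
  - rewrite -[y]reprK pi_scale; apply/cnN_pi.
    change (cn A q (r * submod_val (repr y))); rewrite mulrC; apply: cn_mem => //.
    by apply/idealP1; exact: (valP (repr y)).
rewrite -{2}[x]reprK /cnN; move: (repr x) => y {x}.
elim/last_ind: q y {ic} => [|q a IH] y.
  move=> hy; have -> : pi y = 0 :> N; last exact: rpred0.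
  have -> : (0 : N) = pi 0 by rewrite -[0 in LHS](scale0r (pi 0)) pi_scale scale0r.
  by apply/pi_eq; rewrite subr0.
move=> /cn_rcons[v /idealP1 hv]; pose w : submodule I := Submodule hv.
have -> : submod_val y - v * a = submod_val (y - a *: w) by rewrite mulrC.
move=> /IH h; rewrite -[y](subrK (a *: w)) -piD -pi_scale; apply: rpredD; last first.
  by apply: mem_ideal_smul; rewrite mem_rcons mem_head.
apply: (ideal_smul_min (P := fun x => x \in ideal_smul N (mem (rcons q a)))) h => [|r u z|r u rq].
- exact: rpred0.
- by move=> hu hz; apply: rpredD => //; apply: rpredZ.
- by apply: mem_ideal_smul; rewrite mem_rcons inE rq orbT.
Qed.

Lemma regular_seqP q : regular_seq N q <->
  creg A q /\ exists2 y, P 1 y & ~ cn A q y.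
Proof.
split=> [[h [x hx]]|[h [y /idealP1 hy ny]]]; split.
- move=> i iq y /idealP1 hy; pose w : submodule I := Submodule hy.
  rewrite -[_ * y]/(submod_val (q`_i *: w)) -[y in X in _ -> X]/(val w).
  move=> /cnN_pi/conormal_smul; rewrite -pi_scale => /(h i iq).
  by move=> /conormal_smul/cnN_pi.
- exists (submod_val (repr x)); first by apply/idealP1; exact: (valP (repr x)).
  by move=> hc; move/negP: hx; apply; apply/conormal_smul.
- move=> i iq x; rewrite -[x]reprK pi_scale => /conormal_smul/cnN_pi hc.
  apply/conormal_smul/cnN_pi; apply: h iq _ _ hc.
  by apply/idealP1; exact: (valP (repr x)).
- exists (pi (Submodule hy)); apply/negP => /conormal_smul/cnN_pi; exact: ny.
Qed.

Lemma creg_rcons q x : creg A (rcons q x) <-> creg A q /\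
  forall y, P 1 y -> cn A q (x * y) -> cn A q y.
Proof.
split=> [h|[h hx] i].
  split=> [i iq y hy|y hy].
    have := h i _ y hy; rewrite size_rcons nth_rcons iq -cats1 takel_cat; last exact: ltnW.
    by apply; apply: ltnW.
  have := h (size q) _ y hy; rewrite size_rcons nth_rcons ltnn eqxx -cats1 take_size_cat //.
  by apply.
rewrite size_rcons ltnS leq_eqVlt nth_rcons => /orP[/eqP->|lt] y hy.
  by rewrite ltnn eqxx -cats1 take_size_cat //; apply: hx.
by rewrite lt -cats1 takel_cat ?(ltnW lt) //; apply: h.
Qed.

Hypothesis noeth : noetherian R.

(** Take a regular extension [q'] with [cn A q'] maximal. If [f] extended it further, [f * y] would
    lie in [cn A (rcons q' f)], hence in [cn A q'], for every [y] in I; regularity of [f] would put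
    I into [cn A q']. *)
Lemma max_extension (a : {pred R}) q : {subset q <= a} -> regular_seq N q ->
  depth_ge a N (size q).
Proof.
move=> qa rq; pose F c := exists q', [/\ {subset q' <= a}, regular_seq N q',
  (size q <= size q')%N & c = cn A q'].
have [|_ [_ [q' [qa' rq' sq' ->]] hmax]] := @noeth F.
  by exists (cn A q); [exact: ideal_cn | exists q].
exists (size q') => //; exists q' => //; split=> // f fa rf.
have [/creg_rcons[_ hf] [y hy ny]] := (regular_seqP (rcons q' f)).1 rf.
apply: ny; apply: cn_rcons_sub; apply: hf => //.
apply: (hmax (cn A (rcons q' f))).
- exact: ideal_cn.
- exists (rcons q' f); split=> //; last by rewrite size_rcons ltnW.
  by move=> x; rewrite mem_rcons inE => /orP[/eqP->|/qa'].
- by move=> x; apply: cn_rcons_sub.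
by rewrite mulrC; apply: cn_mem => //; rewrite mem_rcons mem_head.
Qed.

End Conormal.
Close Scope quotient_scope.

(** * Homogeneous regular sequences *)

Section RegularSequences.
Variable R : comNzRingType.
Implicit Types (a : R -> Prop) (x y : R).

Lemma gen_cons a x s : gen a (x :: s) = gen (adj a x) s. Proof. by []. Qed.

Lemma regs_congr a (Fs Gs : seq R) : ideal a -> size Fs = size Gs ->
  (forall i, a (Fs`_i - Gs`_i)) -> regs a Gs -> regs a Fs.
Proof.
elim: Gs Fs a => [|G Gs IH] [|F Fs] a //= ia [sz] h [rG rs].
have h0 := h 0%N; have FG : a (G - F) by rewrite -opprB; apply: idealN.
split; first exact: reg_congr FG rG.
rewrite (adj_congr ia h0); apply: IH rs => //; first exact: ideal_adj.
by move=> i; apply: sub_adj; apply: (h i.+1).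
Qed.

Lemma regs_cat a s s' : regs a (s ++ s') <-> regs a s /\ regs (gen a s) s'.
Proof. by elim: s a => [|x s IH] a /=; [tauto | rewrite IH; tauto]. Qed.
End RegularSequences.

Section Graded.
Variables (K : fieldType) (n : nat).
Local Notation R := {mpoly K[n]}.
Implicit Types (a : R -> Prop) (u x F : R).

Definition homog_ideal a : Prop := forall f d, a f -> a (pihomog mdeg d f).
Definition form F : Prop := exists2 e, (0 < e)%N & F \is e.-homog.

Lemma pihomogM (p q : R) d e : q \is e.-homog ->
  pihomog mdeg d (p * q) = if (e <= d)%N then pihomog mdeg (d - e) p * q else 0.
Proof.
move=> hq; pose B := maxn (mmeasure mdeg p) (d - e).+1.
rewrite {1}(@pihomog_partitionE _ _ mdeg B p (leq_maxl _ _)) mulr_suml linear_sum /=.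
have hM (i : 'I_B) : pihomog mdeg i p * q \is (i + e).-homog by apply: dhomogM => //; exact: pihomogP.
have [ed|de] := leqP e d; last first.
  rewrite big1 // => i _; apply: (pihomog_ne0 _ (hM i)).
  by rewrite neq_ltn (leq_trans de) ?orbT ?leq_addl.
have lt : (d - e < B)%N by rewrite leq_max ltnSn orbT.
rewrite (bigD1 (Ordinal lt)) //= [X in _ + X]big1 ?addr0 => [|i ne].
  by apply: pihomog_dE; rewrite -{2}(subnK ed); exact: (hM (Ordinal lt)).
apply: (pihomog_ne0 _ (hM i)); apply: contraNneq ne => e'.
by apply/eqP/val_inj; rewrite /= -e' addnK.
Qed.

Lemma dhomog_exp (p : R) d k : p \is d.-homog -> p ^+ k \is (d * k).-homog.
Proof.
move=> hp; elim: k => [|k IH]; first by rewrite muln0 dhomog1.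
by rewrite exprS mulnS; apply: dhomogM.
Qed.

Lemma homog_zero : homog_ideal (@zero_ideal R).
Proof. by move=> f d ->; rewrite /zero_ideal pihomog0. Qed.

Lemma homog_adj a F e : ideal a -> homog_ideal a -> F \is e.-homog -> homog_ideal (adj a F).
Proof.
move=> ia ha hF u d [r /(ha _ d)]; rewrite pihomogB (pihomogM _ _ hF).
case: leqP => _ h; first by exists (pihomog mdeg (d - e) r).
by exists 0; rewrite mul0r.
Qed.

Lemma homog_span ps : (forall p, p \in ps -> exists e, p \is e.-homog) -> homog_ideal (span ps).
Proof.
elim: ps => [|p ps IH] h; first exact: homog_zero.
have [e he] := h p (mem_head _ _); apply: (homog_adj (ideal_span ps) _ he).
by apply: IH => q qps; apply: h; rewrite inE qps orbT.
Qed.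

(* Krull intersection, trivial in the graded case. *)
Lemma graded_krull a x u : ideal a -> homog_ideal a -> form x ->
  (forall k, exists v, a (u - v * x ^+ k)) -> a u.
Proof.
move=> ia ha [e e0 hx] h; rewrite (@pihomog_partitionE _ _ mdeg _ u (leqnn _)).
apply: ideal_sum => // d _; have [v /(ha _ d)] := h d.+1.
have hxk : x ^+ d.+1 \is (e * d.+1).-homog by apply: dhomog_exp.
rewrite pihomogB (pihomogM _ _ hxk) ifF ?subr0 //.
by apply/negbTE; rewrite -ltnNge; exact: leq_pmull.
Qed.

(** If [y u] is in [a], then [u] can be divided by [x] modulo [a] again and again, and Krull's
    intersection applies. *)
Lemma graded_reg a x y : ideal a -> homog_ideal a -> form x ->
  reg a x -> reg (adj a x) y -> reg a y.
Proof.
move=> ia ha fx rx ry u hu; apply: (graded_krull ia ha fx) => k.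
suff [v [h _]] : exists v, a (u - v * x ^+ k) /\ a (y * v) by exists v.
elim: k => [|k [v [h1 h2]]]; first by exists u; rewrite mulr1 subrr; split=> //; apply: ideal0.
have [r hr] : adj a x v by apply: ry; apply: sub_adj.
exists r; split.
  have -> : u - r * x ^+ k.+1 = (u - v * x ^+ k) + x ^+ k * (v - r * x) by rewrite exprS; ring.
  by apply: idealD => //; apply: idealM.
apply: rx; have -> : x * (y * r) = y * v - y * (v - r * x) by ring.
by apply: idealB => //; apply: idealM.
Qed.

Lemma regs_front a xs F Fs : ideal a -> homog_ideal a -> form F -> (forall x, x \in xs -> form x) ->
  regs a (xs ++ F :: Fs) -> regs a (F :: xs ++ Fs).
Proof.
move=> + + fF; elim: xs a => //= x xs IH a ia ha fxs [rx rs].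
have fx := fxs x (mem_head _ _); have [e e0 hx] := fx.
have [||y ys|rF rs'] := IH (adj a x) _ _ _ rs.
- exact: ideal_adj.
- exact: homog_adj hx.
- by apply: fxs; rewrite inE ys orbT.
have rF' := graded_reg ia ha fx rx rF.
by split=> //; rewrite -adjC; split=> //; apply: reg_swap.
Qed.

(** Regular sequences of forms may be permuted: each term of [Fs] is moved in front of [xs], which
    can then be forgotten. *)
Lemma regs_drop a xs Fs : ideal a -> homog_ideal a -> (forall F, F \in Fs -> form F) ->
  (forall x, x \in xs -> form x) -> regs a (xs ++ Fs) -> regs a Fs.
Proof.
elim: Fs a => //= F Fs IH a ia ha fFs fxs rs.
have fF := fFs F (mem_head _ _); have [e e0 hF] := fF.
have [rF rs'] := regs_front ia ha fF fxs rs; split=> //.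
apply: IH rs' => // [||G Gs]; [exact: ideal_adj | exact: homog_adj hF |].
by apply: fFs; rewrite inE Gs orbT.
Qed.

Implicit Types (L : seq ('I_n * nat)).
Definition powers L : seq R := [seq 'X_p.1 ^+ p.2 | p <- L].

Lemma coefM_pow (r : R) (i : 'I_n) N m : (r * 'X_i ^+ N)@_m =
  if (N <= m i)%N then r@_(m - U_(i) *+ N)%MM else 0.
Proof.
rewrite mpolyXn; case: leqP => h.
  have {1}-> : m = (U_(i) *+ N + (m - U_(i) *+ N))%MM; last by rewrite mcoeffMX.
  apply/mnmP=> j; rewrite mnmDE mnmBE mulmnE mnm1E subnKC //.
  by case: eqP => [<-|]; rewrite ?mul1n ?mul0n.
apply: memN_msupp_eq0; apply/negP; rewrite (perm_mem (msuppMX _ _)) => /mapP[m' _ e].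
by move: h; rewrite e mnmDE mulmnE mnm1E eqxx mul1n ltnNge leq_addr.
Qed.

Lemma gen_powers L u : gen (@zero_ideal R) (powers L) u <->
  forall m, u@_m != 0 -> has (fun p => p.2 <= m p.1)%N L.
Proof.
elim/last_ind: L u => [|L [i N] IH] u.
  split=> [-> m|h]; first by rewrite mcoeff0 eqxx.
  by apply/mpolyP=> m; rewrite mcoeff0; apply/eqP; apply: contraT => /h.
rewrite /powers map_rcons gen_rcons -/(powers L); split=> [[r /IH h] m um|h].
  rewrite has_rcons /=; case: leqP => //= lt; apply: h.
  by rewrite mcoeffB coefM_pow leqNgt lt subr0.
exists (\sum_(m <- msupp u | (N <= m i)%N) u@_m *: 'X_[m - U_(i) *+ N]).
apply/IH => m; have -> : (u - (\sum_(m <- msupp u | (N <= m i)%N) u@_m *: 'X_[m - U_(i) *+ N])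
    * 'X_i ^+ N)@_m = if (N <= m i)%N then 0 else u@_m.
  rewrite mulr_suml mcoeffB raddf_sum /=.
  under eq_bigr => m' hm'.
    rewrite -scalerAl mpolyXn -mpolyXD submK; last first.
      apply/mnm_lepP=> j; rewrite mulmnE mnm1E; case: eqP => [<-|]; by rewrite ?mul1n ?mul0n.
    rewrite mcoeffZ mcoeffX. over.
  case: ifP => Nm; last first.
    rewrite big1 ?subr0 // => m' hm'; case: eqP => [e|]; last by rewrite mulr0.
    by rewrite -e hm' in Nm.
  have [ms|ms] := boolP (m \in msupp u); last first.
    rewrite (memN_msupp_eq0 ms) big_seq_cond big1 ?subr0 // => m' /andP[hm' _].
    by case: eqP hm' => [->|]; rewrite ?(negbTE ms) ?mulr0.
  rewrite -big_filter (bigD1_seq m) ?filter_uniq ?msupp_uniq ?mem_filter ?Nm //= eqxx mulr1.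
  by rewrite big1 ?addr0 ?subrr // => m' ne; rewrite (negbTE ne) mulr0.
case: ifP => [_|Nm um]; first by rewrite eqxx.
by have := h m um; rewrite has_rcons /= Nm.
Qed.

Lemma reg_powers L j N : j \notin map fst L -> reg (gen (@zero_ideal R) (powers L)) ('X_j ^+ N).
Proof.
move=> jL u /gen_powers h; apply/gen_powers => m um.
have [|[i M] pL /= le] := hasP (h (m + U_(j) *+ N)%MM _).
  rewrite mulrC coefM_pow mnmDE mulmnE mnm1E eqxx mul1n leq_addl.
  by rewrite (_ : (_ - _)%MM = m) //; apply/mnmP=> l; rewrite mnmBE mnmDE addnK.
apply/hasP; exists (i, M) => //=; move: le; rewrite mnmDE mulmnE mnm1E.
case: eqP => [e|]; last by rewrite mul0n addn0.
by case/negP: jL; rewrite e; apply/mapP; exists (i, M).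
Qed.

Lemma regs_powers L : uniq (map fst L) -> regs (@zero_ideal R) (powers L).
Proof.
elim/last_ind: L => // L [j N] IH; rewrite /powers !map_rcons rcons_uniq => /andP[jL uL].
by apply/regs_rcons; split; [exact: IH | exact: reg_powers].
Qed.

Definition later_vars (h : nat) : seq R := powers [seq (k, 1%N) | k <- [seq k : 'I_n <- enum 'I_n | (h <= k)%N]].

Lemma form_var_pow (j : 'I_n) N : (0 < N)%N -> form ('X_j ^+ N).
Proof.
move=> N0; exists N => //; have := @dhomog_exp 'X_j 1 N; rewrite mul1n; apply.
by rewrite dhomogX; apply/eqP; exact: mdeg1.
Qed.

(** After the later variables, [F j] may be replaced by ['X_j ^+ N], and powers of distinct
    variables form a regular sequence. *)
Lemma regs_of_powers h N (P : R -> Prop) (F : 'I_n -> R) : (h <= n)%N -> (0 < N)%N ->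
  (forall j : 'I_n, (j < h)%N -> [/\ P (F j), F j \is N.-homog &
     gen (@zero_ideal R) (later_vars h) (F j - 'X_j ^+ N)]) ->
  exists Fs, [/\ size Fs = h, forall G, G \in Fs -> P G /\ G \is N.-homog & regs (@zero_ideal R) Fs].
Proof.
move=> hn N0 hF; pose js := [seq j : 'I_n <- enum 'I_n | (j < h)%N].
have iz := ideal_zero R.
exists (map F js); split.
- rewrite size_map /js -(size_map val) -(filter_map val (fun j => j < h)%N) val_enum_ord.
  rewrite -(subnKC hn) iotaD filter_cat size_cat add0n.
  rewrite (eq_in_filter (a2 := predT)) => [|j]; last by rewrite mem_iota => /andP[_ ->].
  rewrite filter_predT size_iota (eq_in_filter (a2 := pred0)) ?filter_pred0 ?addn0 // => j.
  by rewrite mem_iota => /andP[le _]; rewrite ltnNge le.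
- by move=> _ /mapP[j + ->]; rewrite mem_filter => /andP[/hF[]].
apply: (regs_drop (xs := later_vars h)) => //; first exact: homog_zero.
- by move=> _ /mapP[j + ->]; rewrite mem_filter => /andP[/hF[_ hj _] _]; exists N.
- by move=> _ /mapP[p + ->] => /mapP[k _ ->]; apply: form_var_pow.
apply/regs_cat; split.
  by apply: regs_powers; rewrite -map_comp map_id filter_uniq ?enum_uniq.
pose L := [seq (j, N) | j <- js].
apply: (@regs_congr _ _ _ (powers L)) => [||i|]; first exact: gen_ideal.
- by rewrite !size_map.
- have [lt|ge] := ltnP i (size js); last first.
    rewrite !nth_default ?size_map // subrr; exact: (ideal0 (gen_ideal _ _)).
  have [j0 _] : exists j : 'I_n, True by case: (js) lt => [|j]; [|exists j].
  rewrite /powers /L -map_comp !(nth_map j0) //=.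
  have := mem_nth j0 lt; rewrite mem_filter => /andP[/hF[_ _ h'] _]; exact: h'.
have : regs (@zero_ideal R) (powers ([seq (k, 1%N) | k <- [seq k : 'I_n <- enum 'I_n | (h <= k)%N]] ++ L)).
  have mf q M : [seq p.1 | p <- [seq (k : 'I_n, M : nat) | k <- q]] = q by rewrite -map_comp map_id.
  apply: regs_powers; rewrite map_cat !mf cat_uniq; apply/and3P; split.
  - exact: filter_uniq (enum_uniq _).
  - by apply/hasPn => j; rewrite !mem_filter => /andP[jh _]; rewrite leqNgt jh.
  - exact: filter_uniq (enum_uniq _).
by rewrite {1}/powers map_cat => /regs_cat[].
Qed.
End Graded.

(** * General matrices *)

Section PolynomialFunctions.
Variables (K : fieldType) (n p q : nat).
Local Notation R := {mpoly K[n]}.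
Implicit Types (f g : 'M[R]_(p, q) -> K) (G H : 'M[R]_(p, q) -> R).

Lemma polynomial_fun_ext f g : f =1 g -> polynomial_fun g -> polynomial_fun f.
Proof. by move=> fg [N [w [P h]]]; exists N, w, P => A; rewrite fg. Qed.

Lemma polynomial_fun_op f g (op : forall N, {mpoly K[N]} -> {mpoly K[N]} -> {mpoly K[N]})
    (op' : K -> K -> K) :
  (forall N (P Q : {mpoly K[N]}) v, (op N P Q).@[v] = op' P.@[v] Q.@[v]) ->
  polynomial_fun f -> polynomial_fun g -> polynomial_fun (fun A => op' (f A) (g A)).
Proof.
move=> hop [N1 [w1 [P1 h1]]] [N2 [w2 [P2 h2]]]; exists (N1 + N2)%N.
exists (fun l => match split l with inl i => w1 i | inr j => w2 j end).
exists (op _ (P1 \mPo [tuple 'X_(lshift N2 i) | i < N1]) (P2 \mPo [tuple 'X_(rshift N1 i) | i < N2])).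
move=> A; rewrite hop !comp_mpoly_meval h1 h2; congr op'; apply: meval_eq => i.
  by rewrite tnth_mktuple mevalXU (unsplitK (inl i)).
by rewrite tnth_mktuple mevalXU (unsplitK (inr i)).
Qed.

Lemma polynomial_funD f g : polynomial_fun f -> polynomial_fun g ->
  polynomial_fun (fun A => f A + g A).
Proof. by apply: (polynomial_fun_op (op := fun N => +%R)) => N P Q v; rewrite mevalD. Qed.
Lemma polynomial_funM f g : polynomial_fun f -> polynomial_fun g ->
  polynomial_fun (fun A => f A * g A).
Proof. by apply: (polynomial_fun_op (op := fun N => *%R)) => N P Q v; rewrite mevalM. Qed.
Lemma polynomial_funC c : polynomial_fun (fun _ : 'M[R]_(p, q) => c).
Proof.
have w : 'I_0 -> 'I_p * 'I_q * 'X_{1..n} by case.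
by exists 0%N, w, c%:MP => A; rewrite mevalC.
Qed.

Definition coef_fun G : Prop := forall m, polynomial_fun (fun A => (G A)@_m).

Lemma coef_fun_ext G H : G =1 H -> coef_fun H -> coef_fun G.
Proof. by move=> GH h m; apply: polynomial_fun_ext (h m) => A; rewrite GH. Qed.
Lemma coef_funC (r : R) : coef_fun (fun=> r).
Proof. by move=> m; apply: polynomial_funC. Qed.
Lemma coef_fun_entry i j : coef_fun (fun A => A i j).
Proof.
move=> m; exists 1%N, (fun=> (i, j, m)), 'X_ord0 => A; by rewrite mevalXU.
Qed.
Lemma coef_funD G H : coef_fun G -> coef_fun H -> coef_fun (fun A => G A + H A).
Proof.
move=> hG hH m; apply: polynomial_fun_ext (polynomial_funD (hG m) (hH m)) => A.
by rewrite mcoeffD.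
Qed.
Lemma polynomial_fun_sum (T : Type) (s : seq T) (P : pred T) (F : T -> 'M[R]_(p, q) -> K) :
  (forall i, polynomial_fun (F i)) -> polynomial_fun (fun A => \sum_(i <- s | P i) F i A).
Proof.
move=> h; elim: s => [|i s IH].
  by apply: polynomial_fun_ext (polynomial_funC 0) => A; rewrite big_nil.
case E : (P i); last by apply: polynomial_fun_ext IH => A; rewrite big_cons E.
by apply: polynomial_fun_ext (polynomial_funD (h i) IH) => A; rewrite big_cons E.
Qed.
Lemma polynomial_fun_prod (T : Type) (s : seq T) (F : T -> 'M[R]_(p, q) -> K) :
  (forall i, polynomial_fun (F i)) -> polynomial_fun (fun A => \prod_(i <- s) F i A).
Proof.
move=> h; elim: s => [|i s IH].
  by apply: polynomial_fun_ext (polynomial_funC 1) => A; rewrite big_nil.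
by apply: polynomial_fun_ext (polynomial_funM (h i) IH) => A; rewrite big_cons.
Qed.
Lemma polynomial_fun_det k (F : 'I_k -> 'I_k -> 'M[R]_(p, q) -> K) :
  (forall i j, polynomial_fun (F i j)) -> polynomial_fun (fun A => \det (\matrix_(i, j) F i j A)).
Proof.
move=> h; apply: polynomial_fun_sum => sg; apply: polynomial_funM (polynomial_funC _) _.
apply: (polynomial_fun_ext (g := fun A => \prod_(i < k) F i (sg i) A)) => [A|].
  by apply: eq_bigr => i _; rewrite mxE.
exact: polynomial_fun_prod.
Qed.
Lemma coef_funM G H : coef_fun G -> coef_fun H -> coef_fun (fun A => G A * H A).
Proof.
move=> hG hH m; apply: polynomial_fun_ext (fun A => mcoeffM (G A) (H A) m) _.
by apply: polynomial_fun_sum => k; apply: polynomial_funM.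
Qed.
Lemma coef_fun_sum (T : Type) (s : seq T) (F : T -> 'M[R]_(p, q) -> R) :
  (forall i, coef_fun (F i)) -> coef_fun (fun A => \sum_(i <- s) F i A).
Proof.
move=> h; elim: s => [|i s IH].
  by apply: coef_fun_ext (coef_funC 0) => A; rewrite big_nil.
by apply: coef_fun_ext (coef_funD (h i) IH) => A; rewrite big_cons.
Qed.
Lemma coef_fun_prod (T : Type) (s : seq T) (F : T -> 'M[R]_(p, q) -> R) :
  (forall i, coef_fun (F i)) -> coef_fun (fun A => \prod_(i <- s) F i A).
Proof.
move=> h; elim: s => [|i s IH].
  by apply: coef_fun_ext (coef_funC 1) => A; rewrite big_nil.
by apply: coef_fun_ext (coef_funM (h i) IH) => A; rewrite big_cons.
Qed.
Lemma coef_fun_minor k (e : {ffun 'I_k -> 'I_p} * {ffun 'I_k -> 'I_q}) :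
  coef_fun (fun A => minor A e).
Proof.
apply: coef_fun_sum => sg; apply: coef_funM (coef_funC _) _.
apply: (coef_fun_ext (H := fun A => \prod_(i < k) A (e.1 i) (e.2 (sg i)))) => [A|].
  by apply: eq_bigr => i _; rewrite mxE.
by apply: coef_fun_prod => i; apply: coef_fun_entry.
Qed.
End PolynomialFunctions.

Lemma span_image (R : comNzRingType) (T : finType) (g : T -> R) v :
  span [seq g f | f : T] v -> exists r : T -> R, v = \sum_f r f * g f.
Proof.
apply: (span_min (b := fun v => exists r : T -> R, v = \sum_f r f * g f)).
  split=> [|x y [r ->] [r' ->]|c x [r ->]].
  - by exists (fun=> 0); rewrite big1 // => f _; rewrite mul0r.
  - exists (fun f => r f + r' f); rewrite -big_split; apply: eq_bigr => f _.
    by rewrite mulrDl.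
  - by exists (fun f => c * r f); rewrite mulr_sumr; apply: eq_bigr => f _; rewrite mulrA.
move=> _ /mapP[f _ ->]; exists (fun f' => (f' == f)%:R).
by rewrite (bigD1 f) //= eqxx mul1r big1 ?addr0 // => f' /negbTE->; rewrite mul0r.
Qed.

Section Generic.
Variables (K : fieldType) (n t s : nat) (a : 'I_s -> int) (b : 'I_t -> int).
Hypothesis hd : forall i j, 0 < a j - b i.
Local Notation R := {mpoly K[n]}.
Local Notation D := (fun i j => absz (a j - b i)).
Implicit Types A : 'M[R]_(t, s).

Lemma homogeneous_minor A k f : homogeneous_mx D A ->
  @minor R t s A k f \is (\sum_i D (f.1 i) (f.2 i))%N.-homog.
Proof.
move=> hA; rewrite /minor /determinant; apply: rpred_sum => sg _; rewrite -signr_odd.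
have e : (\sum_i D (f.1 i) (f.2 i) = \sum_i D (f.1 i) (f.2 (sg i)))%N.
  suff : (\sum_i D (f.1 i) (f.2 i))%N%:R = (\sum_i D (f.1 i) (f.2 (sg i)))%N%:R :> int.
    by move/eqP; rewrite eqr_nat => /eqP.
  have DE i j : (D i j)%:R = a j - b i by rewrite natz gez0_abs // ltW // hd.
  rewrite !natr_sum (eq_bigr _ (fun i _ => DE _ _)) [RHS](eq_bigr _ (fun i _ => DE _ _)) !sumrB.
  by congr (_ - _); rewrite (reindex_inj (@perm_inj _ sg)).
rewrite e; have hp : \prod_i mxsub f.1 f.2 A i (sg i) \is (\sum_i D (f.1 i) (f.2 (sg i)))%N.-homog.
  elim/big_rec2: _ => [|i d q _ hq]; first exact: dhomog1.
  by rewrite mxE; apply: dhomogM.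
by case: (odd sg); rewrite ?mulN1r ?mul1r ?rpredN.
Qed.

Lemma homogeneous_ideal A k : homogeneous_mx D A -> homog_ideal (span (minor_list A k)).
Proof.
by move=> hA; apply: homog_span => _ /mapP[f _ ->]; eexists; apply: homogeneous_minor.
Qed.

(* If the degree [N] monomials in the first [h] variables lie in [I_k + (x_h, ...)] for one
   matrix, then the determinant expressing them stays nonzero on an open set of matrices. *)
Lemma generic_powers k h A0 :
  (forall j : 'I_n, (j < h)%N -> exists N,
     isum (span (minor_list A0 k)) (gen (@zero_ideal R) (later_vars K n h)) ('X_j ^+ N)) ->
  exists f, [/\ polynomial_fun f, f A0 != 0 & forall A, homogeneous_mx D A -> f A != 0 ->
    exists2 N, (0 < N)%N & forall j : 'I_n, (j < h)%N -> exists F,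
      [/\ span (minor_list A k) F, F \is N.-homog &
          gen (@zero_ideal R) (later_vars K n h) (F - 'X_j ^+ N)]].
Proof.
move=> h0; pose xs := gen (@zero_ideal R) (later_vars K n h).
have ixs : ideal xs by exact/gen_ideal/ideal_zero.
have ii A : ideal (isum (span (minor_list A k)) xs) by apply: ideal_isum => //; exact: ideal_span.
have [N0 N00 hN0] : exists2 N0, (0 < N0)%N & forall j : 'I_n, (j < h)%N ->
    isum (span (minor_list A0 k)) xs ('X_j ^+ N0).
  have /choice[e he] : forall j : 'I_n, exists N, (j < h)%N ->
      isum (span (minor_list A0 k)) xs ('X_j ^+ N).
    by move=> j; case: (boolP (j < h)%N) => [/h0[N hN]|_]; [exists N | exists 0%N].
  exists (\max_j e j).+1%N => // j jh; rewrite -(subnK (leqW (leq_bigmax j))) exprD.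
  exact: (idealM (ii A0)) (he j jh).
(* A monomial of this degree in n variables has some exponent at least [N0]. *)
pose N := (n * N0).+1.
pose T := {m : 'X_{1..n < N.+1} | (mdeg m == N) && [forall i : 'I_n, (h <= i)%N ==> (m i == 0%N)]}.
pose mon (m : T) : 'X_{1..n} := val m.
have xs_coef u (m : T) : xs u -> u@_(mon m) = 0.
  move=> /gen_powers hu; apply/eqP; apply: contraT => /hu/hasP[p /mapP[i + ->] /=].
  rewrite mem_filter => /andP[hi _]; have /andP[_ /forallP/(_ i)] := valP m.
  by rewrite hi /= => /eqP e; rewrite /mon e.
have mon_in (m : T) : isum (span (minor_list A0 k)) xs 'X_[mon m].
  have /andP[/eqP md /forallP mh] := valP m.
  have [j jN] : exists j : 'I_n, (N0 <= mon m j)%N.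
    apply/existsP; apply: contraT; rewrite negb_exists => /forallP hlt.
    suff : (N <= n * N0)%N by rewrite ltnn.
    have -> : (n * N0 = \sum_(i < n) N0)%N by rewrite sum_nat_const card_ord.
    rewrite -md mdegE.
    apply: leq_sum => i _.
    by rewrite ltnW // ltnNge.
  have jh : (j < h)%N.
    rewrite ltnNge; apply/negP => hj; have := mh j; rewrite hj /= => /eqP e.
    by move: jN; rewrite /mon e leqNgt N00.
  have -> : 'X_[mon m] = 'X_[mon m - U_(j) *+ N0] * 'X_j ^+ N0 :> R.
    rewrite mpolyXn -mpolyXD submK //; apply/mnm_lepP => i; rewrite mulmnE mnm1E.
    by case: eqP => [<-|]; rewrite ?mul1n ?mul0n.
  exact: (idealM (ii A0)) (hN0 j jh).
have /choice[v hv] : forall m : T, exists v, span (minor_list A0 k) v /\ xs ('X_[mon m] - v).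
  by move=> m; have [v] := mon_in m; exists v.
have /choice[r hr] : forall m : T, exists r, v m = \sum_f r f * @minor R t s A0 k f.
  by move=> m; apply: span_image; exact: (hv m).1.
pose G m A := \sum_f r m f * @minor R t s A k f.
pose q := #|{: T}|.
(* The coefficients of the combinations [G] at the degree N monomials in the first h variables; for
   [A0] this is the identity matrix. *)
pose M A : 'M[K]_q := \matrix_(i, j) (G (enum_val i) A)@_(mon (enum_val j)).
exists (fun A => \det (M A)); split.
- apply: polynomial_fun_det => i j; apply: coef_fun_sum => f.
  by apply: coef_funM; [apply: coef_funC | apply: coef_fun_minor].
- have -> : M A0 = 1%:M; last by rewrite det1 oner_eq0.
  apply/matrixP=> i j; rewrite !mxE /G -hr.
  have := xs_coef _ (enum_val j) (hv (enum_val i)).2.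
  rewrite mcoeffB mcoeffX => /eqP; rewrite subr_eq0 => /eqP <-.
  by rewrite /mon (inj_eq val_inj) (inj_eq val_inj) (inj_eq enum_val_inj).
move=> A hA dA; exists N => // j jh.
have hT : (mdeg (U_(j) *+ N)%MM == N) && [forall i : 'I_n, (h <= i)%N ==> ((U_(j) *+ N)%MM i == 0%N)].
  rewrite mdegMn mdeg1 mul1n eqxx; apply/forallP => i; apply/implyP => hi.
  rewrite mulmnE mnm1E; case: (j =P i) => [e|_]; last by rewrite mul0n.
  by move: hi; rewrite -e leqNgt jh.
have hB : (mdeg (U_(j) *+ N)%MM < N.+1)%N by rewrite (eqP (proj1 (andP hT))).
pose mj : T := Sub (BMultinom hB) hT.
(* Solving the system leaves ['X_j ^+ N] as the only such monomial; the degree N component stays in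
   the ideal, which is homogeneous. *)
pose W := invmx (M A); pose F0 := \sum_i (W (enum_rank mj) i) *: G (enum_val i) A.
have W1 : W *m M A = 1%:M by rewrite mulVmx // unitmxE unitfE.
have cF m : (pihomog mdeg N F0)@_(mon m) = (mj == m)%:R.
  have -> : (pihomog mdeg N F0)@_(mon m) = F0@_(mon m).
    have /andP[/eqP md _] := valP m.
    rewrite pihomogE [in RHS](mpolyE F0) !raddf_sum /= big_mkcond /=; apply: eq_bigr => m' _.
    case: eqP => // ne; rewrite mcoeffZ mcoeffX; case: eqP => [e|]; rewrite ?mulr0 //.
    by case: ne; rewrite e.
  rewrite raddf_sum /=; have /matrixP/(_ (enum_rank mj) (enum_rank m)) := W1.
  rewrite !mxE (inj_eq enum_rank_inj) => <-; apply: eq_bigr => i _.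
  by rewrite mcoeffZ mxE enum_rankK.
exists (pihomog mdeg N F0); split; last 1 first.
- apply/gen_powers => m um; have [md|md] := eqVneq (mdeg m) N; last first.
    move: um; rewrite mcoeffB mpolyXn mcoeffX (dhomog_nemf_coeff (pihomogP _ _ _) md) sub0r.
    case: ((U_(j) *+ N)%MM =P m) md => [<-|_] md; last by rewrite oppr0 eqxx.
    by rewrite (eqP (proj1 (andP hT))) eqxx in md.
  have [/forallP all0|] := boolP [forall i : 'I_n, (h <= i)%N ==> (m i == 0%N)].
    have hm : (mdeg m < N.+1)%N by rewrite md.
    have hm' : (mdeg m == N) && [forall i : 'I_n, (h <= i)%N ==> (m i == 0%N)].
      by rewrite md eqxx; apply/forallP.
    pose mm : T := Sub (BMultinom hm) hm'.
    move: um; rewrite mcoeffB mpolyXn mcoeffX -[m]/(mon mm) cF.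
    by rewrite -[(U_(j) *+ N)%MM]/(mon mj) /mon !(inj_eq val_inj) subrr eqxx.
  rewrite negb_forall => /existsP[i]; rewrite negb_imply => /andP[hi mi].
  apply/hasP; exists (i, 1%N); last by rewrite /= lt0n.
  by apply/mapP; exists i => //; rewrite mem_filter hi mem_enum.
- apply: homogeneous_ideal => //; apply: ideal_sum => [|i _]; first exact: ideal_span.
  rewrite -mul_mpolyC; apply: (idealM (ideal_span _)); apply: ideal_sum => [|f _].
    exact: ideal_span.
  by apply: (idealM (ideal_span _)); apply: mem_span; apply/mapP; exists f; rewrite ?mem_enum.
- exact: pihomogP.
Qed.
End Generic.

Section Diagonal.
Variable R : comNzRingType.
Implicit Types (q : R -> Prop).

Lemma prod_congr q (T : finType) (F G : T -> R) : ideal q ->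
  (forall i, q (F i - G i)) -> q (\prod_i F i - \prod_i G i).
Proof.
move=> iq h; elim/big_rec2: _ => [|i x y _ hxy]; first by rewrite subrr; apply: ideal0.
have -> : F i * y - G i * x = F i * (y - x) + x * (F i - G i) by ring.
by apply: idealD => //; apply: idealM => //; rewrite -opprB; apply: idealN.
Qed.

Lemma det_congr q k (A B : 'M[R]_k) : ideal q -> (forall i j, q (A i j - B i j)) ->
  q (\det A - \det B).
Proof.
move=> iq h; rewrite /determinant -sumrB; apply: ideal_sum => // sg _.
by rewrite -mulrBr; apply: idealM => //; apply: prod_congr.
Qed.

Lemma diagonal_minor q t s (A : 'M[R]_(t, s)) k (f : {ffun 'I_k -> 'I_t} * {ffun 'I_k -> 'I_s}) :
  isprime q -> (forall i j : 'I_k, (j < i)%N -> q (A (f.1 i) (f.2 j))) -> q (minor A f) ->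
  exists i, q (A (f.1 i) (f.2 i)).
Proof.
move=> pq low hq; have [iq _ _] := pq.
apply: (prime_prod (F := fun i => A (f.1 i) (f.2 i)) pq).
pose B : 'M[R]_k := \matrix_(i, j) if (j < i)%N then 0 else A (f.1 i) (f.2 j).
have -> : \prod_i A (f.1 i) (f.2 i) = \det B.
  rewrite -det_tr det_trig; last by apply/is_trig_mxP => i j ij; rewrite !mxE ij.
  by apply: eq_bigr => i _; rewrite !mxE ltnn.
apply: (ideal_subr iq _ hq); apply: det_congr => // i j; rewrite !mxE.
by case: ifP => [/low|_]; rewrite ?subr0 // subrr; apply: ideal0.
Qed.
End Diagonal.

(** * An explicit matrix with maximal grades *)

Section Example.
Variables (K : fieldType) (charK : [pchar K] =i pred0) (n t s c : nat).
Variables (a : 'I_s -> int) (b : 'I_t.+1 -> int).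
Hypothesis hd : forall i j, 0 < a j - b i.
(** With [t.+1] rows, [c] is here the codimension itself. *)
Hypothesis sE : s = (t + c)%N.
Local Notation R := {mpoly K[n.+1]}.
Local Notation D := (fun i j => absz (a j - b i)).

(** Indices beyond n give 0, so that the matrix, which names [2 * c + 2] variables, exists in fewer
    variables as well. *)
Definition var (k : nat) : R := if (k < n.+1)%N then 'X_(inord k) else 0.

(* A band matrix with [c] generic diagonals, bordered by two monomial ones. *)
Definition band_mx : 'M[R]_(t.+1, s) := \matrix_(i, j)
  if (j < i)%N then (if i == j.+1 :> nat then var (2 * c) ^+ D i j else 0)
  else let k := (j - i)%N in
    if (k < c)%N then var (c + k) ^+ D i j - ((2 ^ i)%:R : K) ^+ D i j *: var k ^+ D i j
    else if k == c then var (2 * c).+1 ^+ D i j else 0.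

Lemma var_homog k : var k \is 1.-homog.
Proof.
by rewrite /var; case: ifP => _; [rewrite dhomogX; apply/eqP; exact: mdeg1 | exact: dhomog0].
Qed.

Lemma band_mx_homogeneous : homogeneous_mx D band_mx.
Proof.
move=> i j; rewrite mxE.
have vp k e : var k ^+ e \is e.-homog by rewrite -{2}[e]mul1n; apply/dhomog_exp/var_homog.
case: ifP => _; first by case: ifP => _; [exact: vp | exact: dhomog0].
rewrite /=; case: ifP => _; first by apply: rpredB; [exact: vp | exact: rpredZ (vp _ _)].
by case: ifP => _; [exact: vp | exact: dhomog0].
Qed.

Lemma D_gt0 i j : (0 < D i j)%N.
Proof. by rewrite absz_gt0 gt_eqF ?hd. Qed.

Lemma ideal_scale (q : R -> Prop) (x : K) y : ideal q -> q y -> q (x *: y).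
Proof. by move=> iq qy; rewrite -mul_mpolyC; apply: idealM. Qed.

Lemma ideal_scaleK (q : R -> Prop) (x : K) y : ideal q -> x != 0 -> q (x *: y) -> q y.
Proof. by move=> iq x0 /(ideal_scale x^-1 iq); rewrite scalerA mulVf // scale1r. Qed.

Section Prime.
Variable q : R -> Prop.
Hypothesis pq : isprime q.
Let iq : ideal q. Proof. by case: pq. Qed.

Lemma var_pow k e : (0 < e)%N -> q (var k) -> q (var k ^+ e).
Proof. by case: e => // e _ h; rewrite exprS mulrC; apply: idealM. Qed.

Definition vars_below (k : nat) : Prop := forall (i : 'I_t.+1) (j : 'I_s), (j < i + k)%N -> q (band_mx i j).

Lemma below0 : q (var (2 * c)) -> vars_below 0.
Proof.
move=> h i j; rewrite addn0 mxE => ->; case: ifP => _; last exact: ideal0.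
exact: var_pow (D_gt0 _ _) h.
Qed.

Lemma belowS k : (k < c)%N -> q (var k) -> q (var (c + k)) -> vars_below k -> vars_below k.+1.
Proof.
move=> kc h1 h2 hb i j; rewrite addnS ltnS leq_eqVlt => /orP[/eqP e|]; last exact: hb.
rewrite mxE e ltnNge leq_addr /= addKn kc.
apply: idealB => //; first exact: var_pow (D_gt0 _ _) h2.
by apply: ideal_scale => //; exact: var_pow (D_gt0 _ _) h1.
Qed.

Lemma nat_neq0 m : (0 < m)%N -> m%:R != 0 :> K.
Proof. by move=> m0; move/(pcharf0P K): charK => ->; rewrite -lt0n. Qed.

(** Raised to the common exponent [d * e], the relations give a multiple of [Y ^+ (d * e)] by a
    difference of distinct powers of 2, nonzero in characteristic 0. This is why row i of the matrix
    carries the factor [2 ^ i]. *)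
Lemma two_roots (Y U : R) (i j d e : nat) : i != j -> (0 < d)%N -> (0 < e)%N ->
  q (U ^+ d - ((2 ^ i)%:R : K) ^+ d *: Y ^+ d) -> q (U ^+ e - ((2 ^ j)%:R : K) ^+ e *: Y ^+ e) ->
  q Y /\ q U.
Proof.
move=> ij d0 e0 h1 h2.
have hX (x y : R) m : q (x - y) -> q (x ^+ m - y ^+ m).
  by move=> h; rewrite subrXX mulrC; apply: idealM.
have := hX _ _ e h1; have := hX _ _ d h2; rewrite !exprZn -!exprM [(e * d)%N]mulnC => k2 k1.
have : q ((((2 ^ j)%:R : K) ^+ (d * e) - (2 ^ i)%:R ^+ (d * e)) *: Y ^+ (d * e)).
  rewrite scalerBl; set y1 := _ *: _ in k1 *; set y2 := _ *: _ in k2 *.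
  have -> : y2 - y1 = (U ^+ (d * e) - y1) - (U ^+ (d * e) - y2) by ring.
  exact: idealB.
move=> /ideal_scaleK-/(_ iq) h.
have qY : q Y.
  apply: (prime_exp pq); apply: h; rewrite -!natrX -!expnM subr_eq0 -subr_eq0.
  have ne : (2 ^ (j * (d * e)) != 2 ^ (i * (d * e)))%N.
    by rewrite eqn_exp2l // eqn_pmul2r ?muln_gt0 ?d0 // eq_sym.
  have [lt|lt|e'] := ltngtP (2 ^ (j * (d * e)))%N (2 ^ (i * (d * e)))%N.
  - by rewrite -opprB oppr_eq0 -natrB ?(ltnW lt) // nat_neq0 // subn_gt0.
  - by rewrite -natrB ?(ltnW lt) // nat_neq0 // subn_gt0.
  - by rewrite e' eqxx in ne.
split=> //; apply: (prime_exp (k := d) pq).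
apply: (ideal_sub iq h1); apply: ideal_scale => //.
by case: (d) d0 => // d' _; rewrite exprS mulrC; apply: idealM.
Qed.

Lemma one_root (Y : R) (i d : nat) (U : R) : (0 < d)%N -> q U ->
  q (U ^+ d - ((2 ^ i)%:R : K) ^+ d *: Y ^+ d) -> q Y.
Proof.
move=> d0 qU h; apply: (prime_exp (k := d) pq).
apply: (ideal_scaleK (x := ((2 ^ i)%:R : K) ^+ d)) => //.
  by rewrite expf_neq0 // nat_neq0 // expn_gt0.
apply: (ideal_subr iq h); case: (d) d0 => // d' _; rewrite exprS mulrC; exact: idealM.
Qed.

Lemma band_entry (k : nat) (i : 'I_t.+1) (j : 'I_s) : (k < c)%N -> j = (i + k)%N :> nat ->
  band_mx i j = var (c + k) ^+ D i j - ((2 ^ i)%:R : K) ^+ D i j *: var k ^+ D i j.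
Proof. by move=> kc e; rewrite mxE e ltnNge leq_addr /= addKn kc. Qed.

(** Once the lower diagonals vanish modulo [q], the minor on the k-th diagonal is the product of its
    entries; as [var (c + k)] is already in [q], one entry suffices for [var k]. *)
Lemma full_vars : (forall f, q (minor band_mx (k := t.+1) f)) ->
  (forall k, (c <= k)%N -> q (var k)) -> forall k, q (var k).
Proof.
move=> hm hv.
suff h k : (k <= c)%N -> vars_below k /\ forall k', (k' < k)%N -> q (var k').
  by move=> k; have [/hv //|kc] := leqP c k; have [_] := h c (leqnn _); apply.
elim: k => [|k IH] kc; first by split=> //; apply: below0; apply: hv; lia.
have [hb hk] := IH (ltnW kc).
have ks (i : 'I_t.+1) : (i + k < s)%N by have := ltn_ord i; lia.
pose f : {ffun 'I_t.+1 -> 'I_t.+1} * {ffun 'I_t.+1 -> 'I_s} :=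
  ([ffun i => i], [ffun i => Ordinal (ks i)]).
have [i j ji|i] := diagonal_minor pq _ (hm f).
  by rewrite !ffunE; apply: hb; rewrite /= ltn_add2r.
rewrite !ffunE (@band_entry k) // => h.
have qk : q (var k).
  by apply: one_root h; [exact: D_gt0 | apply: hv; lia].
split; first by apply: belowS => //; apply: hv; lia.
by move=> k'; rewrite ltnS leq_eqVlt => /orP[/eqP-> //|/hk].
Qed.

(** The subdiagonal yields [var (2 * c)], each diagonal [k < c] yields both [var k] and
    [var (c + k)] from two of its rows, and the last diagonal yields [var (2 * c).+1]. *)
Lemma corank_vars : (0 < t)%N -> (forall f, q (minor band_mx (k := t) f)) ->
  (forall k, (2 * c + 2 <= k)%N -> q (var k)) -> forall k, q (var k).
Proof.
move=> t0 hm hv.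
have ts (i : 'I_t) : (i < s)%N by have := ltn_ord i; lia.
have z0 : q (var (2 * c)).
  pose f : {ffun 'I_t -> 'I_t.+1} * {ffun 'I_t -> 'I_s} :=
    ([ffun i => lift ord0 i], [ffun i => Ordinal (ts i)]).
  have [i j ji|i] := diagonal_minor pq _ (hm f).
    rewrite !ffunE mxE lift0 /= ltnS (ltnW ji) eqSS eq_sym.
    by rewrite (ltn_eqF ji); apply: ideal0.
  by rewrite !ffunE mxE lift0 /= ltnSn eqxx => /(prime_exp pq).
have h k : (k <= c)%N -> vars_below k /\ forall k', (k' < k)%N -> q (var k') /\ q (var (c + k')).
  elim: k => [|k IH] kc; first by split=> //; exact: below0.
  have [hb hk] := IH (ltnW kc).
  have ks (i : 'I_t.+1) : (i + k < s)%N by have := ltn_ord i; lia.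
  (* The minor omitting row p is triangular modulo [q]. Omitting next the row just found produces a
     second, different row. *)
  have diag (p : 'I_t.+1) : exists i, i != p /\ q (band_mx i (Ordinal (ks i))).
    pose f : {ffun 'I_t -> 'I_t.+1} * {ffun 'I_t -> 'I_s} :=
      ([ffun i => lift p i], [ffun i => Ordinal (ks (lift p i))]).
    have [i j ji|i] := diagonal_minor pq _ (hm f).
      rewrite !ffunE; apply: hb; rewrite /= ltn_add2r /bump; lia.
    by rewrite !ffunE => h; exists (lift p i); rewrite eq_sym neq_lift.
  have [i [_ hi]] := diag ord0; have [j [ji hj]] := diag i.
  rewrite (@band_entry k) // in hi; rewrite (@band_entry k) // in hj.
  have [q1 q2] := two_roots (negbT (introF eqP (fun e => elimN eqP ji (val_inj (esym e)))))
    (D_gt0 _ _) (D_gt0 _ _) hi hj.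
  split; first exact: belowS.
  by move=> k'; rewrite ltnS leq_eqVlt => /orP[/eqP-> //|/hk].
have [hb hk] := h c (leqnn _).
have z1 : q (var (2 * c).+1).
  have cs (i : 'I_t) : (i + c < s)%N by have := ltn_ord i; lia.
  pose f : {ffun 'I_t -> 'I_t.+1} * {ffun 'I_t -> 'I_s} :=
    ([ffun i => widen_ord (leqnSn t) i], [ffun i => Ordinal (cs i)]).
  have [i j ji|i] := diagonal_minor pq _ (hm f).
    by rewrite !ffunE; apply: hb; rewrite /= ltn_add2r.
  by rewrite !ffunE mxE /= ltnNge leq_addr /= addKn ltnn eqxx => /(prime_exp pq).
move=> k; have [kc|ck] := ltnP k c; first by have [] := hk k kc.
have [k2|] := ltnP k (2 * c).
  by have [|_] := hk (k - c)%N; [lia | rewrite subnKC].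
rewrite leq_eqVlt => /orP[/eqP<- //|]; rewrite leq_eqVlt => /orP[/eqP<- //|lt].
by apply: hv; lia.
Qed.
End Prime.

Lemma later_var h k (q : R -> Prop) : ideal q -> (h <= k)%N ->
  (forall y, gen (@zero_ideal R) (later_vars K n.+1 h) y -> q y) -> q (var k).
Proof.
move=> iq hk hq; rewrite /var; case: ifP => kn; last exact: ideal0.
apply: hq; rewrite -['X_(inord k)]expr1; apply: mem_gen; first exact: ideal_zero.
apply/mapP; exists (inord k, 1%N) => //; apply/mapP; exists (inord k) => //.
by rewrite mem_filter inordK // hk mem_enum.
Qed.

Lemma band_powers k h : 
  (forall q, isprime q -> (forall f, q (minor band_mx (k := k) f)) ->
     (forall l, (h <= l)%N -> q (var l)) -> forall l, q (var l)) ->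
  forall j : 'I_n.+1, exists N, isum (span (minor_list band_mx k))
    (gen (@zero_ideal R) (later_vars K n.+1 h)) ('X_j ^+ N).
Proof.
move=> hq j; have igv : ideal (gen (@zero_ideal R) (later_vars K n.+1 h)) by exact/gen_ideal/ideal_zero.
apply: (radical_prime (@mpoly_noetherian K n.+1)) => [|q pq sub].
  by apply: ideal_isum => //; exact: ideal_span.
have [iq _ _] := pq; have -> : 'X_j = var j by rewrite /var ltn_ord inord_val.
apply: hq => // [f|l hl].
  apply: sub; apply: isum_l => //; apply: mem_span; apply/mapP; exists f => //.
  by rewrite mem_enum.
apply: later_var hl _ => // y hy; apply: sub; apply: isum_r => //; exact: ideal_span.
Qed.
End Example.

(** * Stalks *)

Local Notation "x %:F" := (tofrac x).

Section Generators.
Variable R : comNzRingType.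
Hypothesis noeth : noetherian R.
Hypothesis nat_inv : forall n, exists d : R, n.+1%:R * d = 1.

Lemma gen_span (ps : seq R) : gen (@zero_ideal R) ps = span ps.
Proof.
apply: pred_eq => u; split.
  apply: gen_min => [|_ ->|p]; [exact: ideal_span | exact: ideal0 (ideal_span _) | exact: mem_span].
apply: span_min => [|p]; [exact/gen_ideal/ideal_zero | exact/mem_gen/ideal_zero].
Qed.

(* Generators in number equal to the grade can be replaced by a regular sequence. *)
Lemma regular_generators (a : R -> Prop) ps : ideal a -> grade (size ps) (span ps) a ->
  exists ys, regs a ys /\ gen a ys = gen a ps.
Proof.
elim: ps a => [|p ps IH] a ia g; first by exists [::].
have na : nosocle (p :: ps) a by exact: (grade_nosocle (k := size ps) ia g).
have [n [ry _ _]] := avoidance noeth nat_inv ia ia ia na na na.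
have := grade_adj noeth nat_inv ia (span_mixed n (p :: ps)) ry g.
set y := mixed n (p :: ps) in ry *; move=> g'.
have iy := ideal_adj y ia.
have g2 : grade (size ps) (span ps) (adj a y).
  apply: grade_congr g' => // x [r hr]; have isp := ideal_span ps.
  exists ((x - r * p) - r * (n%:R * mixed n ps)).
    apply: (idealB isp) => //; apply: (idealM isp); apply: (idealM isp); exact: span_mixed.
  have -> : x - (x - r * p - r * (n%:R * mixed n ps)) = r * y by rewrite /y /=; ring.
  exact: mem_adj.
have [ys [rys gys]] := IH _ iy g2; exists (y :: ys); split=> //.
rewrite gen_cons gys; have ip := ideal_adj p ia.
have step z w : adj a z w -> forall u, gen (adj a w) ps u -> gen (adj a z) ps u.
  move=> hzw; have ig := gen_ideal ps (ideal_adj z ia).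
  apply: gen_min => // [u|x xs]; last by apply: mem_gen xs; exact: ideal_adj.
  apply: (adj_min ig) => [v av|]; apply: sub_gen => //; exact: sub_adj.
have step' z w : gen (adj a z) ps w -> forall u, gen (adj a w) ps u -> gen (adj a z) ps u.
  move=> hzw; have ig := gen_ideal ps (ideal_adj z ia).
  apply: gen_min => // [u|x xs]; last by apply: mem_gen xs; exact: ideal_adj.
  by apply: (adj_min ig) => // v av; apply: sub_gen; apply: sub_adj.
apply: pred_eq => u; split; apply: step'.
  have ig := gen_ideal ps ip; apply: (idealD ig).
    by apply: sub_gen; exact: mem_adj1.
  apply: (idealM ig); apply: (span_min ig) (span_mixed n ps) => x xs; exact: mem_gen.
have ig := gen_ideal ps iy; have -> : p = y - n%:R * mixed n ps by rewrite /y /=; ring.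
apply: (idealB ig); first by apply: sub_gen; exact: mem_adj1.
apply: (idealM ig); apply: (span_min ig) (span_mixed n ps) => x xs; exact: mem_gen.
Qed.
End Generators.

Section Stalk.
Variables (K : fieldType) (charK : [pchar K] =i pred0) (n : nat) (x : proj_point K n).
Local Notation R := {mpoly K[n.+1]}.
Local Notation P := (point_ideal x : {pred R}).
Local Notation S := (local_ring x).
Implicit Types (a : R -> Prop) (u v w : S).
Variable i0 : 'I_n.+1.
Hypothesis hi0 : 'X_i0 \notin P.
Let y : R := 'X_i0.

Lemma tofrac_neq0 q : q \notin P -> q%:F != 0.
Proof. by apply: contraNneq => /eqP; rewrite tofrac_eq0 => /eqP ->; exact: idealr0. Qed.

Lemma tofrac_div q : q \notin P -> q%:F / q%:F = 1.
Proof. by move/tofrac_neq0/divff. Qed.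

Lemma notinM p q : p \notin P -> q \notin P -> p * q \notin P.
Proof. by move=> hp hq; rewrite prime_idealrM negb_or hp. Qed.

Lemma y_pow d : y ^+ d \notin P /\ y ^+ d \is d.-homog.
Proof.
split; last by rewrite -{2}[d]mul1n; apply: dhomog_exp; rewrite dhomogX; apply/eqP; exact: mdeg1.
elim: d => [|d IH]; first by rewrite expr0 idealr1.
by rewrite exprS notinM.
Qed.

Lemma frac_stalk d p q : p \is d.-homog -> q \is d.-homog -> q \notin P ->
  exists u, local_val u = p%:F / q%:F.
Proof.
move=> hp hq Pq; have h : p%:F / q%:F \in @local_ring_pred K n x.
  by apply/asboolP; exists d, p, q.
by exists (LocalRing h).
Qed.

Lemma valS_D u v : local_val (u + v) = local_val u + local_val v. Proof. by []. Qed.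
Lemma valS_M u v : local_val (u * v) = local_val u * local_val v. Proof. by []. Qed.
Lemma valS_B u v : local_val (u - v) = local_val u - local_val v. Proof. by []. Qed.
Lemma valS_0 : local_val (0 : S) = 0. Proof. by []. Qed.
Definition stalk a u : Prop := exists d p q,
  [/\ p \is d.-homog, q \is d.-homog, a p, q \notin P & local_val u = p%:F / q%:F].

Lemma stalk_repr u : exists d p q,
  [/\ p \is d.-homog, q \is d.-homog, q \notin P & local_val u = p%:F / q%:F].
Proof. by case: u => u /= /asboolP[d [p [q [hp hq _ hP ->]]]]; exists d, p, q. Qed.

Lemma frac_eq (p q p' q' : R) : q \notin P -> q' \notin P ->
  p%:F / q%:F = p'%:F / q'%:F -> p * q' = p' * q.
Proof.
move=> hq hq' /eqP; rewrite eqr_div ?tofrac_neq0 // -!tofracM => /eqP h.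
by apply/eqP; rewrite -tofrac_eq; apply/eqP.
Qed.

Lemma ideal_stalkP a : ideal a -> ideal (stalk a).
Proof.
move=> ia; split.
- exists 0%N, 0, 1; split=> //; [exact: dhomog0 | exact: dhomog1 | exact: ideal0 | | ].
    by have [] := y_pow 0.
  by rewrite valS_0 tofrac0 mul0r.
- move=> u v [d [p [q [hp hq ap Pq eu]]]] [e [p' [q' [hp' hq' ap' Pq' ev]]]].
  exists (d + e)%N, (p * q' + p' * q), (q * q'); split.
  + by apply: rpredD; [exact: dhomogM | rewrite addnC; exact: dhomogM].
  + exact: dhomogM.
  + by apply: idealD => //; rewrite mulrC; apply: idealM.
  + exact: notinM.
  + by rewrite valS_D eu ev addf_div ?tofrac_neq0 // tofracD !tofracM.
- move=> r u [d [p [q [hp hq ap Pq eu]]]]; have [e [p' [q' [hp' hq' Pq' er]]]] := stalk_repr r.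
  exists (e + d)%N, (p' * p), (q' * q); split; try exact: dhomogM.
  + exact: idealM.
  + exact: notinM.
  + by rewrite valS_M eu er mulf_div !tofracM.
Qed.

(** Dehomogenization by the variable [y]; the default 0 of [insubd] is not met when [f] has degree d
    ([locE]). *)
Definition loc (d : nat) (f : R) : S :=
  insubd (0 : S) (f%:F / (y ^+ d)%:F).
Lemma locE d f : f \is d.-homog -> local_val (loc d f) = f%:F / (y ^+ d)%:F.
Proof.
move=> hf; rewrite [LHS]val_insubd ifT //; apply/asboolP; exists d, f, (y ^+ d).
by have [h1 h2] := y_pow d.
Qed.

Lemma stalk_sub a b u : (forall p, a p -> b p) -> stalk a u -> stalk b u.
Proof. by move=> ab [d [p [q [hp hq /ab bp Pq eu]]]]; exists d, p, q. Qed.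

Lemma stalk_adj a F N : ideal a -> homog_ideal a -> F \is N.-homog ->
  stalk (adj a F) = adj (stalk a) (loc N F).
Proof.
move=> ia ha hF; have [yN hyN] := y_pow N; apply: pred_eq => u; split.
  move=> [d [p [q [hp hq [r /(ha _ d) har] Pq eu]]]].
  move: har; rewrite pihomogB (pihomogM _ _ hF) (pihomog_dE hp); case: leqP => [Nd|_] har; last first.
    by apply: sub_adj; exists d, p, q; rewrite subr0 in har.
  set r' := pihomog mdeg (d - N) r in har.
  have hr' : r' \is (d - N).-homog by exact: pihomogP.
  have hrF : r' * F \is d.-homog by rewrite -(subnK Nd); apply: dhomogM.
  have hry : r' * y ^+ N \is d.-homog by rewrite -(subnK Nd); apply: dhomogM.
  have [w ew] := frac_stalk hry hq Pq; exists w; exists d, (p - r' * F), q; split=> //.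
    exact: rpredB.
  rewrite valS_B valS_M eu ew locE // mulf_div tofracB mulrBl !tofracM; congr (_ - _).
  by rewrite [X in X / _ = _]mulrAC -mulf_div (tofrac_div yN) mulr1.
move=> [w [d [p [q [hp hq ap Pq e]]]]].
have [d' [p' [q' [hp' hq' Pq' ew]]]] := stalk_repr w.
exists (d + (d' + N))%N, (p * (q' * y ^+ N) + p' * F * q), (q * (q' * y ^+ N)); split.
- apply: rpredD; first by apply: dhomogM => //; apply: dhomogM.
  by rewrite addnC; apply: dhomogM => //; apply: dhomogM.
- by apply: dhomogM => //; apply: dhomogM.
- have iF := ideal_adj F ia; apply: (idealD iF).
    by apply: sub_adj; rewrite mulrC; apply: idealM.
  by rewrite mulrC mulrA; apply: (idealM iF); exact: mem_adj1.
- by apply: notinM => //; apply: notinM.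
have -> : local_val u = local_val (u - w * loc N F) + local_val w * local_val (loc N F).
  by rewrite valS_B valS_M subrK.
rewrite e ew locE // mulf_div addf_div ?mulf_neq0 ?tofrac_neq0 //.
by rewrite tofracD !tofracM.
Qed.

Lemma stalk_gen a (L : seq (nat * R)) : ideal a -> homog_ideal a ->
  (forall p, p \in L -> p.2 \is (p.1).-homog) ->
  stalk (gen a (map snd L)) = gen (stalk a) [seq loc p.1 p.2 | p <- L].
Proof.
elim: L a => //= p L IH a ia ha h; have hp := h p (mem_head _ _).
rewrite IH ?(stalk_adj ia ha hp) //; [exact: ideal_adj | exact: homog_adj hp |].
by move=> q qL; apply: h; rewrite inE qL orbT.
Qed.

Lemma stalk_zero : stalk (@zero_ideal R) = @zero_ideal S.
Proof.
apply: pred_eq => u; split=> [[d [p [q [_ _ -> _ e]]]]|->].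
  by apply: val_inj; rewrite [LHS]e tofrac0 mul0r.
exact: ideal0 (ideal_stalkP (ideal_zero R)).
Qed.

Lemma stalk_reg a F N : ideal a -> F \is N.-homog -> reg a F -> reg (stalk a) (loc N F).
Proof.
move=> ia hF rF u [d [p [q [hp hq ap Pq e]]]]; have [yN hyN] := y_pow N.
have [d' [p' [q' [hp' hq' Pq' eu]]]] := stalk_repr u.
move: e; rewrite valS_M locE // eu mulf_div -!tofracM => /frac_eq h.
exists (d' + d)%N, (p' * q), (q' * q); split; try exact: dhomogM.
- apply: rF; rewrite mulrA h //; last exact: notinM.
  by rewrite mulrC; apply: idealM.
- exact: notinM.
by rewrite eu !tofracM -mulf_div (tofrac_div Pq) mulr1.
Qed.

Lemma stalk_regs a (L : seq (nat * R)) : ideal a -> homog_ideal a ->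
  (forall p, p \in L -> p.2 \is (p.1).-homog) ->
  regs a (map snd L) -> regs (stalk a) [seq loc p.1 p.2 | p <- L].
Proof.
elim: L a => //= p L IH a ia ha h [rp rs]; have hp := h p (mem_head _ _).
split; first exact: stalk_reg.
rewrite -(stalk_adj ia ha hp); apply: IH => //; [exact: ideal_adj | exact: homog_adj hp |].
by move=> q qL; apply: h; rewrite inE qL orbT.
Qed.

Lemma locM d e f g : f \is d.-homog -> g \is e.-homog -> loc (d + e) (f * g) = loc d f * loc e g.
Proof.
move=> hf hg; apply: val_inj; rewrite [LHS]locE ?dhomogM // [RHS]valS_M !locE //.
by rewrite mulf_div -!tofracM exprD.
Qed.
Lemma locD d f g : f \is d.-homog -> g \is d.-homog -> loc d (f + g) = loc d f + loc d g.
Proof.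
move=> hf hg; apply: val_inj; rewrite [LHS]locE ?rpredD // [RHS]valS_D !locE //.
by rewrite tofracD mulrDl.
Qed.
Lemma loc0 d : loc d 0 = 0.
Proof. by apply: val_inj; rewrite [LHS]locE ?dhomog0 // tofrac0 mul0r. Qed.

(** The largest homogeneous ideal of R whose forms dehomogenize into [b]. It determines [b], since a
    fraction [p / q] is a unit times [loc d p]. *)
Definition homogenize (b : S -> Prop) (f : R) : Prop := forall d, b (loc d (pihomog mdeg d f)).

Lemma ideal_homogenize b : ideal b -> ideal (homogenize b).
Proof.
move=> ib; split=> [d|f g hf hg d|r f hf d].
- by rewrite pihomog0 loc0; apply: ideal0.
- by rewrite pihomogD locD ?pihomogP //; apply: idealD.
rewrite (@pihomog_partitionE _ _ mdeg _ r (leqnn _)) mulr_suml linear_sum /=.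
suff : loc d (\sum_(i < mmeasure mdeg r) pihomog mdeg d (pihomog mdeg i r * f)) =
   \sum_(i < mmeasure mdeg r) loc d (pihomog mdeg d (pihomog mdeg i r * f)).
  move=> ->; apply: ideal_sum => // i _.
  have hi : pihomog mdeg i r \is i.-homog by exact: pihomogP.
  rewrite mulrC (pihomogM _ _ hi); case: leqP => [id|_]; last by rewrite loc0; apply: ideal0.
  rewrite -{1}(subnK id) locM ?pihomogP // mulrC; exact: idealM.
pose F (i : 'I_(mmeasure mdeg r)) := pihomog mdeg d (pihomog mdeg i r * f).
suff [] : \sum_i F i \is d.-homog /\ loc d (\sum_i F i) = \sum_i loc d (F i) by [].
elim/big_rec2: _ => [|i u v _ [hv <-]]; first by rewrite loc0; split=> //; exact: dhomog0.
by rewrite locD ?pihomogP //; split=> //; apply: rpredD => //; exact: pihomogP.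
Qed.

Lemma local_noetherian : noetherian S.
Proof.
apply: (noetherian_transfer (@mpoly_noetherian K n.+1) ideal_homogenize) => [a b _ _ ab f hf d|].
  exact: ab.
move=> a b ia ib ab u au; have [d [p [q [hp hq Pq eu]]]] := stalk_repr u.
have [yd hyd] := y_pow d.
have eq1 : loc d p = loc d q * u.
  apply: val_inj; rewrite [LHS]locE // [RHS]valS_M locE // eu.
  by rewrite [X in X * (p%:F / _)]mulrC mulrACA (tofrac_div Pq) mulr1 mulrC.
have hap : homogenize a p.
  move=> e; have [<-|ne] := eqVneq d e; first by rewrite (pihomog_dE hp) eq1; apply: idealM.
  by rewrite (pihomog_ne0 ne hp) loc0; apply: ideal0.
have := ab p hap d; rewrite (pihomog_dE hp) => blp.
have [w ew] := frac_stalk hyd hq Pq.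
have -> : u = w * loc d p; last exact: idealM.
apply: val_inj; rewrite [RHS]valS_M [LHS]eu ew locE //.
by rewrite [X in X * (p%:F / _)]mulrC mulrACA (tofrac_div yd) mulr1 mulrC.
Qed.

Lemma local_nat_inverse m : exists d : S, m.+1%:R * d = 1.
Proof.
have m0 : m.+1%:R != 0 :> K by move/(pcharf0P K): charK => ->.
have h : ((m.+1%:R : K)^-1)%:MP_[n.+1] \is 0%N.-homog.
  by apply/dhomogP => k; rewrite msuppC; case: ifP => // _; rewrite inE => /eqP->; exact: mdeg0.
have h1 k : (k%:R : R) \is 0%N.-homog by apply: rpredMn; exact: dhomog1.
exists (loc 0 ((m.+1%:R : K)^-1)%:MP).
have -> : (m.+1%:R : S) = loc 0 m.+1%:R.
  elim: (m.+1) => [|k IH]; first by rewrite loc0.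
  rewrite -!natr1 locD ?dhomog1 //.
  by rewrite IH; congr (_ + _); apply: val_inj; rewrite [RHS]locE ?dhomog1 // expr0 tofrac1 divr1.
rewrite -locM // addn0 -mpolyC_nat -mpolyCM mulfV // mpolyC1.
by apply: val_inj; rewrite [LHS]locE ?dhomog1 // expr0 tofrac1 divr1.
Qed.
End Stalk.

(** * Minors bordering a given (t-1)-minor *)

Section Bordered.
Variables (R : comNzRingType) (t s : nat) (A : 'M[R]_(t.+1, s)) (f2 : {ffun 'I_t -> 'I_s}).

(** The coefficients in the expansion of a bordered minor along its extra column; they are the same
    for all extra columns. *)
Definition cofactor_row (i : 'I_t.+1) : R := (-1) ^+ i * minor A ([ffun l => lift i l], f2).
Definition border (j : 'I_s) : {ffun 'I_t.+1 -> 'I_s} :=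
  [ffun l => if unlift ord0 l is Some l' then f2 l' else j].
Definition bordered_minor j : R := minor A ([ffun i => i], border j).

Lemma bordered_minorE j : bordered_minor j = \sum_i A i j * cofactor_row i.
Proof.
rewrite /bordered_minor /minor (expand_det_col _ ord0); apply: eq_bigr => i _.
rewrite !mxE !ffunE unlift_none; congr (_ * _); rewrite /cofactor /cofactor_row addn0.
by congr (_ * \det _); apply/matrixP=> k l; rewrite !mxE !ffunE liftK.
Qed.

Lemma bordered_minor0 k : bordered_minor (f2 k) = 0.
Proof.
apply/eqP; apply: contraT => /minor_inj[_ inj]; have := inj ord0 (lift ord0 k).
by rewrite !ffunE unlift_none liftK => /(_ erefl)/eqP; rewrite (negbTE (neq_lift _ _)).
Qed.

(* The cofactor row times A is the row of bordered minors; multiply by an adjugate. *)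
Lemma cofactor_minor (b : R -> Prop) i
    (h : {ffun 'I_t.+1 -> 'I_t.+1} * {ffun 'I_t.+1 -> 'I_s}) : ideal b -> (forall j, b (bordered_minor j)) ->
  injective h.1 -> b (cofactor_row i * minor A h).
Proof.
move=> ib hb h_inj; pose C : 'rV[R]_t.+1 := \row_k cofactor_row (h.1 k).
pose B := mxsub h.1 h.2 A.
have hC l : (C *m B) 0 l = bordered_minor (h.2 l).
  rewrite bordered_minorE mxE [RHS](reindex_inj h_inj); apply: eq_bigr => k _.
  by rewrite !mxE mulrC.
have /codomP[k ->] : i \in codom h.1 by rewrite (inj_card_onto h_inj).
have -> : cofactor_row (h.1 k) * minor A h = (C *m B *m \adj B) 0 k.
  by rewrite -mulmxA mul_mx_adj mul_mx_scalar !mxE mulrC.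
by rewrite mxE; apply: ideal_sum => // l _; rewrite hC mulrC; apply: idealM.
Qed.

Lemma minor_cofactor (f1 : {ffun 'I_t -> 'I_t.+1}) : injective f1 ->
  exists i (e : bool), minor A (f1, f2) = (-1) ^+ e * cofactor_row i.
Proof.
move=> f1_inj; have [i iN] : exists i, i \notin codom f1.
  apply/existsP; apply: contraT; rewrite negb_exists => /forallP h.
  have : (#|'I_t.+1| <= #|codom f1|)%N.
    by apply: subset_leq_card; apply/subsetP => k _; have := h k; rewrite negbK.
  by rewrite (card_codom f1_inj) !card_ord ltnn.
have lk k : i != f1 k by apply: contraNneq iN => ->; apply: codom_f.
pose sg k := odflt k (unlift i (f1 k)).
have sgE k : lift i (sg k) = f1 k.
  by rewrite /sg; case: unliftP (lk k) => [l -> _|->]; rewrite ?liftK ?eqxx.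
have sg_inj : injective sg by move=> k l e; apply: f1_inj; rewrite -!sgE e.
exists i, (perm sg_inj (+) odd i); rewrite /cofactor_row mulrA signr_addb signr_odd.
rewrite -[_ * _ * (-1) ^+ i]mulrA -expr2 sqrr_sign mulr1.
rewrite /minor -det_perm -det_mulmx -row_permE; congr (\det _).
by apply/matrixP=> k l; rewrite !mxE !ffunE permE sgE.
Qed.
End Bordered.

Lemma regs_nth (R : comNzRingType) (a : R -> Prop) s i : regs a s -> (i < size s)%N ->
  reg (gen a (take i s)) s`_i.
Proof.
move=> rs lt; move: rs; rewrite -{1}(cat_take_drop i s) => /regs_cat[_].
by rewrite (drop_nth 0 lt) => -[].
Qed.

Lemma regular_seq_ring (R : comNzRingType) (s : seq R) : regs (@zero_ideal R) s ->
  ~ gen (@zero_ideal R) s 1 -> regular_seq (R^o) s.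
Proof.
move=> rs n1; split=> [i lt y|].
  move=> h; apply: (ideal_smul_gen (take i s) y).2.
  exact: (@regs_nth _ _ _ _ rs lt _ ((ideal_smul_gen _ _).1 h)).
by exists (1 : R); apply/negP => h; apply: n1; exact: (ideal_smul_gen _ _).1 h.
Qed.

Lemma ideal_genP (R : comNzRingType) (s : seq R) u :
  u \in ideal_gen (fun y => y \in s) <-> gen (@zero_ideal R) s u.
Proof.
have iz := ideal_zero R; have ig := gen_ideal s iz; split.
  apply: (submod_gen_min (V := R^o) (P := gen (@zero_ideal R) s)) => [|r y z hy hz|y ys].
  - exact: ideal0 ig.
  - by apply: (idealD ig) => //; apply: (idealM ig).
  - exact: mem_gen.
apply: (gen_min (b := fun y : R => y \in ideal_gen (fun y => y \in s))) => [|_ ->|y ys].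
- exact: (ideal_submod (submod_gen (V := R^o) (fun y => y \in s))).
- exact: (ideal0 (ideal_submod (submod_gen (V := R^o) (fun y => y \in s)))).
- exact: (mem_submod_gen (V := R^o)).
Qed.

Section LocalCompleteIntersection.
Variables (K : fieldType) (charK : [pchar K] =i pred0) (n t s c : nat).
Variables (a : 'I_s -> int) (b : 'I_t.+1 -> int).
Hypothesis hd : forall i j, 0 < a j - b i.
Hypothesis sE : s = (t + c)%N.
Local Notation R := {mpoly K[n.+1]}.
Local Notation D := (fun i j => absz (a j - b i)).
Variables (A : 'M[R]_(t.+1, s)) (hA : homogeneous_mx D A).
Local Notation IA := (span (minor_list A t.+1)).
Variables (Fs : seq R) (N : nat).
Hypothesis Fs_size : size Fs = c.
Hypothesis FsP : forall F, F \in Fs -> IA F /\ F \is N.-homog.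
Hypothesis Fs_regs : regs (@zero_ideal R) Fs.
Variables (x : proj_point K n) (f0 : {ffun 'I_t -> 'I_t.+1} * {ffun 'I_t -> 'I_s}).
Hypothesis xI : forall f, IA f -> f \in (point_ideal x : {pred R}).
Hypothesis xJ : minor A f0 \notin (point_ideal x : {pred R}).

Lemma lci_at_corank1 (I : {pred R}) : (forall f, f \in I <-> IA f) -> lci_at x I.
Proof.
move=> hI; have [i0 hi0] := point_relevant x; pose P := (point_ideal x : {pred R}).
have nz : minor A f0 != 0 by apply: contraNneq xJ => ->; exact: idealr0.
have [f1_inj f2_inj] := minor_inj nz.
have [i [e ei]] := minor_cofactor A f0.2 f1_inj.
have iI := ideal_span (minor_list A t.+1); have iz := ideal_zero R.
pose g := cofactor_row A f0.2 i.
have gP : g \notin P.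
  by apply: contra xJ => h; rewrite [f0]surjective_pairing ei; apply: idealMr.
pose d0 := (\sum_l D ([ffun l => lift i l] l) (f0.2 l))%N.
have g_homog : g \is d0.-homog.
  rewrite /g /cofactor_row -signr_odd; have h := homogeneous_minor hd ([ffun l => lift i l], f0.2) hA.
  by case: (odd i); rewrite ?mulN1r ?mul1r ?rpredN.
pose deg j := (\sum_l D ([ffun l => l] l) (border f0.2 j l))%N.
pose L := [seq (deg j, bordered_minor A f0.2 j) | j <- enum [predC codom f0.2]].
have L_size : size L = c.
  rewrite size_map -cardE; have := cardC (mem (codom f0.2)); rewrite card_ord.
  rewrite [X in (X + _)%N](_ : _ = #|codom f0.2|) // (card_codom f2_inj) card_ord => h.
  exact: (@addnI t _ _ (etrans h sE)).
have L_homog p : p \in L -> p.2 \is (p.1).-homog.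
  by move=> /mapP[j _ ->]; exact: (homogeneous_minor hd ([ffun l => l], border f0.2 j) hA).
pose bd := gen (@zero_ideal R) (map snd L); have ibd : ideal bd by exact: gen_ideal.
have bdI f : bd f -> IA f.
  apply: (gen_min iI) => [u ->|_ /mapP[_ /mapP[j _ ->] ->]]; first exact: ideal0.
  by apply: mem_span; apply/mapP; exists ([ffun l => l], border f0.2 j); rewrite ?mem_enum.
have bd_border j : bd (bordered_minor A f0.2 j).
  have [/codomP[k ->]|jN] := boolP (j \in codom f0.2).
    by rewrite bordered_minor0; apply: ideal0.
  apply: mem_gen => //; apply/mapP; exists (deg j, bordered_minor A f0.2 j) => //.
  by apply: map_f; rewrite mem_enum.
have gI f : IA f -> bd (g * f).
  move=> hf; rewrite mulrC; apply: (span_min (ideal_colon g ibd)) hf => _ /mapP[h _ ->].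
  rewrite /colon mulrC; have [->|nzh] := eqVneq (minor A h) 0; first by rewrite mulr0; apply: ideal0.
  exact: cofactor_minor ibd bd_border (minor_inj nzh).1.
pose y : R := 'X_i0; pose ls := [seq loc x i0 p.1 p.2 | p <- L].
have stalkE : stalk (x := x) IA = gen (@zero_ideal _) ls.
  rewrite -(stalk_zero hi0) -(stalk_gen hi0 iz (@homog_zero K n.+1) L_homog).
  apply: pred_eq => u; split; last exact: stalk_sub.
  move=> [d [p [q [hp hq Ip Pq eu]]]]; exists (d0 + d)%N, (g * p), (g * q).
  split; try exact: dhomogM; [exact: gI | exact: notinM |].
  by rewrite eu (tofracM g p) (tofracM g q) -mulf_div (tofrac_div gP) mul1r.
pose LF := [seq (N, F) | F <- Fs].
have LF_homog p : p \in LF -> p.2 \is (p.1).-homog.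
  by move=> /mapP[F /FsP[_ hF] ->].
have rLF : regs (@zero_ideal _) [seq loc x i0 p.1 p.2 | p <- LF].
  rewrite -(stalk_zero hi0); apply: stalk_regs => //; first exact: homog_zero.
  by rewrite -map_comp map_id.
(* The grade comes from [Fs], which stays regular in the stalk and has as many terms as there are
   bordered minors with a column outside [f0.2]. *)
have gr : grade (size ls) (span ls) (@zero_ideal _).
  rewrite size_map L_size -Fs_size.
  have -> : size Fs = (size [seq loc x i0 p.1 p.2 | p <- LF] + 0)%N by rewrite addn0 !size_map.
  apply: regs_grade => // _ /mapP[p + ->] => /mapP[F FF ->] /=; have [IF hF] := FsP FF.
  rewrite -gen_span -stalkE; have [yP hy] := y_pow hi0 N.
  by exists N, F, (y ^+ N); split=> //; exact: locE.
have [ys [rys gys]] := regular_generators (local_noetherian hi0) (local_nat_inverse charK hi0)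
  (ideal_zero _) gr.
exists ys.
  (* Properness: [1 = p / q] would force [p = q], with [p] in the ideal of the point and [q] outside
     it. *)
  apply: regular_seq_ring => //; rewrite gys -stalkE => -[d [p [q [_ _ /xI Pp Pq]]]].
  rewrite [LHS](_ : _ = 1) // => e1; have := frac_eq (p := 1) (q := 1) (p' := p) (q' := q) (x := x).
  rewrite tofrac1 divr1 idealr1 => /(_ isT Pq e1); rewrite mul1r mulr1 => eqp.
  by rewrite eqp Pp in Pq.
move=> u; apply/idP/idP.
  move=> /ideal_genP; rewrite gys -stalkE => -[d [p [q [hp hq Ip Pq eu]]]].
  by apply/asboolP; exists d, p, q; split=> //; apply/hI.
move=> /asboolP[d [p [q [hp hq Ip Pq eu]]]]; apply/ideal_genP; rewrite gys -stalkE.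
by exists d, p, q; split=> //; apply/hI.
Qed.
End LocalCompleteIntersection.

(** * The depth of I/I^2 *)

Lemma grade_gen (R : comNzRingType) (ps s : seq R) k a : noetherian R ->
  (forall n, exists d : R, n.+1%:R * d = 1) -> ideal a ->
  regs a s -> (forall x, x \in s -> span ps x) ->
  grade (size s + k) (span ps) a -> grade k (span ps) (gen a s).
Proof.
move=> noeth nat_inv; elim: s a => //= x s IH a ia [rx rs] sP g.
apply: IH => //; [exact: ideal_adj | by move=> y ys; apply: sP; rewrite inE ys orbT |].
by apply: (grade_adj noeth nat_inv) => //; apply: sP; rewrite mem_head.
Qed.

Lemma minor_laplace (R : comNzRingType) t s (A : 'M[R]_(t, s)) k f :
  span (minor_list A k.+1) f -> span (minor_list A k) f.
Proof.
have isp := ideal_span (minor_list A k).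
apply: (span_min isp) => _ /mapP[h _ ->]; rewrite /minor (expand_det_row _ ord0).
apply: ideal_sum => // j _; apply: (idealM isp); rewrite /cofactor; apply: (idealM isp).
apply: mem_span; apply/mapP.
exists ([ffun l => h.1 (lift ord0 l)], [ffun l => h.2 (lift j l)]); first by rewrite mem_enum.
by congr (\det _); apply/matrixP=> i l; rewrite !mxE !ffunE.
Qed.

Section Irrelevant.
Variables (K : fieldType) (n : nat).
Local Notation R := {mpoly K[n.+1]}.
Local Notation ms := (later_vars K n.+1 0).
Local Notation zero := (@zero_ideal R).

Lemma span_vars (f : R) : span ms f <-> f@_0%MM = 0.
Proof.
rewrite -gen_span; split=> [/gen_powers h|f0].
  apply/eqP; apply: contraT => /h/hasP[p /mapP[i _ ->]] /=.
  by rewrite mnm0E.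
apply/gen_powers => m um; have /existsP[i mi] : [exists i, m i != 0%N].
  apply: contraNT um; rewrite negb_exists => /forallP h.
  rewrite (_ : m = 0%MM) ?f0 //; apply/mnmP=> i; rewrite mnm0E.
  by have := h i; rewrite negbK => /eqP.
apply/hasP; exists (i, 1%N); last by rewrite /= lt0n.
by apply/mapP; exists i => //; rewrite mem_filter mem_enum.
Qed.

Lemma irrelevantP (f : R) : f \in @irrelevant K n <-> span ms f.
Proof.
have isp := ideal_span ms; split.
  apply: (submod_gen_min (V := R^o) (P := span ms)) => [|r x y hx hy|_ [i _ <-]].
  - exact: ideal0.
  - by apply: (idealD isp) => //; apply: (idealM isp).
  apply/span_vars; rewrite mcoeffX; case: eqP => // /mnmP/(_ i).
  by rewrite mnm1E eqxx mnm0E.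
apply: (span_min (b := fun f : R => f \in @irrelevant K n)) => [|_ /mapP[p /mapP[i _ ->] ->]].
  exact: (ideal_submod (submod_gen (V := R^o) (fun y => exists2 i, True & 'X_i = y))).
by rewrite expr1; apply: (mem_submod_gen (V := R^o)); exists i.
Qed.

Lemma regs_vars : regs (@zero_ideal R) ms.
Proof.
apply: regs_powers; rewrite -map_comp map_id; exact: filter_uniq (enum_uniq _).
Qed.
Lemma size_vars : size ms = n.+1.
Proof.
rewrite /later_vars /powers; set l := [seq k <- _ | _].
have -> : l = enum 'I_n.+1 by apply/all_filterP/allP.
by rewrite (size_map _ [seq (k, 1%N) | k <- _]) (size_map _ (enum _)) size_enum_ord.
Qed.

Lemma grade_vars : grade n.+1 (span ms) (@zero_ideal R).
Proof.
have := @regs_grade R zero ms 0 (span ms) regs_vars (@mem_span _ ms) I.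
by rewrite addn0 size_vars.
Qed.
End Irrelevant.

Section Main.
Variables (K : fieldType) (charK : [pchar K] =i pred0) (n t s c : nat).
Variables (a : 'I_s -> int) (b : 'I_t.+2 -> int).
Hypothesis hd : forall i j, 0 < a j - b i.
Hypothesis sE : s = (t.+1 + c.+2)%N.
Hypothesis hn : (2 * c + 2 <= n)%N.
Local Notation R := {mpoly K[n.+1]}.
Local Notation D := (fun i j => absz (a j - b i)).
Variables (A : 'M[R]_(t.+2, s)) (hA : homogeneous_mx D A).
Local Notation IA := (span (minor_list A t.+2)).
Local Notation JA := (span (minor_list A t.+1)).
Local Notation ms := (later_vars K n.+1 0).
Local Notation zero := (@zero_ideal R).
Variables (Fs : seq R) (N : nat).
Hypothesis Fs_size : size Fs = c.+2.
Hypothesis FsP : forall F, F \in Fs -> IA F /\ F \is N.-homog.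
Hypothesis Fs_regs : regs zero Fs.
(** [2 * c + 6] is twice the codimension [c.+2] plus 2, the generic codimension of the (t-1)-minors;
    [n.+1] is the grade of m. *)
Hypothesis gJ : grade (minn n.+1 (2 * c + 6)) JA zero.
Variables (I : submodClosed R^o) (J : {pred R}).
Hypothesis hI : forall f, f \in I <-> IA f.
Hypothesis hJ : forall f, f \in J <-> JA f.

Let noeth : noetherian R. Proof. exact: mpoly_noetherian. Qed.

Lemma nat_unit_mpoly m : m.+1%:R \is a @GRing.unit R.
Proof.
have m0 : m.+1%:R != 0 :> K by move/(pcharf0P K): charK => ->.
by rewrite -mpolyC_nat; apply: rmorph_unit; rewrite unitfE.
Qed.
Let nu := nat_unit_mpoly.

Let sE' : s.+1 = (t.+2 + c.+2)%N. Proof. by rewrite sE. Qed.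

Lemma JA_vars f : JA f -> span ms f.
Proof.
apply: span_min (ideal_span _) _ _ => _ /mapP[h _ ->]; apply/span_vars.
apply: (dhomog_nemf_coeff (homogeneous_minor hd h hA)).
rewrite /= mdeg0 big_ord_recl /= eq_sym -lt0n ltn_addr //.
by rewrite absz_gt0 gt_eqF ?hd.
Qed.
Lemma IA_vars f : IA f -> span ms f.
Proof. by move/minor_laplace/JA_vars. Qed.

Lemma A_vars i j : span ms (A i j).
Proof.
apply/span_vars; apply: (dhomog_nemf_coeff (hA i j)).
by rewrite /= mdeg0 eq_sym -lt0n absz_gt0 gt_eqF ?hd.
Qed.

Lemma P1E f : f \in I <-> span (minor_power A 1) f.
Proof. by rewrite hI; split=> /span_minor_power1. Qed.

Lemma acyclic_zero : acyclic c A zero.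
Proof.
apply: (acyclic0 nu sE' (ltn0Sn _)).
  have := @regs_grade R zero Fs 0 IA Fs_regs; rewrite addn0 Fs_size.
  by apply => // F /FsP[].
by apply: grade_le gJ; rewrite leq_min; lia.
Qed.

(* Nakayama: the elements of least order in I are not in (s) I + I^2. *)
Lemma cn_proper q : (forall x, x \in q -> span ms x) ->
  exists2 y, span (minor_power A 1) y & ~ cn A q y.
Proof.
move=> qP; have [F [IF F0]] : exists F, IA F /\ F != 0.
  case E : Fs Fs_size => [//|F Fs'] _; exists F; split; first by case: (FsP (F := F)); rewrite ?E ?mem_head.
  have := Fs_regs; rewrite E => -[rF _]; apply/negP => /eqP e.
  by have /eqP := rF 1 (etrans (congr1 (fun z => z * 1) e) (mul0r 1)); rewrite oner_eq0.
have ex : exists d, `[< exists f m, [/\ IA f, f@_m != 0 & mdeg m = d] >].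
  by exists (mdeg (mlead F)); apply/asboolP; exists F, (mlead F); rewrite mleadc_eq0.
case: (ex_minnP ex) => d /asboolP[f [m [If fm md]]] dmin.
have low g k : IA g -> (mdeg k < d)%N -> g@_k = 0.
  move=> Ig kd; apply/eqP; apply: contraT => gk.
  have /dmin : `[< exists f m, [/\ IA f, f@_m != 0 & mdeg m = mdeg k] >].
    by apply/asboolP; exists g, k.
  by rewrite leqNgt kd.
pose small (g : R) : Prop := forall k : 'X_{1..n.+1}, (mdeg k <= d)%N -> g@_k = 0.
have addl x y z : z = (x + y)%N -> (y <= z)%N by move->; exact: leq_addl.
have addlt x y z : x != 0%N -> z = (x + y)%N -> (y < z)%N by lia.
have ism : ideal small.
  split=> [k _|x y hx hy k kd|r x hx k kd]; first by rewrite mcoeff0.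
    by rewrite mcoeffD hx // hy // addr0.
  rewrite mcoeffM big1 // => l /eqP e; rewrite hx ?mulr0 //.
  by apply: leq_trans kd; have := congr1 mdeg e; rewrite mdegD; exact: addl.
have mul_small p g : span ms p -> IA g -> small (p * g).
  move=> /span_vars p0 Ig k kd; rewrite mcoeffM big1 // => l /eqP e.
  have [l0|l0] := eqVneq (l.1 : 'X_{1..n.+1}) 0%MM; first by rewrite l0 p0 mul0r.
  rewrite (low g l.2) ?mulr0 //; apply: leq_trans kd; have := congr1 mdeg e; rewrite mdegD; apply: addlt.
  by rewrite mdeg_eq0.
exists f; first exact/span_minor_power1.
suff h y : cn A q y -> small y by move=> /h/(_ m); rewrite md leqnn => /(_ isT) e; rewrite e eqxx in fm.
elim/last_ind: q qP y => [|q x IH] qP y.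
  apply: I2_sub => // u v /span_minor_power1 hu /span_minor_power1 hv.
  exact: mul_small (IA_vars hu) hv.
move=> /cn_rcons[v /span_minor_power1 hv h]; rewrite -[y](subrK (v * x)); apply: (idealD ism).
  by apply: IH h => z zq; apply: qP; rewrite mem_rcons inE zq orbT.
by rewrite mulrC; apply: mul_small hv; apply: qP; rewrite mem_rcons mem_head.
Qed.

Lemma good_regular q : good_seq A q -> (forall x, x \in q -> span ms x) ->
  regular_seq (conormal I) q.
Proof.
by move=> gq qP; apply/(regular_seqP P1E); split; [exact: good_creg | exact: cn_proper].
Qed.

(** Otherwise m would have grade n+2. Exchanging regular elements for the n+1 variables would leave
    a regular element in m on R/m, forcing 1 into m. *)
Lemma no_socle_bound q : regs zero q -> (forall x, x \in q -> span ms x) ->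
  size q = n.+1 -> ~ nosocle ms (gen zero q).
Proof.
move=> rq qP sq nq; have iz := ideal_zero R; have iq := gen_ideal q iz.
have [m [rx _ _]] := avoidance noeth (nat_inverse nu) iq iq iq nq nq nq.
have g : grade (n.+1 + 1) (span ms) zero.
  have := @regs_grade R zero q 1 (span ms) rq qP; rewrite sq; apply.
  by exists (mixed m ms); split=> //; exact: span_mixed.
have [|x [px rx' _]] := @grade_gen R ms ms 1 zero noeth (nat_inverse nu) iz (regs_vars K n) (@mem_span _ ms).
  by rewrite size_vars.
have : span ms 1 by rewrite -gen_span; apply: rx'; rewrite mulr1 gen_span.
by move/span_vars/eqP; rewrite mcoeff1 eqxx oner_eq0.
Qed.

(** A good sequence of length k exists since the grade exceeds the length [2 * c + 3] by k; it is
    maximal by [creg_bound], because then all of the grade n+1 of m is used up. *)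
Lemma conormal_is_depth (p : {pred R}) (ps : seq R) k : (2 * c + 3 + k)%N = n.+1 ->
  (forall f, f \in p <-> span ps f) -> (forall f, span ps f -> span ms f) ->
  grade (2 * c + 3 + k) (span ps) zero -> is_depth p (conormal I) k.
Proof.
move=> kn hp pm g; have [|q [sq qP gq aq grq]] := @good_seq_exists _ _ _ _ nu noeth sE' (ltn0Sn _) A ps k 0 acyclic_zero.
  by rewrite addn0.
have qm x : x \in q -> span ms x by move=> /qP/pm.
have iq := gen_ideal q (ideal_zero R).
exists q => //; split; [by move=> x /qP/hp | exact: good_regular |].
move=> f /hp/pm mf /(regular_seqP P1E)[/creg_rcons[_ hf] _].
apply: (@creg_bound _ _ _ _ nu noeth sE' (ltn0Sn _) A q ms f isT gq aq _ A_vars qm _ mf hf).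
  by rewrite addn0 in grq; apply: grade_sub grq.
by move=> q' rq' q'P sq'; apply: no_socle_bound => //; rewrite sq' sq -kn addnC.
Qed.

Lemma conormal_depth_ge (p : {pred R}) k : (2 * c + 3 + k <= minn n.+1 (2 * c + 6))%N ->
  (forall f, JA f -> f \in p) -> depth_ge p (conormal I) k.
Proof.
move=> kn hp; have [|q [sq qP gq aq grq]] :=
  @good_seq_exists _ _ _ _ nu noeth sE' (ltn0Sn _) A (minor_list A t.+1) k 0 acyclic_zero.
  by rewrite addn0; apply: grade_le gJ.
rewrite -sq; apply: (max_extension P1E noeth); first by move=> x /qP/hp.
by apply: good_regular => // x /qP/JA_vars.
Qed.

Lemma depth_irrelevant : is_depth (@irrelevant K n) (conormal I) (n + 2 - 2 * c.+2).
Proof.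
have e : (2 * c + 3 + (n + 2 - 2 * c.+2))%N = n.+1 by lia.
apply: conormal_is_depth (e) (@irrelevantP K n) _ _ => //; rewrite e; exact: grade_vars.
Qed.

Lemma depth_J_small : (n <= 2 * c.+2)%N -> is_depth J (conormal I) (n + 2 - 2 * c.+2).
Proof.
move=> nc; have e : (2 * c + 3 + (n + 2 - 2 * c.+2))%N = n.+1 by lia.
apply: (conormal_is_depth e hJ JA_vars); apply: grade_le gJ; lia.
Qed.

Lemma depth_J_large : (2 * c.+2 + 1 <= n)%N -> depth_ge J (conormal I) 3.
Proof. by move=> nc; apply: conormal_depth_ge => [|f /hJ //]; lia. Qed.

Lemma lci_locus : (2 * c.+2 <= n)%N ->
  exists Z : proj_point K n -> Prop, [/\ proj_closed Z, (forall x, Z x -> proj_zeros (I : {pred R}) x),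
    lci_outside (I : {pred R}) Z & depth_ge (vanishing_ideal Z) (conormal I) 2].
Proof.
move=> nc; pose Z (x : proj_point K n) : Prop :=
  forall f, f \in minor_list A t.+1 -> f \in (point_ideal x : {pred R}).
have ZJ x : Z x -> forall f, JA f -> f \in (point_ideal x : {pred R}).
  move=> hx; apply: span_min => //; split=> [|u v hu hv|r u hu]; first exact: idealr0.
    exact: rpredD.
  exact: idealMr.
exists Z; split.
- exists (fun f => f \in minor_list A t.+1) => // f /mapP[h _ ->].
  by exists (\sum_i absz (a (h.2 i) - b (h.1 i)))%N; exact: (homogeneous_minor hd h hA).
- by move=> x /ZJ h f /hI/minor_laplace/h.
- move=> x hx nZ; have [h hP] : exists h, minor A (k := t.+1) h \notin (point_ideal x : {pred R}).
    apply: contrapT => nh; apply: nZ => _ /mapP[h _ ->].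
    by apply: contrapT => /negP hn'; apply: nh; exists h.
  apply: (lci_at_corank1 charK hd sE hA Fs_size FsP Fs_regs _ hP) => // f /hI hf.
  exact: hx.
(* Elements of J vanish on [Z], so a regular sequence of length 2 in J also lies in the vanishing
   ideal. *)
- apply: conormal_depth_ge => [|f Jf]; first by rewrite leq_min; lia.
  apply/andP; split; first by apply/irrelevantP; exact: JA_vars.
  by apply/asboolP => x /ZJ; apply.
Qed.
End Main.

(* Imported only here because it shadows [set0], [setD1K] and other names of finset. *)
From mathcomp Require Import classical_sets.
Local Open Scope classical_set_scope.

Lemma generic_minors (K : fieldType) (n t s : nat) (a : 'I_s -> int) (b : 'I_t -> int)
    (hd : forall i j, 0 < a j - b i) k h (A0 : 'M[{mpoly K[n]}]_(t, s)) :
  (h <= n)%N ->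
  (forall j : 'I_n, (j < h)%N -> exists N, isum (span (minor_list A0 k))
     (gen (@zero_ideal {mpoly K[n]}) (later_vars K n h)) ('X_j ^+ N)) ->
  exists f : 'M[{mpoly K[n]}]_(t, s) -> K, [/\ polynomial_fun f, f A0 != 0 &
    forall A, homogeneous_mx (fun i j => absz (a j - b i)) A -> f A != 0 ->
    exists N Fs, [/\ size Fs = h,
      forall F, F \in Fs -> span (minor_list A k) F /\ F \is N.-homog &
      regs (@zero_ideal {mpoly K[n]}) Fs]].
Proof.
move=> hn /(generic_powers hd)[f [pf f0 hf]]; exists f; split=> // A hA fA.
have [N N0 hN] := hf A hA fA; exists N.
have /choice[F hF] : forall j : 'I_n, exists F : {mpoly K[n]}, (j < h)%N ->
    [/\ span (minor_list A k) F, F \is N.-homog &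
     gen (@zero_ideal {mpoly K[n]}) (later_vars K n h) (F - 'X_j ^+ N)].
  move=> j; have [/hN[F hF]|jh] := boolP (j < h)%N; first by exists F.
  by exists 0.
exact: (regs_of_powers hn N0 hF).
Qed.

Theorem proposition4p1 (K : closedFieldType) (charK : [pchar K] =i pred0)
    (n c t : nat) (a : 'I_(t + c).-1 -> int) (b : 'I_t -> int)
    (hc : (2 <= c)%N) (ht : (2 <= t)%N) (hd : forall i j, 0 < a j - b i)
    (hn : (2 * c - 2 <= n)%N) :
  exists U : set 'M[{mpoly K[n.+1]}]_(t, (t + c).-1),
    [/\ zariski_open (fun i j => absz (a j - b i)) U, U !=set0 &
        forall A, U A ->
        let I := minors_ideal t A in
        let J := minors_ideal t.-1 A in
        standard_determinantal A ->
        [/\ is_depth (@irrelevant K n) (conormal I) (n + 2 - 2 * c),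
            ((2 * c + 1 <= n)%N -> depth_ge J (conormal I) 3) /\
            ((n <= 2 * c)%N -> is_depth J (conormal I) (n + 2 - 2 * c)) &
            (2 * c <= n)%N ->
            exists Z : set (proj_point K n),
              [/\ proj_closed Z, Z `<=` proj_zeros I, lci_outside I Z &
                  depth_ge (vanishing_ideal Z) (conormal I) 2]]].
Proof.
(* From here on the codimension is [c.+2] and the matrix has [t.+2] rows. *)
case: c a hc hn hd => [|[|c]] // a _ hn; case: t a b ht => [|[|t]] // a b _ hd.
have hn' : (2 * c + 2 <= n)%N by lia.
pose s := (t.+2 + c.+2).-1; have sE : s = (t.+1 + c.+2)%N by [].
pose A0 := @band_mx K n t.+1 s c.+2 a b.
have [|j _|fI [pI fI0 hfI]] := @generic_minors K n.+1 t.+2 s a b hd t.+2 c.+2 A0; first lia.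
  by apply: band_powers => q pq; apply: (full_vars charK hd sE pq).
have [|j _|fJ [pJ fJ0 hfJ]] :=
  @generic_minors K n.+1 t.+2 s a b hd t.+1 (minn n.+1 (2 * c + 6)) A0; first exact: geq_minl.
  apply: band_powers => q pq qm qv; apply: (corank_vars charK hd sE pq) => // l hl.
  by apply: qv; rewrite geq_min; apply/orP; right; lia.
(* The product imposes the grade conditions on I and J together; the band matrix satisfies both, so
   the open set is not empty. *)
exists [set A | homogeneous_mx (fun i j => absz (a j - b i)) A /\ fI A * fJ A != 0]; split.
- exists [set f | f = fun A => fI A * fJ A]; first by move=> _ ->; exact: polynomial_funM.
  by apply/seteqP; split=> A /= [hA fA]; split=> //; [exists (fun A => fI A * fJ A) | case: fA => _ ->].
- exists A0; split; first exact: band_mx_homogeneous.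
  by rewrite mulf_neq0.
move=> A [hA]; rewrite mulf_eq0 negb_or => /andP[fIA fJA] I J _.
have [N [Fs [Fs_size FsP Fs_regs]]] := hfI A hA fIA.
have [N' [Gs [Gs_size GsP Gs_regs]]] := hfJ A hA fJA.
have gJ : grade (minn n.+1 (2 * c + 6)) (span (minor_list A t.+1)) (@zero_ideal {mpoly K[n.+1]}).
  by rewrite -Gs_size -[size Gs]addn0; apply: regs_grade Gs_regs _ _ => // G /GsP[].
have hI f : f \in I <-> span (minor_list A t.+2) f := minors_idealP A t.+2 f.
have hJ f : f \in (J : {pred _}) <-> span (minor_list A t.+1) f := minors_idealP A t.+1 f.
split; [|split|].
- exact: (depth_irrelevant charK hd sE hn' hA Fs_size FsP Fs_regs gJ hI).
- exact: (depth_J_large charK hd sE hn' hA Fs_size FsP Fs_regs gJ hI hJ).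
- exact: (depth_J_small charK hd sE hn' hA Fs_size FsP Fs_regs gJ hI hJ).
- exact: (lci_locus charK hd sE hn' hA Fs_size FsP Fs_regs gJ hI).
Qed.
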